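(* Consider the series $$\sum_{m=1}^\infty\ \sum_{p=0}^{m-1}\genfrac{\{}{\}}{0pt}{}{p+m-1}{p}_{\ge 2}(-1)^{p+m-1}\,\frac{\zeta^{p+m}\tau^m}{m!},\qquad \zeta=\frac1{1+\sigma},$$ in the case $\alpha=1$, i.e. with $\sigma=1/\ln z$ and $\tau=\ln\ln z/\ln z=-\sigma\ln\sigma$, regarded as a power series in $\tau$ with parameter $\sigma$. For complex $\sigma$, the radius of convergence of this series is $$\tau_\ast(\sigma)=\left|1+\sigma-\sigma\ln\sigma-i\pi\sigma\right|\quad\text{when }\operatorname{Im}\sigma<0,$$ $$\tau_\ast(\sigma)=\left|1+\sigma-\sigma\ln\sigma+i\pi\sigma\right|\quad\text{when }\operatorname{Im}\sigma>0.$$ In the complex $z$-plane this is equivalent to the following: the series (for the Lambert $W$ function) is convergent everywhere in the exterior of the boundary line defined by the equation $$\left|-\sigma\ln\sigma\right|=\left|1+\sigma-\sigma\ln\sigma\pm i\pi\sigma\right|,\qquad \sigma=1/\ln z,$$ where the sign minus is taken in the upper half-plane of $z$ and the sign plus in the lower half-plane of $z$.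
   Context: $\ln$ denotes the principal branch of the natural logarithm. $\genfrac{\{}{\}}{0pt}{}{n}{k}_{\ge 2}$ is the 2-associated Stirling subset number (second kind): the number of partitions of an $n$-element set into $k$ blocks each of size at least $2$ (with value $1$ for $n=k=0$). The outer sum is over $m$, with finite inner sums over $p$. With $u$ denoting the sum of the series, the corresponding series for the principal branch of the Lambert $W$ function is $W(z)=\ln z-\ln\ln z+u$, where $u$ satisfies $1-e^{-u}+\sigma u-\tau=0$. *)

(* Defs.v *)
From HB Require Import structures.
From mathcomp Require Import all_boot all_order all_algebra.
From mathcomp Require Import complex.
From mathcomp Require Import all_classical all_reals all_analysis.

Set Implicit Arguments.
Unset Strict Implicit.
Unset Printing Implicit Defensive.

Import Order.TTheory GRing.Theory Num.Theory numFieldNormedType.Exports.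

Local Open Scope classical_set_scope.
Local Open Scope ring_scope.
Local Open Scope complex_scope.

(* The [^o] gives R[i] its topology and its structure of normed module over
   itself; norms, as elements of R[i], are of the form r%:C. *)
Notation cplx R := ((R[i])^o).

Definition stirling2_ge2 (n k : nat) : nat :=
  #|[set P : {set {set 'I_n}} |
      [&& finset.partition P [set: 'I_n], #|P| == k
        & [forall B in P, (1 < #|B|)%N]]]%SET|.

Section ComplexLogarithm.
Variable R : realType.
Implicit Type z : R[i].

Definition cmod z : R := complex.Re `|z|.

(* Takes its values in ]-pi, pi] for z != 0. *)
Definition carg z : R :=
  if 0 <= complex.Im z then acos (complex.Re z / cmod z)
  else - acos (complex.Re z / cmod z).

(* Principal branch; meaningful for z != 0 only. *)
Definition cln z : R[i] := ln (cmod z) +i* carg z.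

End ComplexLogarithm.

Section PowerSeries.
Variable R : realType.
Implicit Types (a : nat -> R[i]) (x : R[i]).

Definition cpseries a x : nat -> cplx R := [series a m * x ^+ m]_m.

Definition convergence_radius a : \bar R :=
  ereal_sup [set (cmod x)%:E | x in [set x : R[i] | cvgn (cpseries a x)]].

End PowerSeries.

(* "Outside L": the points of the unbounded components of its complement. *)
Definition exterior (R : realType) (L : set (cplx R)) : set (cplx R) :=
  [set z | ~ L z /\ ~ bounded_set (connected_component (~` L) z)].

Section LambertSeries.
Variable R : realType.
Implicit Types (s z : R[i]).

(* Coefficient of tau ^+ m.  The inner sum is empty for m = 0, so the power
   series effectively starts at m = 1. *)
Definition lambert_coef s (m : nat) : R[i] :=
  let zeta := (1 + s)^-1 in
  \sum_(p < m) (stirling2_ge2 (p + m).-1 p)%:R * (-1) ^+ (p + m).-1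
               * zeta ^+ (p + m) / (m`!)%:R.

Definition sigma z : R[i] := (cln z)^-1.

Definition tau z : R[i] := cln (cln z) / cln z.

Definition tau_star_minus s : R :=
  cmod (1 + s - s * cln s - 'i%C * pi%:C * s).

Definition tau_star_plus s : R :=
  cmod (1 + s - s * cln s + 'i%C * pi%:C * s).

(* The equation is prescribed in the open upper and lower half-planes; the
   closure adds the points where the line meets the real axis. *)
Definition boundary_line : set (cplx R) :=
  closure
    ([set z : cplx R | 0 < complex.Im z /\
        cmod (- (sigma z * cln (sigma z))) = tau_star_minus (sigma z)] `|`
     [set z : cplx R | complex.Im z < 0 /\
        cmod (- (sigma z * cln (sigma z))) = tau_star_plus (sigma z)]).

End LambertSeries.

(* Main.v *)
Require Import Defs.
From HB Require Import structures.
From mathcomp Require Import all_boot all_order all_algebra.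
From mathcomp Require Import complex.

Set Implicit Arguments.
Unset Strict Implicit.
Unset Printing Implicit Defensive.

(** Write s for sigma, u(t) for the sum of the series at tau = t and
    y0 = 1/s.  The series inverts t = 1 - e^(-u) + s u.  In terms of
    y = u + y0 (1 - t) and x = x0 - t y0, where x0 = y0 + ln y0, this equation
    reads y + ln y = x, with y = y0 at x = x0.  So y is a branch of the inverse
    of y |-> y + ln y, whose only critical point on the Riemann surface of the
    logarithm lies over y = -1, with critical values -1 + (2 k + 1) pi i.  The
    radius in t is 1/|y0| times the radius in x.  When Im y0 >= 0 (that is
    Im s <= 0) the first singularity of this branch is d = -1 + pi i, and
    |s| |x0 - d| is the announced formula
    (tau_star_minusE); the other half-plane follows by conjugation.  Although
    other critical values may be nearer to x0 than d, they are singular for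
    other sheets only.

    The link between coefficients and equation is the recursion of the
    associated Stirling numbers (stirling2_ge2_rec).  It is a linear partial
    differential equation for u in t and zeta, from which the quadratic
    equation u u_t = zeta^2 u_zeta follows (inverse_series_pde); together they
    give u' (1 + s + s u - t) = 1 (lambert_poly_ode, lambert_ode).

    The radius is at least the announced one: f = u' satisfies
    f' = f^2 - s f^3, so its n-th derivative is a polynomial in f, bounded by
    n! W B^n wherever |f| <= W (ode_poly_bound).  A Cauchy estimate obtained by
    averaging over roots of unity and a summation by the binomial theorem then
    enlarge the disc of convergence by the fixed length 1/B (radius_step), so
    it reaches any radius below which f stays bounded (radius_ge).  Since
    f s (1 + y) = 1, it remains to keep y away from -1.  On a ray from
    the origin y is a continuous lift of x; near y = -1 the point x is near
    some critical value, and following the argument of y shows that x cannot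
    be near one unless t is about as large as announced
    (path_avoids_critical).

    The radius is at most the announced one: if the series converged beyond
    it, then y would be defined along the whole segment from x0 to d and would
    reach -1 at its end (path_to_critical), contradicting f s (1 + y) = 1.

    For the last claim let L = ln z.  In the upper half-plane |tau| is below
    the radius if and only if |ln L| < |L + ln L + 1 - pi i|.  The difference
    of the squares of the two sides, extended by symmetry to the lower
    half-plane, is a function of z (boundary_fun) that is continuous away from
    0 and 1, positive near 0 and near infinity and negative near 1.  Its zeros
    off the real axis are on the boundary line by definition; at a real zero
    other than 0 and 1 it changes sign along the real axis, so such a zero is
    a limit of non-real ones and is on the line as well.  Hence it has constant
    sign on every component of the complement of the line, and the
    components on which it is negative are bounded. *)

(** * Recursion of the associated Stirling numbers *)

Section AssociatedStirling.
Variable T : finType.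
Implicit Types (A B : {set T}) (P : {set {set T}}).

Definition ge2_partitions A k : {set {set {set T}}} :=
  [set P : {set {set T}} | [&& partition P A, #|P| == k
                             & [forall B in P, (1 < #|B|)%N]]].

Lemma ge2_partition_block A k P B : P \in ge2_partitions A k -> B \in P ->
  B \subset A /\ (1 < #|B|)%N.
Proof.
rewrite inE => /and3P[PA _ /forall_inP Pge] BP; split; last exact: Pge.
by rewrite -(cover_partition PA) /cover (bigcup_sup B).
Qed.

(** Removing the block B is a bijection onto the partitions of A minus B; the
    inverse adds B. *)
Lemma card_ge2_partitions_block A B k : B \subset A -> (1 < #|B|)%N ->
  #|[set P in ge2_partitions A k.+1 | B \in P]| = #|ge2_partitions (A :\: B) k|.
Proof.
move=> BA B2; have [x xB] : exists x, x \in B.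
  by apply/set0Pn; rewrite -card_gt0 (ltn_trans _ B2).
have notin P : P \in ge2_partitions (A :\: B) k -> B \notin P.
  move=> PD; apply/negP => BP.
  have [/subsetP/(_ _ xB)] := ge2_partition_block PD BP.
  by rewrite inE xB.
rewrite -[RHS](card_in_imset (f := fun P => B |: P)); last first.
  move=> P Q /notin PB /notin QB /= /(congr1 (fun X => X :\ B)).
  by rewrite !setU1K.
congr #|pred_of_set _|; apply/setP => P; rewrite inE; apply/andP/imsetP.
- move=> [PA BP]; exists (P :\ B); last by rewrite setD1K.
  move: PA; rewrite !inE => /and3P[PA /eqP cP /forall_inP P2]; apply/and3P; split.
  + case/and3P: PA => /eqP cov tr n0; apply/and3P; split.
    * apply/eqP/setP => y; apply/bigcupP/idP.
      - move=> [C]; rewrite !inE => /andP[CB CP] yC.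
        rewrite -cov; apply/andP; split; last by apply/bigcupP; exists C.
        apply/negP => yB; have /trivIsetP/(_ _ _ CP BP CB) := tr.
        by move/(disjointFr)/(_ yC); rewrite yB.
      - rewrite inE -cov => /andP[yB /bigcupP[C CP yC]].
        exists C => //; rewrite !inE CP andbT.
        by apply: contra yB => /eqP <-.
    * by apply: trivIsetS tr; apply: subsetDl.
    * by rewrite inE negb_and n0 orbT.
  + by move: cP; rewrite (cardsD1 B) BP add1n => -[->].
  + by apply/forall_inP => C; rewrite !inE => /andP[_ /P2].
- move=> [Q QD ->]; split; last by rewrite !inE eqxx.
  have QB := notin _ QD.
  move: QD; rewrite !inE => /and3P[QD /eqP cQ /forall_inP Q2]; apply/and3P; split.
  + case/and3P: QD => /eqP cov tr n0; apply/and3P; split.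
    * by rewrite /cover big_setU1 //= -/(cover Q) cov -{1}(setIidPr BA) setID.
    * apply/trivIsetP => C D; rewrite !inE.
      have dj E : E \in Q -> [disjoint B & E].
        move=> EQ; have : E \subset A :\: B by rewrite -cov /cover (bigcup_sup E).
        by rewrite subsetD disjoint_sym => /andP[].
      move=> /orP[/eqP->|CQ] /orP[/eqP->|DQ]; rewrite ?eqxx //.
      - by move=> _; apply: dj.
      - by move=> _; rewrite disjoint_sym; apply: dj.
      - by have /trivIsetP := tr; apply.
    * rewrite !inE negb_or n0 andbT; apply: contraTneq xB => <-.
      by rewrite inE.
  + by rewrite cardsU1 QB cQ.
  + by apply/forall_inP => C; rewrite !inE => /orP[/eqP->|/Q2].
Qed.

(** Double counting of the pairs formed by a partition and one of its blocks. *)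
Lemma sum_blocks_ge2 A k :
  (\sum_(B : {set T} | (B \subset A) && (1 < #|B|)) #|ge2_partitions (A :\: B) k| =
   k.+1 * #|ge2_partitions A k.+1|)%N.
Proof.
transitivity (\sum_(P in ge2_partitions A k.+1) #|P|)%N; last first.
  rewrite (eq_bigr (fun=> k.+1)); first by rewrite sum_nat_const mulnC.
  by move=> P; rewrite inE => /and3P[_ /eqP].
under [RHS]eq_bigr do rewrite -sum1_card.
rewrite (exchange_big_dep (fun B : {set T} => (B \subset A) && (1 < #|B|)%N)) /=; last first.
  by move=> P B /ge2_partition_block H /H[-> ->].
apply: eq_bigr => B /andP[BA B2]; rewrite -card_ge2_partitions_block // -sum1_card.
by apply: eq_bigl => P; rewrite inE.
Qed.

(** A partition of A is sorted according to its block containing x. *)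
Lemma sum_blocks_at A x k : x \in A ->
  (\sum_(B : {set T} | [&& B \subset A, 1 < #|B| & x \in B])
     #|ge2_partitions (A :\: B) k| =
   #|ge2_partitions A k.+1|)%N.
Proof.
move=> xA.
transitivity (\sum_(P in ge2_partitions A k.+1)
                \sum_(B in P | x \in B) 1)%N; last first.
  rewrite -sum1_card; apply: eq_bigr => P; rewrite inE => /and3P[PA _ _].
  case/and3P: (PA) => /eqP cov tr n0.
  have xP : x \in cover P by rewrite cov.
  have E B : (B \in P) && (x \in B) = (B == pblock P x).
    apply/andP/eqP => [[BP xB]|->]; first by rewrite (def_pblock tr BP xB).
    by rewrite pblock_mem // mem_pblock.
  by rewrite (big_pred1 (pblock P x)) // => B; apply: E.
rewrite (exchange_big_dep (fun B : {set T} => [&& B \subset A, (1 < #|B|)%N & x \in B])) /=;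
  last first.
  by move=> P B /ge2_partition_block H /andP[/H[-> ->]].
apply: eq_bigr => B /and3P[BA B2 xB]; rewrite -card_ge2_partitions_block // -sum1_card.
by apply: eq_bigl => P; rewrite inE xB andbT.
Qed.

(** The block of x, once x is removed, is either again a block of size at least
    2, which is one of the k + 1 blocks of a partition of the rest, or a
    singleton y. *)
Lemma ge2_partitions_rec A x k : x \in A ->
  (#|ge2_partitions A k.+1| = k.+1 * #|ge2_partitions (A :\ x) k.+1| +
   \sum_(y in A :\ x) #|ge2_partitions (A :\ x :\ y) k|)%N.
Proof.
move=> xA; rewrite -(sum_blocks_at k xA) -sum_blocks_ge2.
have reidx (F : {set T} -> nat) :
    (\sum_(B : {set T} | [&& B \subset A, 1 < #|B| & x \in B]) F (A :\: B) =
     \sum_(C : {set T} | (C \subset A :\ x) && (0 < #|C|)) F (A :\ x :\: C))%N.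
  rewrite (reindex_onto (fun C => x |: C) (fun B => B :\ x)) /=; last first.
    by move=> B /and3P[_ _ xB]; rewrite setD1K.
  apply: eq_big => C; last by rewrite setDDl.
  rewrite subUset sub1set xA /= !inE eqxx /= subsetD1.
  case xC: (x \in C); rewrite /= ?andbF /=.
    apply/negbTE; apply/negP => /andP[_ /eqP /setP /(_ x)].
    by rewrite !inE eqxx xC.
  by rewrite setU1K ?xC // eqxx !andbT cardsU1 xC.
rewrite (reidx (fun D => #|ge2_partitions D k|)) (bigID (fun C : {set T} => 1 < #|C|)%N) /=; congr (_ + _)%N.
  by apply: eq_bigl => C; rewrite -andbA; congr andb; case: #|C| => // -[].
rewrite (eq_bigl (fun C : {set T} => C \in [set [set y] | y in A :\ x])).
  by rewrite big_imset //= => y z _ _; apply: set1_inj.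
move=> C; apply/idP/imsetP => [/andP[/andP[CA C0] C1]|[y yA ->]].
  have /cards1P[y defC] : #|C| == 1%N by rewrite eqn_leq C0 leqNgt C1.
  by exists y => //; move: CA; rewrite defC sub1set.
by rewrite sub1set yA cards1.
Qed.

Lemma ge2_partitions0 A : #|ge2_partitions A 0| = (A == set0).
Proof.
have E P : (P \in ge2_partitions A 0) = (P == set0) && (A == set0).
  rewrite inE; apply/and3P/andP => [[PA /eqP/cards0_eq P0 _]|[/eqP-> /eqP->]].
    by rewrite P0 eqxx -(cover_partition PA) P0 /cover big_set0.
  split; rewrite ?cards0 //; last by apply/forall_inP => B; rewrite inE.
  by rewrite /partition /cover big_set0 eqxx inE /= andbT; apply/trivIsetP => B C; rewrite inE.
have [A0|A0] := eqVneq A set0.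
  by rewrite (eq_card (B := pred1 set0)) ?card1 // => P; rewrite E A0 eqxx andbT.
by rewrite eq_card0 // => P; rewrite E (negbTE A0) andbF.
Qed.

Lemma ge2_partitions_set0 k : #|ge2_partitions set0 k.+1| = 0%N.
Proof.
apply/eqP; rewrite cards_eq0; apply/eqP/setP => P; rewrite !inE.
by rewrite partition_set0; apply/negP => /and3P[/eqP->]; rewrite cards0.
Qed.

End AssociatedStirling.

Section AssociatedStirlingNumbers.

Fixpoint assoc_stirling2 (n k : nat) : nat :=
  match n, k with
  | 0, 0 => 1
  | 0, _.+1 => 0
  | _.+1, 0 => 0
  | n'.+1, k'.+1 => k * assoc_stirling2 n' k
                    + match n' with 0 => 0 | m.+1 => n' * assoc_stirling2 m k' end
  end.

(** The recursion shows that the number of partitions depends on the size of A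
    only. *)
Lemma card_ge2_partitions (T : finType) (A : {set T}) k :
  #|ge2_partitions A k| = assoc_stirling2 #|A| k.
Proof.
elim: {A}_.+1 {-2}A (ltnSn #|A|) k => // m IH A leAm [|k].
  by rewrite ge2_partitions0 -cards_eq0; case: #|A|.
have [->|/set0Pn[x xA]] := eqVneq A set0; first by rewrite ge2_partitions_set0 cards0.
have cA : #|A| = #|A :\ x|.+1 by rewrite (cardsD1 x) xA.
rewrite (ge2_partitions_rec _ xA) cA /= IH; last by rewrite -ltnS -cA.
congr (_ + _)%N.
case E: #|A :\ x| => [|n].
  by rewrite big_pred0 // => y; rewrite (cards0_eq E) inE.
rewrite (eq_bigr (fun=> assoc_stirling2 n k)) ?sum_nat_const ?E // => y yA.
have cAy : #|A :\ x :\ y| = n by move: E; rewrite (cardsD1 y) yA => -[].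
by rewrite IH cAy // -ltnS (leq_trans _ leAm) // cA E.
Qed.

Lemma stirling2_ge2E n k : stirling2_ge2 n k = assoc_stirling2 n k.
Proof. by rewrite -[in RHS](card_ord n) -cardsT -card_ge2_partitions. Qed.

Lemma stirling2_ge2_00 : stirling2_ge2 0 0 = 1%N.
Proof. by rewrite stirling2_ge2E. Qed.

Lemma stirling2_ge2_S0 n : stirling2_ge2 n.+1 0 = 0%N.
Proof. by rewrite stirling2_ge2E. Qed.

Lemma stirling2_ge2_rec n k : stirling2_ge2 n.+2 k.+1 =
  (k.+1 * stirling2_ge2 n.+1 k.+1 + n.+1 * stirling2_ge2 n k)%N.
Proof. by rewrite !stirling2_ge2E. Qed.

Lemma stirling2_ge2_small n k : (n < k.*2)%N -> stirling2_ge2 n k = 0%N.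
Proof.
rewrite stirling2_ge2E; elim: {n}_.+1 {-2}n (ltnSn n) k => // m IH [|n] lem [|k] //= h.
rewrite IH // ?muln0 ?add0n; last by rewrite (leq_trans _ h).
by case: n lem h => // n lem h; rewrite IH ?muln0 //; move: lem h; rewrite ?doubleS ?ltnS // => /ltnW.
Qed.
End AssociatedStirlingNumbers.

From mathcomp Require Import all_classical all_reals all_analysis.
From mathcomp Require Import cyclic separable cyclotomic.
From mathcomp Require Import ring lra zify.

Import Order.TTheory GRing.Theory Num.Theory numFieldNormedType.Exports.

Local Open Scope classical_set_scope.
Local Open Scope ring_scope.

(** * The differential equation of the series, coefficientwise *)

Section CauchyProduct.
Variable A : comNzRingType.
Implicit Types a b : nat -> A.

Definition cauchy_prod a b (m : nat) : A := \sum_(i < m.+1) a i * b (m - i)%N.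

Lemma cauchy_prod0 a b : cauchy_prod a b 0 = a 0%N * b 0%N.
Proof. by rewrite /cauchy_prod big_ord1. Qed.

Lemma cauchy_prodC a b m : cauchy_prod a b m = cauchy_prod b a m.
Proof.
rewrite /cauchy_prod (reindex_inj rev_ord_inj) /=; apply: eq_bigr => i _.
by rewrite subSS subKn -1?ltnS // mulrC.
Qed.

Definition shift_deriv a (m : nat) : A := a m.+1 *+ m.+1.

Lemma cauchy_prod_shift_deriv a b m :
  shift_deriv (cauchy_prod a b) m = cauchy_prod (shift_deriv a) b m + cauchy_prod a (shift_deriv b) m.
Proof.
rewrite /shift_deriv /cauchy_prod -sumrMnl.
transitivity (\sum_(i < m.+2) ((a i *+ i) * b (m.+1 - i)%N) +
              \sum_(i < m.+2) (a i * (b (m.+1 - i)%N *+ (m.+1 - i)))).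
  rewrite -big_split /=; apply: eq_bigr => i _.
  by rewrite mulrnAl mulrnAr -mulrnDr subnKC // -ltnS.
rewrite big_ord_recl /= mulr0n mul0r add0r; congr (_ + _).
rewrite big_ord_recr /= subnn mulr0n mulr0 addr0.
by apply: eq_bigr => i _; rewrite subSn // -ltnS.
Qed.

Lemma cauchy_prod_mulrn a b m :
  cauchy_prod a b m *+ m = cauchy_prod (fun i => a i *+ i) b m + cauchy_prod a (fun i => b i *+ i) m.
Proof.
rewrite /cauchy_prod -sumrMnl -big_split /=; apply: eq_bigr => i _.
by rewrite mulrnAl mulrnAr -mulrnDr subnKC // -ltnS.
Qed.

End CauchyProduct.

Section InverseSeriesPDE.
Variables (A : comNzRingType) (D : {additive A -> A}) (X : A) (q : nat -> A).
Hypothesis natA : forall n (x : A), x *+ n.+1 = 0 -> x = 0.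
Hypothesis DM : forall x y, D (x * y) = D x * y + x * D y.
Hypothesis DX : D X = X ^+ 2.
Hypothesis q0 : q 0 = 0.
Hypothesis q_rec : forall m,
  q m.+1 *+ m.+1 = X *+ (m == 0) + X * q m *+ m - (1 - X) * D (q m).

Let D1 : D 1 = 0.
Proof. by have := DM 1 1; rewrite !mulr1 mul1r -{1}[D 1]addr0 => /addrI. Qed.

Let L (a : nat -> A) m := shift_deriv a m - X * a m *+ m + (1 - X) * D (a m).

Let L_cauchy_prod a b m : L (cauchy_prod a b) m = cauchy_prod (L a) b m + cauchy_prod a (L b) m.
Proof.
rewrite /L cauchy_prod_shift_deriv -mulrnAr cauchy_prod_mulrn.
have -> : D (cauchy_prod a b m) = cauchy_prod (D \o a) b m + cauchy_prod a (D \o b) m.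
  by rewrite /cauchy_prod raddf_sum -big_split /=; apply: eq_bigr => i _; rewrite DM.
rewrite /cauchy_prod !mulrDr !big_distrr /= -!big_split /= -sumrN -!big_split /=.
by apply: eq_bigr => i _; rewrite -!mulrnAr; ring.
Qed.

(** Here D stands for X^2 d/dX and q for the coefficients of a power series U in
    t over A.  The hypothesis [q_rec] says that L U = X for the derivation
    L = (1 - X t) d/dt + (1 - X) D.  Commuting L with d/dt and with D gives
    L(U_t) = X U_t and L(D U) = X^2 (1 + t U_t + D U).  Hence the difference
    Z = D U - U U_t satisfies L Z = X Z and has no constant term, so that all
    its coefficients vanish. *)
Lemma inverse_series_pde m : D (q m) = cauchy_prod q (shift_deriv q) m.
Proof.
elim: m => [|m IH]; first by rewrite cauchy_prod0 q0 raddf0 mul0r.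
pose b := cauchy_prod q (shift_deriv q).
have Lq k : L q k = X *+ (k == 0) by rewrite /L /shift_deriv q_rec; ring.
have Lq1 k : L (shift_deriv q) k = X * shift_deriv q k.
  have E := q_rec k.+1; have E2 := raddfMn D k.+1 (q k.+1).
  have -> : L (shift_deriv q) k = (q k.+2 *+ k.+2) *+ k.+1
    - X * (q k.+1 *+ k.+1) *+ k + (1 - X) * D (q k.+1 *+ k.+1) by [].
  rewrite E E2 /shift_deriv /= mulr0n add0r; move: (q k.+1) (D (q k.+1)) => u du.
  ring.
have Lb : L b m = X * shift_deriv q m + X * b m.
  rewrite L_cauchy_prod; congr (_ + _).
    rewrite /cauchy_prod (eq_bigr (fun i : 'I_m.+1 => X *+ (i == 0 :> nat) * shift_deriv q (m - i)%N)); last first.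
      by move=> i _; rewrite Lq.
    rewrite big_ord_recl /= subn0 big1 ?addr0 // => i _; by rewrite mulr0n mul0r.
  by rewrite /b /cauchy_prod big_distrr; apply: eq_bigr => i _ /=; rewrite Lq1 mulrCA.
have LDq : L (D \o q) m = X ^+ 2 *+ (m == 0) + X ^+ 2 * q m *+ m + X ^+ 2 * D (q m).
  have -> : L (D \o q) m = D (q m.+1) *+ m.+1 - X * D (q m) *+ m + (1 - X) * D (D (q m)) by [].
  have -> : D (q m.+1) *+ m.+1 = X ^+ 2 *+ (m == 0) + (X ^+ 2 * q m + X * D (q m)) *+ m
      + X ^+ 2 * D (q m) - (1 - X) * D (D (q m)).
    rewrite -raddfMn q_rec raddfB raddfD !raddfMn /= !DM raddfB /= DX D1.
    by move: (q m) (D (q m)) (D (D (q m))) => u du ddu; ring.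
  move: (q m) (D (q m)) (D (D (q m))) => u du ddu; ring.
have := q_rec m; move: LDq Lb; rewrite /L /= (esym IH : b m = D (q m)) => E1 E2 E3; rewrite -/b.
apply/eqP; rewrite -subr_eq0; apply/eqP; apply: (@natA m); rewrite mulrnBl.
have -> : D (q m.+1) *+ m.+1 = shift_deriv (D \o q) m by [].
have -> : b m.+1 *+ m.+1 = shift_deriv b m by [].
have -> : shift_deriv (D \o q) m = X ^+ 2 *+ (m == 0) + X ^+ 2 * q m *+ m + X ^+ 2 * D (q m)
   + X * D (q m) *+ m - (1 - X) * D (D (q m)) by rewrite -E1; ring.
have -> : shift_deriv b m = X * (q m.+1 *+ m.+1) + X * D (q m) + X * D (q m) *+ m
    - (1 - X) * D (D (q m)) by rewrite -E2; ring.
by rewrite E3; ring.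
Qed.

End InverseSeriesPDE.

Section LambertPoly.
Variable K : numFieldType.

(** The coefficient of tau^m as a polynomial in zeta: the recursion in m
    involves the derivative in zeta. *)
Definition lambert_poly (m : nat) : {poly K} :=
  \sum_(p < m) ((stirling2_ge2 (p + m).-1 p)%:R * (-1) ^+ (p + m).-1 / (m`!)%:R)
                 *: 'X^(p + m).

Let w p m : K := (stirling2_ge2 (p + m).-1 p)%:R * (-1) ^+ (p + m).-1.

Let w_rec p m : w p.+1 m.+1 = - (p.+1%:R * w p.+1 m) + (p + m)%:R * w p m.
Proof.
rewrite /w !addSn !addnS /=.
case: (posnP (p + m)) => [/eqP|].
  by rewrite addn_eq0 => /andP[/eqP-> /eqP->]; rewrite !(stirling2_ge2_small (k := 1)) //; ring.
case E : (p + m)%N => [//|n] _; rewrite stirling2_ge2_rec /= natrD !natrM.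
by rewrite !exprS; ring.
Qed.

Lemma lambert_poly_rec m :
  lambert_poly m.+1 *+ m.+1 =
  'X *+ (m == 0) + 'X * lambert_poly m *+ m - (1 - 'X) * ('X^2 * (lambert_poly m)^`()).
Proof.
have fact_neq0 n : n`!%:R != 0 :> K by rewrite pnatr_eq0 -lt0n fact_gt0.
have qE n : lambert_poly n = (n`!)%:R^-1 *: \sum_(p < n) w p n *: 'X^(p + n).
  rewrite scaler_sumr; apply: eq_bigr => p _; rewrite scalerA; congr (_ *: _).
  by rewrite mulrC.
case: m => [|m].
  rewrite /lambert_poly big_ord0 big_ord1 /= stirling2_ge2_00 expr0 deriv0.
  rewrite !mulr0 mulr1 divr1 scale1r add0n expr1 subr0 addr0 mulr1n.
  by [].
rewrite mulr0n add0r; apply: (scalerI (fact_neq0 m.+1)).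
have -> : (m.+1)`!%:R *: (lambert_poly m.+2 *+ m.+2) =
    \sum_(p < m.+2) w p m.+2 *: 'X^(p + m.+2).
  rewrite -(scaler_nat _ (lambert_poly _)) scalerA -natrM mulnC -factS qE scalerA mulfV ?scale1r //.
set d := \sum_(p < m.+1) w p m.+1 *: 'X^(p + m.+1).
have -> : lambert_poly m.+1 = (m.+1)`!%:R^-1 *: d by exact: qE.
rewrite derivZ -!scalerAr scalerMnr -scalerBr scalerA mulfV // scale1r.
have -> : 'X^2 * d^`() = \sum_(p < m.+1) ((p + m.+1)%:R * w p m.+1) *: 'X^(p + m.+2).
  rewrite /d raddf_sum big_distrr; apply: eq_bigr => p _ /=.
  rewrite derivZ derivXn -scalerAr mulrnAr -exprD -(scaler_nat _ 'X^_) scalerA mulrC.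
  by congr (_ *: 'X^ _); rewrite addnS /=; lia.
rewrite mulrBl mul1r.
have -> : 'X * (\sum_(p < m.+1) ((p + m.+1)%:R * w p m.+1) *: 'X^(p + m.+2)) =
   \sum_(p < m.+1) ((p + m.+1)%:R * w p m.+1) *: 'X^(p.+1 + m.+2) :> {poly K}.
  by rewrite big_distrr; apply: eq_bigr => p _ /=; rewrite -scalerAr -exprS.
have -> : 'X * d *+ m.+1 = \sum_(p < m.+1) (m.+1%:R * w p m.+1) *: 'X^(p + m.+2) :> {poly K}.
  rewrite /d big_distrr -sumrMnl; apply: eq_bigr => p _ /=.
  by rewrite -scalerAr -exprS -addnS -(scaler_nat _ (_ *: _)) scalerA.
rewrite opprB addrA addrAC -sumrB.
have -> : \sum_(i < m.+1) ((m.+1%:R * w i m.+1) *: 'X^(i + m.+2) -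
       ((i + m.+1)%:R * w i m.+1) *: 'X^(i + m.+2)) =
     \sum_(p < m.+2) (- (p%:R * w p m.+1)) *: 'X^(p + m.+2) :> {poly K}.
  have wz : w m.+1 m.+1 = 0 by rewrite /w stirling2_ge2_small ?mul0r //; lia.
  rewrite [RHS]big_ord_recr /= wz mulr0 oppr0 scale0r addr0; apply: eq_bigr => p _.
  by rewrite -scalerBl; congr (_ *: _); rewrite natrD; ring.
rewrite big_ord_recl [in RHS]big_ord_recl /= -addrA -big_split /=.
rewrite {1}/w add0n /= stirling2_ge2_S0 !mul0r oppr0 !scale0r; congr (_ + _).
apply: eq_bigr => p _; rewrite -scalerDl; congr (_ *: _).
by rewrite /bump /= add1n w_rec.
Qed.

(** Made an additive map so that it can be the D of [inverse_series_pde]. *)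
Definition X2deriv (p : {poly K}) := 'X^2 * p^`().

Let X2deriv_is_additive : {morph X2deriv : x y / x - y}.
Proof. by move=> x y; rewrite /X2deriv derivB mulrBr. Qed.

HB.instance Definition _ :=
  GRing.isZmodMorphism.Build {poly K} {poly K} X2deriv X2deriv_is_additive.

Lemma lambert_poly_pde m : 'X^2 * (lambert_poly m)^`() =
  cauchy_prod lambert_poly (shift_deriv lambert_poly) m.
Proof.
apply: (@inverse_series_pde _ X2deriv 'X).
- move=> n x; rewrite -(scaler_nat _ x) => /eqP; rewrite scaler_eq0 pnatr_eq0 /=.
  by move/eqP.
- by move=> x y; rewrite /= /X2deriv derivM; ring.
- by rewrite /= /X2deriv derivX mulr1.
- by rewrite /lambert_poly big_ord0.
- by move=> n; exact: lambert_poly_rec.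
Qed.

Variable s : K.
Hypothesis s1 : 1 + s != 0.
Let c m : K := (lambert_poly m).[(1 + s)^-1].

(** Coefficientwise form of u' (1 + s + s u - tau) = 1: eliminate the derivative
    in zeta between the linear equation [lambert_poly_rec] and the quadratic
    equation [lambert_poly_pde]. *)
Lemma lambert_poly_ode m :
  cauchy_prod (shift_deriv c) (fun j => s * c j + (1 + s) *+ (j == 0) - (j == 1)%:R) m = (m == 0)%:R.
Proof.
set z := (1 + s)^-1.
have hz : (1 + s) * z = 1 by rewrite mulfV.
have crec : c m.+1 *+ m.+1 = z *+ (m == 0) + z * c m *+ m - (1 - z) * cauchy_prod c (shift_deriv c) m.
  rewrite /c -!hornerMn lambert_poly_rec lambert_poly_pde.
  rewrite !(hornerD, hornerN, hornerM, hornerMn, hornerX, hornerC).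
  congr (_ - _ * _); rewrite /cauchy_prod horner_sum; apply: eq_bigr => i _.
  by rewrite hornerM hornerMn.
have -> : cauchy_prod (shift_deriv c) (fun j => s * c j + (1 + s) *+ (j == 0) - (j == 1)%:R) m =
  s * cauchy_prod c (shift_deriv c) m + (1 + s) * shift_deriv c m - c m *+ m.
  rewrite [cauchy_prod c _ m]cauchy_prodC /cauchy_prod.
  under eq_bigr do rewrite mulrBr mulrDr mulrCA.
  rewrite sumrB big_split /= -big_distrr /=; congr (_ + _ - _).
    rewrite (bigD1 ord_max) //= subnn big1 ?addr0 1?mulrC // => i.
    move=> im; rewrite (_ : (m - i == 0)%N = false) ?mulr0 //.
    apply/negbTE; rewrite subn_eq0 -ltnNge ltn_neqAle -ltnS ltn_ord andbT.
    by apply: contraNneq im => E; apply/eqP/val_inj.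
  case: m {crec} => [|m]; first by rewrite big_ord1 /= mulr0 mulr0n.
  rewrite big_ord_recr /= subnn mulr0 addr0 (bigD1 ord_max) //= subSnn mulr1.
  rewrite big1 ?addr0 // => i im; rewrite (_ : (m.+1 - i == 1)%N = false) ?mulr0 //.
  apply/negbTE; apply: contra im => /eqP E; apply/eqP/val_inj => /=.
  have := ltn_ord i; lia.
rewrite /shift_deriv crec; have -> : s = (1 + s) - 1 by ring.
have -> : (1 + s - 1) * cauchy_prod c (shift_deriv c) m + (1 + (1 + s - 1)) *
   (z *+ (m == 0) + z * c m *+ m - (1 - z) * cauchy_prod c (shift_deriv c) m) - c m *+ m =
   ((1 + s) * z) * ((m == 0)%:R + c m *+ m + cauchy_prod c (shift_deriv c) m)
     - c m *+ m - cauchy_prod c (shift_deriv c) m.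
  ring.
by rewrite hz; ring.
Qed.

End LambertPoly.

Section LambertBound.
Variable K : numFieldType.

Let A (T : K) m : K := \sum_(p < m) (stirling2_ge2 (p + m).-1 p)%:R * T ^+ p.

Let A_le (T : K) m : 1 <= T -> A T m.+1 <= (3 * T) ^+ m * m`!%:R.
Proof.
move=> T1; have T0 : 0 <= T by apply: le_trans T1.
elim: m => [|m IH].
  by rewrite /A big_ord1 /= stirling2_ge2_00 !expr0 !mulr1.
apply: (@le_trans _ _ ((3 * T * m.+1%:R) * A T m.+1)); last first.
  have H : 0 <= 3 * T * m.+1%:R :> K by rewrite !mulr_ge0 ?ler0n.
  apply: le_trans (ler_wpM2l H IH) _; rewrite exprS factS natrM.
  by rewrite le_eqVlt; apply/orP; left; apply/eqP; ring.
have A0 : 0 <= A T m.+1.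
  by apply: sumr_ge0 => i _; rewrite mulr_ge0 ?ler0n // exprn_ge0.
have -> : A T m.+2 = \sum_(p < m.+1) (p.+1%:R * (stirling2_ge2 (p.+1 + m.+1).-1 p.+1)%:R * T ^+ p.+1)
  + \sum_(p < m.+1) ((p + m.+1)%:R * (stirling2_ge2 (p + m.+1).-1 p)%:R * T ^+ p.+1).
  rewrite {1}/A big_ord_recl /= stirling2_ge2_S0 mul0r add0r -big_split /=.
  apply: eq_bigr => p _; rewrite /bump /= add1n -mulrDl; congr (_ * _).
  by rewrite !addnS /= stirling2_ge2_rec natrD !natrM.
have -> : 3 * T * m.+1%:R * A T m.+1 = T * m.+1%:R * A T m.+1 + T * (2 * m.+1%:R) * A T m.+1.
  by ring.
apply: lerD.
  apply: (@le_trans _ _ (m.+1%:R * A T m.+1)); last first.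
    by rewrite ler_wpM2r // -{1}[m.+1%:R]mul1r ler_wpM2r ?ler0n.
  rewrite /A [X in _ <= _ * X]big_ord_recl mulrDr ler_wpDl //.
    by rewrite !mulr_ge0 ?ler0n ?exprn_ge0.
  rewrite [leLHS]big_ord_recr /= [X in _ * X%:R](_ : _ = 0%N); last first.
    by apply: stirling2_ge2_small; lia.
  rewrite mulr0 mul0r addr0 big_distrr /=; apply: ler_sum => p _.
  rewrite /bump /= add1n mulrA ler_wpM2r ?exprn_ge0 // ler_wpM2r ?ler0n // ler_nat.
  by have := ltn_ord p; lia.
rewrite /A big_distrr /=; apply: ler_sum => p _.
rewrite exprS; have -> : T * (2 * m.+1%:R) * ((stirling2_ge2 (p + m.+1).-1 p)%:R * T ^+ p) =
   (2 * m.+1%:R) * (stirling2_ge2 (p + m.+1).-1 p)%:R * (T * T ^+ p) by ring.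
rewrite ler_wpM2r ?mulr_ge0 ?exprn_ge0 // ler_wpM2r ?ler0n // -natrM ler_nat.
by have := ltn_ord p; lia.
Qed.

(** A crude bound, whose purpose is that the radius of convergence is not zero. *)
Lemma lambert_poly_bound m (z : K) :
  `|(lambert_poly K m).[z]| <= (3 * (1 + `|z|) * `|z|) ^+ m.
Proof.
case: m => [|m]; first by rewrite /lambert_poly big_ord0 horner0 normr0 expr0.
set T := 1 + `|z|; have T1 : 1 <= T by rewrite lerDl.
have T0 : 0 <= T by apply: le_trans T1.
apply: (@le_trans _ _ (`|z| ^+ m.+1 * (A T m.+1 / (m.+1)`!%:R))).
  rewrite /A /lambert_poly horner_sum mulr_suml big_distrr /=.
  apply: le_trans (ler_norm_sum _ _ _) _; apply: ler_sum => p _.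
  rewrite hornerZ hornerXn !normrM normrV ?unitfE ?pnatr_eq0 -?lt0n ?fact_gt0 //.
  rewrite !normr_nat normrX normrN1 expr1n mulr1 normrX exprD.
  rewrite [leLHS](_ : _ = `|z| ^+ m.+1 *
    ((stirling2_ge2 (p + m.+1).-1 p)%:R * `|z| ^+ p / (m.+1)`!%:R)); last by ring.
  rewrite ler_wpM2l ?exprn_ge0 // ler_wpM2r ?invr_ge0 ?ler0n // ler_wpM2l ?ler0n //.
  by apply: lerXn2r; rewrite ?nnegrE // lerDr.
rewrite exprMn mulrC ler_wpM2r ?exprn_ge0 // ler_pdivrMr ?ltr0n ?fact_gt0 //.
apply: le_trans (A_le m T1) _.
have T3 : 1 <= 3 * T by apply: le_trans T1 _; rewrite ler_peMl ?ler1n.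
apply: ler_pM; rewrite ?exprn_ge0 ?ler0n ?mulr_ge0 //; first by apply: ler_weXn2l.
by rewrite ler_nat factS leq_pmull.
Qed.

End LambertBound.

(** * Complex sequences and series *)

Section Modulus.
Local Open Scope complex_scope.
Variable R : realType.
Implicit Types (z w : R[i]) (r : R).
Local Notation Re := complex.Re.
Local Notation Im := complex.Im.

Lemma cmodE z : cmod z = Num.sqrt (Re z ^+ 2 + Im z ^+ 2).
Proof. by rewrite /cmod normc_def. Qed.

Lemma normc_cmod z : `|z| = (cmod z)%:C.
Proof. by rewrite normc_def cmodE. Qed.

Lemma cmod_ge0 z : 0 <= cmod z.
Proof. by rewrite cmodE sqrtr_ge0. Qed.

Lemma cmod_sqr z : cmod z ^+ 2 = Re z ^+ 2 + Im z ^+ 2.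
Proof. by rewrite cmodE sqr_sqrtr // addr_ge0 // sqr_ge0. Qed.

Lemma cmodM z w : cmod (z * w) = cmod z * cmod w.
Proof. by apply: (@complexI R); rewrite rmorphM /= -!normc_cmod normrM. Qed.

Lemma cmodN z : cmod (- z) = cmod z.
Proof. by rewrite /cmod normrN. Qed.

Lemma cmodB z w : cmod (z - w) = cmod (w - z).
Proof. by rewrite -cmodN opprB. Qed.

Lemma cmodV z : cmod z^-1 = (cmod z)^-1.
Proof. by apply: (@complexI R); rewrite fmorphV /= -!normc_cmod normfV. Qed.

Lemma cmodX z n : cmod (z ^+ n) = cmod z ^+ n.
Proof. by apply: (@complexI R); rewrite rmorphXn /= -!normc_cmod normrX. Qed.

Lemma cmod0 : cmod (0 : R[i]) = 0.
Proof. by rewrite /cmod normr0. Qed.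

Lemma cmod1 : cmod (1 : R[i]) = 1.
Proof. by rewrite /cmod normr1. Qed.

Lemma cmod_nat n : cmod (n%:R : R[i]) = n%:R.
Proof. by apply: (@complexI R); rewrite -normc_cmod normr_nat rmorph_nat. Qed.

Lemma cmod_real r : cmod r%:C = `|r|.
Proof. by rewrite cmodE /= expr0n addr0 sqrtr_sqr. Qed.

Lemma cmod_eq0 z : (cmod z == 0) = (z == 0).
Proof. by rewrite -(inj_eq (@complexI R)) -normc_cmod rmorph0 normr_eq0. Qed.

Lemma cmod_gt0 z : (0 < cmod z) = (z != 0).
Proof. by rewrite lt_def cmod_eq0 cmod_ge0 andbT. Qed.

Lemma ler_cmodD z w : cmod (z + w) <= cmod z + cmod w.
Proof. by rewrite -lecR rmorphD /= -!normc_cmod ler_normD. Qed.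

Lemma ler_cmod_dist z w : cmod z - cmod w <= cmod (z - w).
Proof. by rewrite lerBlDr -{1}[z](subrK w) ler_cmodD. Qed.

Lemma ler_cmod_sum I (s : seq I) (P : pred I) (F : I -> R[i]) :
  cmod (\sum_(i <- s | P i) F i) <= \sum_(i <- s | P i) cmod (F i).
Proof.
elim/big_ind2 : _ => [|x1 x2 y1 y2 h1 h2|//]; first by rewrite cmod0.
exact: le_trans (ler_cmodD _ _) (lerD h1 h2).
Qed.

Lemma Re_le_cmod z : `|Re z| <= cmod z.
Proof.
rewrite -sqrtr_sqr cmodE; apply: ler_wsqrtr; by rewrite lerDl sqr_ge0.
Qed.

Lemma Im_le_cmod z : `|Im z| <= cmod z.
Proof.
rewrite -sqrtr_sqr cmodE; apply: ler_wsqrtr; by rewrite lerDr sqr_ge0.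
Qed.

Lemma cmod_le_ReIm z : cmod z <= `|Re z| + `|Im z|.
Proof.
rewrite -(@ler_pXn2r _ 2) ?nnegrE ?cmod_ge0 ?addr_ge0 // cmod_sqr sqrrD !real_normK ?num_real //.
by rewrite -addrA [X in _ <= _ + X]addrC addrA lerDl mulrn_wge0 // mulr_ge0.
Qed.

Lemma cReM z w : Re (z * w) = Re z * Re w - Im z * Im w.
Proof. by case: z w => [a b] [c d]. Qed.

Lemma cImM z w : Im (z * w) = Re z * Im w + Im z * Re w.
Proof. by case: z w => [a b] [c d] /=; ring. Qed.

Lemma cReD z w : Re (z + w) = Re z + Re w.
Proof. by case: z w => [a b] [c d]. Qed.

Lemma cImD z w : Im (z + w) = Im z + Im w.
Proof. by case: z w => [a b] [c d]. Qed.

Lemma cReN z : Re (- z) = - Re z.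
Proof. by case: z. Qed.

Lemma cImN z : Im (- z) = - Im z.
Proof. by case: z. Qed.

Definition cReImE := (cReD, cImD, cReN, cImN, cReM, cImM).

Lemma Re_sum I (s : seq I) (P : pred I) (F : I -> R[i]) :
  Re (\sum_(i <- s | P i) F i) = \sum_(i <- s | P i) Re (F i).
Proof. by rewrite (big_morph _ cReD (erefl _)). Qed.

Lemma Im_sum I (s : seq I) (P : pred I) (F : I -> R[i]) :
  Im (\sum_(i <- s | P i) F i) = \sum_(i <- s | P i) Im (F i).
Proof. by rewrite (big_morph _ cImD (erefl _)). Qed.

Lemma complex_eq z w : Re z = Re w -> Im z = Im w -> z = w.
Proof. by case: z w => [a b] [c d] /= -> ->. Qed.

Lemma cvg_complexP (u : nat -> cplx R) (l : cplx R) :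
  u @ \oo --> l <->
  (fun n => Re (u n)) @ \oo --> Re l /\ (fun n => Im (u n)) @ \oo --> Im l.
Proof.
have cm (z : cplx R) : (`|z| : R[i]) = (cmod z)%:C by exact: normc_cmod.
split.
  move=> /cvgrPdist_lt h; split; apply/cvgrPdist_lt => e e0.
    have {}h := h e%:C; rewrite ltcR in h; move: (h e0); apply: filterS => n.
    by rewrite cm ltcR; apply: le_lt_trans; rewrite -cReN -cReD Re_le_cmod.
  have {}h := h e%:C; rewrite ltcR in h; move: (h e0); apply: filterS => n.
  by rewrite cm ltcR; apply: le_lt_trans; rewrite -cImN -cImD Im_le_cmod.
move=> [/cvgrPdist_lt hr /cvgrPdist_lt hi]; apply/cvgrPdist_lt => e.
case: e => er ei; rewrite ltcE /= => /andP[/eqP -> e0].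
have e2 : 0 < er / 2 by rewrite divr_gt0.
near=> n; rewrite cm ltcR; apply: le_lt_trans (cmod_le_ReIm _) _.
by rewrite (splitr er) !cReImE; apply: ltrD; near: n; [exact: hr | exact: hi].
Unshelve. all: end_near. Qed.

Lemma cvg_complexM (u v : nat -> cplx R) (k l : cplx R) :
  u @ \oo --> k -> v @ \oo --> l ->
  (fun n => (u n : R[i]) * (v n : R[i]) : cplx R) @ \oo --> ((k : R[i]) * (l : R[i]) : cplx R).
Proof.
move=> /cvg_complexP[ur ui] /cvg_complexP[vr vi]; apply/cvg_complexP; split.
  under eq_cvg do rewrite cReM.
  by rewrite cReM; apply: cvgB; apply: cvgM.
under eq_cvg do rewrite cImM.
by rewrite cImM; apply: cvgD; apply: cvgM.
Qed.

Lemma cvg_complexZ (k : R[i]) (u : nat -> cplx R) (l : cplx R) :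
  u @ \oo --> l ->
  (fun n => k * (u n : R[i]) : cplx R) @ \oo --> (k * (l : R[i]) : cplx R).
Proof.
move=> /cvg_complexP[ur ui]; apply/cvg_complexP; split.
  under eq_cvg do rewrite cReM.
  by rewrite cReM; apply: cvgB; apply: cvgM => //; apply: cvg_cst.
under eq_cvg do rewrite cImM.
by rewrite cImM; apply: cvgD; apply: cvgM => //; apply: cvg_cst.
Qed.

Lemma cvg_complexD (u v : nat -> cplx R) (k l : cplx R) :
  u @ \oo --> k -> v @ \oo --> l -> u + v @ \oo --> k + l.
Proof.
move=> /cvg_complexP[ur ui] /cvg_complexP[vr vi]; apply/cvg_complexP; split.
  under eq_cvg do rewrite cReD.
  by rewrite cReD; apply: cvgD.
under eq_cvg do rewrite cImD.
by rewrite cImD; apply: cvgD.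
Qed.

Lemma cvg_cmod (u : nat -> cplx R) (l : cplx R) :
  u @ \oo --> l -> (fun n => cmod (u n)) @ \oo --> cmod l.
Proof.
move=> /cvgrPdist_lt h; apply/cvgrPdist_lt => e e0.
have {}h := h e%:C; rewrite ltcR in h; move: (h e0); apply: filterS => n.
have -> : `|l - u n| = (cmod (l - u n))%:C by exact: normc_cmod.
rewrite ltcR; apply: le_lt_trans.
by rewrite ler_norml lerNl opprB ler_cmod_dist cmodB ler_cmod_dist.
Qed.

End Modulus.

Section ComplexSeries.
Local Open Scope complex_scope.
Variable R : realType.
Implicit Types (a b : nat -> R[i]).
Local Notation Re := complex.Re.
Local Notation Im := complex.Im.

Definition csummable a := cvgn (series (fun n => cmod (a n))).

Definition csum a : R[i] := limn (series a : nat -> cplx R).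

Lemma csum_lim a (l : cplx R) : (series a : nat -> cplx R) @ \oo --> l -> csum a = l.
Proof. by move=> h; apply: cvg_lim h. Qed.

Lemma seriesRe a n : Re (series a n) = series (fun k => Re (a k)) n.
Proof. by rewrite /series /= Re_sum. Qed.

Lemma seriesIm a n : Im (series a n) = series (fun k => Im (a k)) n.
Proof. by rewrite /series /= Im_sum. Qed.

Lemma csummable_Re a : csummable a -> cvgn (series (fun k => Re (a k))).
Proof.
move=> h; apply: (@normed_cvg _ R^o); apply: series_le_cvg h => n //=; first exact: cmod_ge0.
exact: Re_le_cmod.
Qed.

Lemma csummable_Im a : csummable a -> cvgn (series (fun k => Im (a k))).
Proof.
move=> h; apply: (@normed_cvg _ R^o); apply: series_le_cvg h => n //=; first exact: cmod_ge0.
exact: Im_le_cmod.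
Qed.

Lemma csummable_cvg a : csummable a -> (series a : nat -> cplx R) @ \oo --> (csum a : cplx R).
Proof.
move=> h; pose l : cplx R := limn (series (fun k => Re (a k))) +i* limn (series (fun k => Im (a k))).
have hl : (series a : nat -> cplx R) @ \oo --> l.
  apply/cvg_complexP; split => /=.
    by under eq_cvg do rewrite seriesRe; exact: csummable_Re.
  by under eq_cvg do rewrite seriesIm; exact: csummable_Im.
by rewrite (csum_lim hl).
Qed.

Lemma Re_csum a : csummable a -> Re (csum a) = limn (series (fun k => Re (a k))).
Proof.
move=> /csummable_cvg/cvg_complexP[h _]; apply/esym/cvg_lim => //.
by under eq_cvg do rewrite -seriesRe.
Qed.

Lemma Im_csum a : csummable a -> Im (csum a) = limn (series (fun k => Im (a k))).
Proof.
move=> /csummable_cvg/cvg_complexP[_ h]; apply/esym/cvg_lim => //.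
by under eq_cvg do rewrite -seriesIm.
Qed.

Lemma csummable_le a (v : nat -> R) : (forall n, cmod (a n) <= v n) ->
  cvgn (series v) -> csummable a.
Proof.
move=> h cv; apply: series_le_cvg cv => // n; first exact: cmod_ge0.
by apply: le_trans (h n); apply: cmod_ge0.
Qed.

Lemma csumD a b : csummable a -> csummable b ->
  csum (fun n => a n + b n) = csum a + csum b.
Proof.
move=> /csummable_cvg ha /csummable_cvg hb; apply: csum_lim.
have -> : series (fun n => a n + b n) = series a + series b :> (nat -> cplx R).
  by apply/funext => n; rewrite /series /= big_split.
exact: cvg_complexD.
Qed.

Lemma csumZ k a : csummable a -> csum (fun n => k * a n) = k * csum a.
Proof.
move=> /csummable_cvg ha; apply: csum_lim.
have -> : series (fun n => k * a n) = (fun n => (k : R[i]) * series a n) :> (nat -> cplx R).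
  by apply/funext => n; rewrite /series /= big_distrr.
exact: cvg_complexZ ha.
Qed.

Lemma csum_finite a N : (forall n, (N <= n)%N -> a n = 0) ->
  csummable a /\ csum a = \sum_(n < N) a n.
Proof.
move=> aN; have S (V : zmodType) (u : nat -> V) : (forall n, (N <= n)%N -> u n = 0) ->
    forall n, (N <= n)%N -> series u n = \sum_(n < N) u n.
  move=> uN n Nn; rewrite /series /= (big_cat_nat (n := N)) //= big_mkord.
  have -> : \sum_(N <= i < n) u i = 0; last by rewrite addr0.
  by rewrite big_nat_cond big1 // => i /andP[/andP[Ni _] _]; exact: uN.
have near (V : normedModType R) (u : nat -> V) : (forall n, (N <= n)%N -> u n = 0) ->
   series u @ \oo --> \sum_(n < N) u n.
  move=> uN; apply: (cvg_near_cst (\sum_(n < N) u n)).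
  by exists N => // n /= Nn; exact: S.
have cs : csummable a.
  apply/cvg_ex; exists (\sum_(n < N) cmod (a n)); apply: (near R^o) => n Nn.
  by rewrite aN // cmod0.
split=> //; apply: csum_lim; apply: (@cvg_near_cst _ (cplx R)).
by exists N => // n /= Nn; exact: S.
Qed.

(** The bound on the remainder depends on the moduli of the terms only; for a
    power series it is therefore uniform on a circle. *)
Lemma cmod_csum_tail a (v : nat -> R) : (forall n, cmod (a n) <= v n) ->
  cvgn (series v) -> forall N, cmod (csum a - \sum_(n < N) a n) <= limn (series v) - series v N.
Proof.
move=> av cv N; have /csummable_cvg ha := csummable_le av cv.
have l2 : (fun n => cmod (series a n - \sum_(n < N) a n)) @ \oo
    --> cmod (csum a - \sum_(n < N) a n).
  apply: cvg_cmod; apply/cvg_complexP.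
  move/cvg_complexP : ha => [hr hi]; split.
    under eq_cvg do rewrite cReD cReN.
    by rewrite cReD cReN; apply: cvgB => //; apply: cvg_cst.
  under eq_cvg do rewrite cImD cImN.
  by rewrite cImD cImN; apply: cvgB => //; apply: cvg_cst.
have l3 : (fun n => series v n - series v N) @ \oo --> limn (series v) - series v N.
  by apply: cvgB => //; exact: cvg_cst.
apply: (ler_cvg_to l2 l3); exists N => // n /= Nn.
rewrite {1}/series /= (big_cat_nat (n := N)) //= big_mkord addrAC subrr add0r.
apply: le_trans (ler_cmod_sum _ _ _) _.
by rewrite sub_series_geq // /=; apply: ler_sum => i _; apply: av.
Qed.

End ComplexSeries.

(** * Products, growth and derivatives of power series *)

Section CauchyProductSeries.

Lemma series_cauchy_prod (K : comNzRingType) (a b : nat -> K) N :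
  \sum_(n < N) cauchy_prod a b n = \sum_(i < N) a i * \sum_(j < N - i) b j.
Proof.
elim: N => [|N IH]; first by rewrite !big_ord0.
rewrite big_ord_recr IH /= [RHS]big_ord_recr /= subSnn big_ord1.
rewrite /cauchy_prod [X in _ + X]big_ord_recr /= subnn addrA; congr (_ + _).
rewrite -big_split /=; apply: eq_bigr => i _.
by rewrite subSn ?(ltnW (ltn_ord i)) // big_ord_recr mulrDr.
Qed.

Variable R : realType.
Implicit Types (a b : nat -> R[i]).

(** The product of the N-th partial sums lies between the N-th and the 2N-th
    partial sums of the Cauchy product. *)
Let cvg_cauchy_prod_nonneg (u v : nat -> R) : (forall n, 0 <= u n) -> (forall n, 0 <= v n) ->
  cvgn (series u) -> cvgn (series v) ->
  series (cauchy_prod u v) @ \oo --> limn (series u) * limn (series v).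
Proof.
move=> u0 v0 cu cv.
have nd (w : nat -> R) : (forall n, 0 <= w n) -> nondecreasing_seq (series w).
  by move=> w0; apply/nondecreasing_seqP => n; rewrite seriesSr lerDl.
have c0 n : 0 <= cauchy_prod u v n by apply: sumr_ge0 => i _; rewrite mulr_ge0.
have sE (w : nat -> R) N : series w N = \sum_(n < N) w n by rewrite /series /= big_mkord.
have le1 N : series (cauchy_prod u v) N <= series u N * series v N.
  rewrite !sE series_cauchy_prod big_distrl /=; apply: ler_sum => i _; apply: ler_wpM2l => //.
  by rewrite -!sE; apply: nd => //; apply: leq_subr.
have le2 N : series u N * series v N <= series (cauchy_prod u v) (N + N)%N.
  rewrite [series (cauchy_prod _ _) _]sE series_cauchy_prod big_split_ord /= -[leLHS]addr0.
  apply: lerD; last by apply: sumr_ge0 => i _; rewrite mulr_ge0 ?sumr_ge0.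
  rewrite sE big_distrl /=; apply: ler_sum => i _; apply: ler_wpM2l => //.
  by rewrite -sE; apply: nd => //; have := ltn_ord i; lia.
have cuv : (fun N => series u N * series v N) @ \oo --> limn (series u) * limn (series v).
  exact: cvgM.
have ub N : series (cauchy_prod u v) N <= limn (series u) * limn (series v).
  apply: le_trans (le1 N) _; apply: ler_pM; rewrite ?sE ?sumr_ge0 // -sE;
  by apply: nondecreasing_cvgn_le => //; exact: nd.
have cc : cvgn (series (cauchy_prod u v)).
  apply: nondecreasing_is_cvgn; first exact: nd.
  by exists (limn (series u) * limn (series v)) => _ [N _ <-].
have -> : limn (series u) * limn (series v) = limn (series (cauchy_prod u v)); last exact: cc.
apply/eqP; rewrite eq_le; apply/andP; split; last first.
  by apply: limr_le => //; near=> N.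
rewrite -(cvg_lim _ cuv) //; apply: limr_le; first by apply/cvg_ex; eexists; exact: cuv.
near=> N; apply: le_trans (le2 N) _.
by apply: nondecreasing_cvgn_le => //; exact: nd.
Unshelve. all: end_near. Qed.

(** The difference between the product of the partial sums and the partial sum
    of the Cauchy product is dominated by the same difference for the moduli. *)
Lemma csum_cauchy_prod a b : csummable a -> csummable b ->
  csummable (cauchy_prod a b) /\ csum (cauchy_prod a b) = csum a * csum b.
Proof.
move=> ca cb; pose u n := cmod (a n); pose v n := cmod (b n).
have u0 n : 0 <= u n by exact: cmod_ge0.
have v0 n : 0 <= v n by exact: cmod_ge0.
have cuv := cvg_cauchy_prod_nonneg u0 v0 ca cb.
have le n : cmod (cauchy_prod a b n) <= cauchy_prod u v n.
  by apply: le_trans (ler_cmod_sum _ _ _) _; apply: ler_sum => i _; rewrite cmodM.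
have cs : csummable (cauchy_prod a b) by apply: csummable_le le _; apply/cvg_ex; eexists; exact: cuv.
split=> //; apply: csum_lim.
have h := cvg_complexM (csummable_cvg ca) (csummable_cvg cb).
have sE (K : zmodType) (w : nat -> K) N : series w N = \sum_(n < N) w n by rewrite /series /= big_mkord.
have d0 : (fun N => cmod (series a N * series b N - series (cauchy_prod a b) N)) @ \oo --> (0 : R).
  have e0 : (fun N => series u N * series v N - series (cauchy_prod u v) N) @ \oo --> (0 : R).
    by rewrite -(subrr (limn (series u) * limn (series v))); apply: cvgB => //; apply: cvgM.
  apply: (squeeze_cvgr _ (cvg_cst 0) e0); near=> N; rewrite cmod_ge0 /=.
  have D (K : comNzRingType) (f g : nat -> K) : series f N * series g N - series (cauchy_prod f g) N
      = \sum_(i < N) f i * \sum_(N - i <= j < N) g j.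
    rewrite !sE series_cauchy_prod big_distrl /= -sumrB; apply: eq_bigr => i _.
    rewrite -mulrBr; congr (_ * _).
    rewrite -!(big_mkord xpredT) (big_cat_nat (n := N - i)) ?leq_subr //=.
    by rewrite addrAC subrr add0r.
  rewrite !D; apply: le_trans (ler_cmod_sum _ _ _) _; apply: ler_sum => i _.
  by rewrite cmodM; apply: ler_wpM2l; [exact: cmod_ge0|exact: ler_cmod_sum].
have d1 : (fun N => series a N * series b N - series (cauchy_prod a b) N : cplx R) @ \oo --> (0 : cplx R).
  apply/cvg_complexP; split; apply/cvgrPdist_lt => e e0; move/cvgrPdist_lt/(_ e e0): d0;
  apply: filterS => N; rewrite !sub0r !normrN (ger0_norm (cmod_ge0 _)); apply: le_lt_trans.
    exact: Re_le_cmod.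
  exact: Im_le_cmod.
have := cvg_complexD h (@cvg_complexZ R (-1) _ _ d1); rewrite mulr0 addr0.
rewrite (_ : _ + _ = series (cauchy_prod a b)) //; apply/funext => N /=.
rewrite -[LHS]/(series a N * series b N + -1 * (series a N * series b N - series (cauchy_prod a b) N)).
by ring.
Unshelve. all: end_near. Qed.

End CauchyProductSeries.

Section PowerSeriesGrowth.
Variable R : realType.
Implicit Types (a : nat -> R[i]) (r s : R) (z : R[i]).

(** That is a_m = O(r^(-m)); up to the boundary case, r is at most the radius of
    convergence. *)
Definition coef_bounded a r := exists K : R, forall m, cmod (a m) * r ^+ m <= K.

Lemma coef_bounded_cmod a r : 0 <= r -> coef_bounded a r ->
  exists2 K : R, 0 < K & forall m, cmod (a m) * r ^+ m <= K.
Proof.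
move=> r0 [K hK]; exists (`|K| + 1); first by rewrite ltr_wpDl.
by move=> m; apply: le_trans (hK m) (le_trans (ler_norm K) _); rewrite lerDl.
Qed.

Lemma coef_boundedW a r s : 0 <= s <= r -> coef_bounded a r -> coef_bounded a s.
Proof.
move=> /andP[s0 sr] [K hK]; exists K => m; apply: le_trans (hK m).
by apply: ler_wpM2l; [exact: cmod_ge0 | apply: lerXn2r; rewrite ?nnegrE // (le_trans s0)].
Qed.

Lemma coef_bounded_series a r s : coef_bounded a r -> 0 <= s < r ->
  cvgn (series (fun m => cmod (a m) * s ^+ m)).
Proof.
move=> ga /andP[s0 sr]; have r0 : 0 < r by apply: le_lt_trans sr.
have [K K0 hK] := coef_bounded_cmod (ltW r0) ga.
(* |a_m| s^m = |a_m| r^m (s / r)^m *)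
apply: (@series_le_cvg _ _ (geometric K (s / r))) => [n|n|n|].
- by rewrite mulr_ge0 ?cmod_ge0 ?exprn_ge0.
- by rewrite /geometric /= mulr_ge0 ?(ltW K0) // exprn_ge0 // divr_ge0 // ltW.
- rewrite /geometric /= expr_div_n mulrA ler_pdivlMr ?exprn_gt0 // mulrAC.
  by apply: ler_wpM2r; rewrite ?exprn_ge0.
- apply: is_cvg_geometric_series; rewrite ger0_norm ?divr_ge0 ?(ltW r0) //.
  by rewrite ltr_pdivrMr ?mul1r.
Qed.

Lemma coef_bounded_csummable a r z : coef_bounded a r -> cmod z < r ->
  csummable (fun m => a m * z ^+ m).
Proof.
move=> ga zr; apply: (@csummable_le _ _ (fun m => cmod (a m) * cmod z ^+ m)).
  by move=> n; rewrite cmodM cmodX.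
by apply: coef_bounded_series ga _; rewrite cmod_ge0.
Qed.

(** Each of the m + 1 terms of 1 + q + ... + q^m is at least q^m. *)
Lemma mulrn_expr_le (q : R) m : 0 <= q < 1 -> m.+1%:R * q ^+ m <= (1 - q)^-1.
Proof.
move=> /andP[q0 q1]; rewrite -[leRHS]mul1r ler_pdivlMr ?subr_gt0 //.
apply: (@le_trans _ _ (1 - q ^+ m.+1)); last by rewrite gerBl exprn_ge0.
have -> : 1 - q ^+ m.+1 = (\sum_(i < m.+1) q ^+ i) * (1 - q).
  rewrite -{1}(expr1n R m.+1) subrXX mulrC; congr (_ * _); apply: eq_bigr => i _.
  by rewrite expr1n mul1r.
apply: ler_wpM2r; first by rewrite subr_ge0 ltW.
rewrite -[m.+1 in leLHS]card_ord -sum1_card natr_sum big_distrl /=; apply: ler_sum => i _.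
by rewrite mul1r; apply: ler_wiXn2l; rewrite ?(ltW q1) // -ltnS.
Qed.

Lemma coef_bounded_deriv a r s : coef_bounded a r -> 0 <= s < r -> coef_bounded (shift_deriv a) s.
Proof.
move=> ga /andP[s0 sr]; have r0 : 0 < r by apply: le_lt_trans sr.
have [K K0 hK] := coef_bounded_cmod (ltW r0) ga.
exists (K / r * (1 - s / r)^-1) => m; rewrite /shift_deriv -mulr_natr cmodM cmod_nat.
have -> : cmod (a m.+1) * m.+1%:R * s ^+ m =
   (cmod (a m.+1) * r ^+ m.+1 / r) * (m.+1%:R * (s / r) ^+ m).
  by rewrite expr_div_n exprS; field; rewrite ?expf_neq0 ?gt_eqF.
have q0 : 0 <= s / r by rewrite divr_ge0 // ltW.
have ir0 : 0 <= r^-1 by rewrite invr_ge0 ltW.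
apply: ler_pM.
- by rewrite mulr_ge0 // mulr_ge0 ?cmod_ge0 // exprn_ge0 // ltW.
- by rewrite mulr_ge0 ?ler0n // exprn_ge0.
- by rewrite ler_wpM2r.
by apply: mulrn_expr_le; rewrite divr_ge0 ?(ltW r0) //= ltr_pdivrMr ?mul1r.
Qed.

Lemma coef_bounded_iter_deriv a r s n : coef_bounded a r -> 0 <= s < r ->
  coef_bounded (iter n (@shift_deriv _) a) s.
Proof.
elim: n s => [|n IH] s ga /andP[s0 sr]; first by apply: coef_boundedW ga; rewrite s0 ltW.
rewrite iterS; apply: (@coef_bounded_deriv _ ((s + r) / 2)); last by rewrite s0 midf_lt.
apply: IH => //; rewrite midf_lt // andbT divr_ge0 // addr_ge0 // ltW //.
exact: le_lt_trans sr.
Qed.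

End PowerSeriesGrowth.

Section ComplexValuedDerivative.
Local Open Scope complex_scope.
Variable R : realType.
Local Notation Re := complex.Re.
Local Notation Im := complex.Im.
Implicit Types (f g : R -> R[i]) (t : R) (d e k : R[i]).

(** Derivative with respect to a real variable: power series are differentiated
    along rays from the origin. *)
Definition is_cderive t f d :=
  is_derive t (1 : R) (fun x => Re (f x)) (Re d) /\
  is_derive t (1 : R) (fun x => Im (f x)) (Im d).

Lemma is_cderive_eq t f d e : is_cderive t f d -> d = e -> is_cderive t f e.
Proof. by move=> h <-. Qed.

Lemma is_cderive_unique t f d e : is_cderive t f d -> is_cderive t f e -> d = e.
Proof.
move=> [[_ dr] [_ di]] [[_ er] [_ ei]]; apply: complex_eq; first by rewrite -dr -er.
by rewrite -di -ei.
Qed.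

Lemma is_cderive_near t f g d : (\near t, f t = g t) -> is_cderive t f d -> is_cderive t g d.
Proof.
move=> fg [fr fi]; split; [apply: near_eq_is_derive fr | apply: near_eq_is_derive fi];
by apply: filterS fg => x ->.
Qed.

Lemma near_dist_lt t (e : R) : 0 < e -> \forall x \near t, `|t - x| < e.
Proof.
move=> e0; near=> x.
by near: x; apply: (@cvgr_dist_lt _ R^o _ _ _ (fun x : R => x) t).
Unshelve. all: end_near. Qed.

Lemma near_norm_lt t s : `|t| < s -> \forall x \near t, `|x| < s.
Proof.
rewrite -subr_gt0 => /(near_dist_lt t); apply: filterS => x h.
by rewrite -[x](subrK t); apply: le_lt_trans (ler_normD _ _) _; rewrite -ltrBrDr distrC.
Qed.

Lemma is_cderive_itv t s f g d : `|t| < s -> (forall x, `|x| < s -> f x = g x) ->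
  is_cderive t f d -> is_cderive t g d.
Proof.
move=> ts fg; apply: is_cderive_near.
by apply: filterS (near_norm_lt ts) => x; apply: fg.
Qed.

Lemma is_cderive_cst t k : is_cderive t (fun=> k) 0.
Proof. by split; apply: is_derive_cst. Qed.

Lemma is_cderive_real t k : is_cderive t (fun x => x%:C * k) k.
Proof.
have Rk x : Re (x%:C * k) = x * Re k by rewrite cReM /= mul0r subr0.
have Ik x : Im (x%:C * k) = x * Im k by rewrite cImM /= mul0r addr0.
split; [under eq_fun do rewrite Rk | under eq_fun do rewrite Ik].
  by apply: is_derive_eq; rewrite scaler0 add0r /GRing.scale /= mulr1.
by apply: is_derive_eq; rewrite scaler0 add0r /GRing.scale /= mulr1.
Qed.

Lemma is_cderiveD t f g d e : is_cderive t f d -> is_cderive t g e ->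
  is_cderive t (fun x => f x + g x) (d + e).
Proof.
move=> [fr fi] [gr gi]; split; [under eq_fun do rewrite cReD | under eq_fun do rewrite cImD].
  by rewrite cReD; apply: is_deriveD.
by rewrite cImD; apply: is_deriveD.
Qed.

Lemma is_cderiveN t f d : is_cderive t f d -> is_cderive t (fun x => - f x) (- d).
Proof.
move=> [fr fi]; split; [under eq_fun do rewrite cReN | under eq_fun do rewrite cImN].
  by rewrite cReN; apply: is_deriveN.
by rewrite cImN; apply: is_deriveN.
Qed.

Lemma is_cderiveM t f g d e : is_cderive t f d -> is_cderive t g e ->
  is_cderive t (fun x => f x * g x) (d * g t + f t * e).
Proof.
move=> [fr fi] [gr gi]; split; [under eq_fun do rewrite cReM | under eq_fun do rewrite cImM].
  by apply: is_derive_eq; rewrite !cReImE /GRing.scale /=; ring.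
by apply: is_derive_eq; rewrite !cReImE /GRing.scale /=; ring.
Qed.

Lemma is_cderive_horner t f d (p : {poly R[i]}) : is_cderive t f d ->
  is_cderive t (fun x => p.[f x]) (p^`().[f t] * d).
Proof.
move=> fd; elim/poly_ind: p => [|p c IH].
  rewrite deriv0 horner0 mul0r; under eq_fun do rewrite horner0.
  exact: is_cderive_cst.
under eq_fun do rewrite hornerMXaddC.
have h := is_cderiveD (is_cderiveM IH fd) (is_cderive_cst t c).
apply: is_cderive_eq h _.
by rewrite derivD derivM derivX derivC !hornerE; ring.
Qed.

Lemma is_cderive_continuous t f d : is_cderive t f d ->
  {for t, continuous (fun x => Re (f x))} /\ {for t, continuous (fun x => Im (f x))}.
Proof.
by move=> [[fr _] [fi _]]; split; exact/differentiable_continuous/derivable1_diffP.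
Qed.

End ComplexValuedDerivative.

Section PowerSeriesSum.
Local Open Scope complex_scope.
Variable R : realType.
Local Notation Re := complex.Re.
Local Notation Im := complex.Im.
Implicit Types (a b : nat -> R[i]) (z : R[i]).

Definition cpsum a z : R[i] := csum (fun m => a m * z ^+ m).

Lemma cpsum0 a : cpsum a 0 = a 0%N.
Proof.
have /csum_finite[_] : forall n, (1 <= n)%N -> a n * 0 ^+ n = 0.
  by case=> // n _; rewrite expr0n mulr0.
by rewrite big_ord1 expr0 mulr1.
Qed.

Lemma cpsumD a b r z : coef_bounded a r -> coef_bounded b r -> cmod z < r ->
  cpsum (fun m => a m + b m) z = cpsum a z + cpsum b z.
Proof.
move=> ga gb zr; rewrite /cpsum -csumD; try exact: coef_bounded_csummable zr.
by congr csum; apply/funext => m; rewrite mulrDl.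
Qed.

Lemma cpsumZ a r k z : coef_bounded a r -> cmod z < r ->
  cpsum (fun m => k * a m) z = k * cpsum a z.
Proof.
move=> ga zr; rewrite /cpsum -csumZ; last exact: coef_bounded_csummable zr.
by congr csum; apply/funext => m; rewrite mulrA.
Qed.

Lemma cpsum_cauchy_prod a b r z : coef_bounded a r -> coef_bounded b r -> cmod z < r ->
  cpsum (cauchy_prod a b) z = cpsum a z * cpsum b z.
Proof.
move=> ga gb zr; have [_ <-] := csum_cauchy_prod (coef_bounded_csummable ga zr)
  (coef_bounded_csummable gb zr).
congr csum; apply/funext => m; rewrite /cauchy_prod big_distrl /=; apply: eq_bigr => i _.
by rewrite mulrACA -exprD subnKC // -ltnS.
Qed.

Let is_derive_pseries (c : nat -> R) (s t : R) : (forall x, `|x| < s -> cvgn (pseries c x)) ->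
  (forall x, `|x| < s -> cvgn (pseries (pseries_diffs c) x)) ->
  (forall x, `|x| < s -> cvgn (pseries (pseries_diffs (pseries_diffs c)) x)) ->
  `|t| < s -> is_derive t (1 : R) (fun x => limn (pseries c x)) (limn (pseries (pseries_diffs c) t)).
Proof.
move=> c0 c1 c2 ts; have [h1 h2] := midf_lt ts.
have n0 : `| (`|t| + s) / 2 | = (`|t| + s) / 2.
  by rewrite ger0_norm // divr_ge0 // addr_ge0 // (le_trans _ (ltW ts)).
apply: (@pseries_snd_diffs _ _ ((`|t| + s) / 2)); rewrite ?n0 //; [apply: c0|apply: c1|apply: c2];
by rewrite n0.
Qed.

Let coef_bounded_prod a r z (s : R) : coef_bounded a r -> 0 <= s -> s * cmod z <= r ->
  coef_bounded (fun m => a m * z ^+ m) s.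
Proof.
move=> ga s0 sz; have [|K hK] := @coef_boundedW _ a r (s * cmod z) _ ga.
  by rewrite mulr_ge0 ?cmod_ge0.
exists K => m; apply: le_trans (hK m).
have -> // : cmod (a m * z ^+ m) * s ^+ m = cmod (a m) * (s * cmod z) ^+ m.
by rewrite cmodM cmodX exprMn; ring.
Qed.

Let Re_term a m (x : R) : Re (a m * x%:C ^+ m) = Re (a m) * x ^+ m.
Proof. by rewrite -rmorphXn cReM /= mulr0 subr0. Qed.

Let Im_term a m (x : R) : Im (a m * x%:C ^+ m) = Im (a m) * x ^+ m.
Proof. by rewrite -rmorphXn cImM /= mulr0 add0r. Qed.

Let Re_cpsum a s (x : R) : coef_bounded a s -> `|x| < s ->
  cvgn (pseries (fun m => Re (a m)) x) /\
  Re (cpsum a x%:C) = limn (pseries (fun m => Re (a m)) x).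
Proof.
move=> ga xs; have ca : csummable (fun m => a m * x%:C ^+ m).
  by apply: coef_bounded_csummable ga _; rewrite cmod_real.
have E : pseries (fun m => Re (a m)) x = series (fun k => Re (a k * x%:C ^+ k)).
  by rewrite /pseries; congr series; apply/funext => m; rewrite Re_term.
by rewrite E; split; [exact: csummable_Re ca | rewrite Re_csum].
Qed.

Let Im_cpsum a s (x : R) : coef_bounded a s -> `|x| < s ->
  cvgn (pseries (fun m => Im (a m)) x) /\
  Im (cpsum a x%:C) = limn (pseries (fun m => Im (a m)) x).
Proof.
move=> ga xs; have ca : csummable (fun m => a m * x%:C ^+ m).
  by apply: coef_bounded_csummable ga _; rewrite cmod_real.
have E : pseries (fun m => Im (a m)) x = series (fun k => Im (a k * x%:C ^+ k)).
  by rewrite /pseries; congr series; apply/funext => m; rewrite Im_term.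
by rewrite E; split; [exact: csummable_Im ca | rewrite Im_csum].
Qed.

Let cReMn z n : Re (z *+ n) = Re z *+ n.
Proof. by elim: n => [|n IH]; rewrite ?mulr0n // !mulrS cReD IH. Qed.

Let cImMn z n : Im (z *+ n) = Im z *+ n.
Proof. by elim: n => [|n IH]; rewrite ?mulr0n // !mulrS cImD IH. Qed.

Let Re_shift_deriv a : (fun m => Re (shift_deriv a m)) = pseries_diffs (fun m => Re (a m)).
Proof. by apply/funext => m; rewrite /shift_deriv /pseries_diffs cReMn mulr_natl. Qed.

Let Im_shift_deriv a : (fun m => Im (shift_deriv a m)) = pseries_diffs (fun m => Im (a m)).
Proof. by apply/funext => m; rewrite /shift_deriv /pseries_diffs cImMn mulr_natl. Qed.

Let is_cderive_cpsum_real a (s t : R) : coef_bounded a s -> `|t| < s ->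
  is_cderive t (fun x => cpsum a x%:C) (cpsum (shift_deriv a) t%:C).
Proof.
move=> ga ts.
have mid (x : R) : `|x| < s -> exists2 u, `|x| < u & 0 <= u < s.
  move=> xs; exists ((`|x| + s) / 2); have [h1 h2] := midf_lt xs => //.
  by rewrite h2 andbT divr_ge0 // addr_ge0 // (le_trans _ (ltW xs)).
have g1 (x : R) : `|x| < s -> exists2 u, coef_bounded (shift_deriv a) u & `|x| < u.
  by move=> /mid[u xu us]; exists u => //; apply: coef_bounded_deriv us.
have g2 (x : R) : `|x| < s -> exists2 u, coef_bounded (shift_deriv (shift_deriv a)) u & `|x| < u.
  by move=> /mid[u xu us]; exists u => //; apply: (coef_bounded_iter_deriv 2 ga us).
have [u gu tu] := g1 t ts.
have xt := near_norm_lt ts.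
split.
  pose c m := Re (a m).
  have D : is_derive t (1 : R) (fun x => limn (pseries c x)) (limn (pseries (pseries_diffs c) t)).
    apply: is_derive_pseries ts => x xs.
    - by have [] := Re_cpsum ga xs.
    - have [v gv xv] := g1 x xs; have [+ _] := Re_cpsum gv xv.
      by rewrite Re_shift_deriv.
    - have [v gv xv] := g2 x xs; have [+ _] := Re_cpsum gv xv.
      by rewrite !Re_shift_deriv.
  have E := etrans (Re_cpsum gu tu).2 (congr1 (fun c => limn (pseries c t)) (Re_shift_deriv a)).
  apply: (is_derive_eq _ (esym E)); apply: near_eq_is_derive D; near=> x.
  apply/esym/(@Re_cpsum a s x ga _).2.
  by near: x; exact: xt.
pose c m := Im (a m).
have D : is_derive t (1 : R) (fun x => limn (pseries c x)) (limn (pseries (pseries_diffs c) t)).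
  apply: is_derive_pseries ts => x xs.
  - by have [] := Im_cpsum ga xs.
  - have [v gv xv] := g1 x xs; have [+ _] := Im_cpsum gv xv.
    by rewrite Im_shift_deriv.
  - have [v gv xv] := g2 x xs; have [+ _] := Im_cpsum gv xv.
    by rewrite !Im_shift_deriv.
have E := etrans (Im_cpsum gu tu).2 (congr1 (fun c => limn (pseries c t)) (Im_shift_deriv a)).
apply: (is_derive_eq _ (esym E)); apply: near_eq_is_derive D; near=> x.
apply/esym/(@Im_cpsum a s x ga _).2.
by near: x; exact: xt.
Unshelve. all: end_near. Qed.

Lemma is_cderive_cpsum a r z (t : R) : coef_bounded a r -> `|t| * cmod z < r ->
  is_cderive t (fun x => cpsum a (x%:C * z)) (z * cpsum (shift_deriv a) (t%:C * z)).
Proof.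
move=> ga tz; have [s ts sz] : exists2 s, `|t| < s & s * cmod z <= r.
  have [z0|z0] := eqVneq z 0.
    by move: tz; rewrite z0 cmod0 !mulr0 => /ltW r0; exists (`|t| + 1); rewrite ?mulr0 ?ltrDl.
  by exists (r / cmod z); [rewrite ltr_pdivlMr ?cmod_gt0 | rewrite divfK // cmod_eq0].
have gz : coef_bounded (fun m => a m * z ^+ m) s by apply: coef_bounded_prod ga _ sz; apply: le_trans (ltW ts).
have E b x : cpsum b (x%:C * z) = cpsum (fun m => b m * z ^+ m) x%:C.
  by congr csum; apply/funext => m; rewrite exprMn; ring.
under eq_fun do rewrite E.
apply: is_cderive_eq (is_cderive_cpsum_real gz ts) _.
have [u [tu us]] : exists u, `|t| * cmod z < u /\ 0 <= u < r.
  exists ((`|t| * cmod z + r) / 2); have [h1 h2] := midf_lt tz; split => //.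
  by rewrite h2 andbT divr_ge0 // addr_ge0 ?mulr_ge0 ?cmod_ge0 // (le_trans _ (ltW tz)) ?mulr_ge0 ?cmod_ge0.
rewrite -(@cpsumZ _ u); [| exact: coef_bounded_deriv ga us | by rewrite cmodM cmod_real].
congr csum; apply/funext => m; rewrite /shift_deriv exprMn exprS.
by ring.
Qed.

End PowerSeriesSum.

(** * Cauchy estimates *)

Section CauchyEstimate.
Local Open Scope complex_scope.
Variable R : realType.
Implicit Types (a : nat -> R[i]) (z w : R[i]).

Lemma complex_prim_root_exists N : (0 < N)%N -> exists w : R[i], N.-primitive_root w.
Proof.
move=> N0; have [rs Dp] := closed_field_poly_normal ('X^N - 1 : {poly R[i]}).
rewrite (monicP _) ?monicXnsubC // scale1r in Dp.
have rs1 : all N.-unity_root rs by apply/allP=> z; rewrite -root_prod_XsubC -Dp.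
have szrs : (N < (size rs).+1)%N by rewrite -(size_prod_XsubC rs id) -Dp size_XnsubC.
have [|w] := hasP (has_prim_root N0 rs1 _ szrs); last by exists w.
by rewrite -separable_prod_XsubC -Dp separable_Xn_sub_1 // pnatr_eq0 -lt0n.
Qed.

Lemma sum_prim_root_exp N (w : R[i]) m : N.-primitive_root w ->
  \sum_(j < N) w ^+ (m * j) = if (N %| m)%N then N%:R else 0.
Proof.
move=> wN; under eq_bigr do rewrite exprM.
case: ifPn => [|Nm].
  rewrite (prim_order_dvd wN) => /eqP->; rewrite (eq_bigr (fun=> 1)); last by move=> j _; rewrite expr1n.
  by rewrite sumr_const card_ord.
have w1 : w ^+ m - 1 != 0 by rewrite subr_eq0 -(prim_order_dvd wN).
apply: (mulfI w1); rewrite mulr0 -subrX1 -exprM mulnC exprM (prim_expr_order wN) expr1n.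
by rewrite subrr.
Qed.

Lemma cmod_prim_root N (w : R[i]) : N.-primitive_root w -> cmod w = 1.
Proof.
move=> wN; apply/eqP; rewrite -(@pexpr_eq1 _ (cmod w) N) ?cmod_ge0 ?(prim_order_gt0 wN) //.
by rewrite -cmodX (prim_expr_order wN) cmod1.
Qed.

(** The coefficient a_k is extracted by averaging over the N-th roots of unity,
    in place of a contour integral; this is exact for a polynomial with at
    most N terms. *)
Lemma cauchy_estimate_poly a N k (r : R) (M : R) : (k < N)%N -> 0 <= r ->
  (forall z, cmod z = r -> cmod (\sum_(m < N) a m * z ^+ m) <= M) ->
  cmod (a k) * r ^+ k <= M.
Proof.
move=> kN r0 hM; have N0 : (0 < N)%N by apply: leq_ltn_trans kN.
have [w wN] := complex_prim_root_exists N0; have w1 := cmod_prim_root wN.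
pose T z := \sum_(m < N) a m * z ^+ m.
(* the exponent N - k replaces -k, as w^N = 1 *)
have E : \sum_(j < N) T (r%:C * w ^+ j) * w ^+ ((N - k) * j) = N%:R * (a k * r%:C ^+ k).
  rewrite /T; under eq_bigr do rewrite big_distrl /=.
  rewrite exchange_big /=.
  have term m : \sum_(j < N) a m * (r%:C * w ^+ j) ^+ m * w ^+ ((N - k) * j) =
      a m * r%:C ^+ m * (if (N %| m + (N - k))%N then N%:R else 0).
    rewrite -(sum_prim_root_exp _ wN) big_distrr /=; apply: eq_bigr => j _.
    rewrite exprMn -exprM [(j * m)%N]mulnC mulnDl exprD; ring.
  under eq_bigr do rewrite term.
  rewrite (bigD1 (Ordinal kN)) //= subnKC ?(ltnW kN) // dvdnn big1 ?addr0; first by ring.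
  move=> m mk; case: ifP; rewrite ?mulr0 // => /dvdnP[q qE]; exfalso.
  have mN := ltn_ord m; have q1 : q = 1%N.
    case: q qE => [|[|q]] qE //; first by lia.
    have h : (N + N <= q.+2 * N)%N by rewrite !mulSn; lia.
    by move: h; rewrite -qE; lia.
  by move/eqP: mk; apply; apply/val_inj => /=; move: qE; rewrite q1; lia.
have NR : (0 : R) < N%:R by rewrite ltr0n.
rewrite -(ler_pM2l NR).
have -> : N%:R * (cmod (a k) * r ^+ k) = cmod (N%:R * (a k * r%:C ^+ k)).
  by rewrite !cmodM cmodX cmod_real cmod_nat ger0_norm.
rewrite -E; apply: le_trans (ler_cmod_sum _ _ _) _.
rewrite -[X in X%:R * M](card_ord N) -sum1_card natr_sum big_distrl /=; apply: ler_sum => j _.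
rewrite cmodM cmodX w1 expr1n mulr1 mul1r; apply: hM.
by rewrite cmodM cmodX w1 expr1n mulr1 cmod_real ger0_norm.
Qed.

(** The partial sums are bounded on the circle by M plus a remainder that is
    uniform in z. *)
Lemma cauchy_estimate a (r s M : R) k : coef_bounded a s -> 0 <= r < s ->
  (forall z, cmod z = r -> cmod (cpsum a z) <= M) -> cmod (a k) * r ^+ k <= M.
Proof.
move=> ga /andP[r0 rs] hM.
pose v m := cmod (a m) * r ^+ m.
have cv : cvgn (series v) by apply: coef_bounded_series ga _; rewrite r0.
have tail0 : (fun N => M + (limn (series v) - series v N)) @ \oo --> M.
  rewrite -[X in _ --> X]addr0 -(subrr (limn (series v))).
  by apply: cvgD; [exact: cvg_cst | apply: cvgB => //; exact: cvg_cst].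
have cst : (fun _ : nat => cmod (a k) * r ^+ k) @ \oo --> cmod (a k) * r ^+ k by exact: cvg_cst.
apply: (ler_cvg_to cst tail0); near=> N.
apply: (@cauchy_estimate_poly _ N) => //; first by near: N; exact: nbhs_infty_gt.
move=> z zr; have /cmod_csum_tail/(_ cv N) : forall m, cmod (a m * z ^+ m) <= v m.
  by move=> m; rewrite cmodM cmodX zr.
rewrite -/(cpsum a z) cmodB => h; have := hM z zr.
have := ler_cmodD (\sum_(n < N) a n * z ^+ n - cpsum a z) (cpsum a z); rewrite subrK.
move=> h1 h2; apply: le_trans h1 _; rewrite addrC; exact: lerD.
Unshelve. all: end_near. Qed.

End CauchyEstimate.

(** * Derivatives of the sum along the differential equation *)

Section TaylorPolynomials.
Variables (R : realType) (s : R[i]).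

(** If f' = f^2 - s f^3, then the n-th derivative of f is [ode_poly n] at f. *)
Definition ode_poly n : {poly R[i]} :=
  iter n (fun p : {poly R[i]} => p^`() * ('X^2 - s *: 'X^3)) 'X.

(** Replacing X^e by its derivative times X^2 - s X^3 turns one term into two and
    multiplies the sum of the moduli of the coefficients by at most
    e (1 + |s|), where e <= 2 n + 1.  A list of terms, possibly with repeated
    exponents, is easier to bound than the coefficients themselves. *)
Lemma ode_poly_coefs n : exists l : seq (R[i] * nat),
  [/\ ode_poly n = \sum_(x <- l) x.1 *: 'X^(x.2),
      all (fun x => x.2 <= n.*2.+1)%N l
    & \sum_(x <- l) cmod x.1 <= (2 * (1 + cmod s)) ^+ n * n`!%:R].
Proof.
elim: n => [|n [l [pE dl sl]]].
  exists [:: (1, 1%N)]; split; rewrite ?big_seq1 //= ?scale1r ?expr1 //.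
  by rewrite cmod1 expr0 mul1r.
pose up (x : R[i] * nat) := (x.2%:R * x.1, x.2.+1).
pose up2 (x : R[i] * nat) := (- s * (x.2%:R * x.1), x.2.+2).
exists (map up l ++ map up2 l); split.
- rewrite [LHS]/= -/(ode_poly n) pE big_cat /= !big_map -big_split /= raddf_sum big_distrl /=.
  apply: eq_bigr => -[k e] _ /=; rewrite derivZ derivXn.
  case: e => [|e]; first by rewrite mulr0n scaler0 mul0r !mul0r mulr0 !scale0r addr0.
  rewrite -mulr_natl -(rmorph_nat (@polyC R[i])) -!mul_polyC !rmorphM rmorphN /= !exprS.
  by ring.
- rewrite all_cat !all_map; apply/andP; split; apply: sub_all dl => x /=; rewrite !doubleS; lia.
- rewrite big_cat /= !big_map -big_split /= exprS factS natrM.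
  apply: (@le_trans _ _ ((2 * (1 + cmod s) * n.+1%:R) * \sum_(x <- l) cmod x.1)); last first.
    have -> : 2 * (1 + cmod s) * (2 * (1 + cmod s)) ^+ n * (n.+1%:R * n`!%:R) =
      (2 * (1 + cmod s) * n.+1%:R) * ((2 * (1 + cmod s)) ^+ n * n`!%:R) by ring.
    by rewrite ler_wpM2l // !mulr_ge0 // addr_ge0 ?cmod_ge0.
  rewrite big_distrr /= big_seq [leRHS]big_seq; apply: ler_sum => x xl.
  rewrite !cmodM cmodN cmod_nat.
  have -> : x.2%:R * cmod x.1 + cmod s * (x.2%:R * cmod x.1) =
     x.2%:R * ((1 + cmod s) * cmod x.1) by ring.
  have -> : 2 * (1 + cmod s) * n.+1%:R * cmod x.1 = (2 * n.+1%:R) * ((1 + cmod s) * cmod x.1).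
    by ring.
  apply: ler_wpM2r; first by rewrite mulr_ge0 ?addr_ge0 ?cmod_ge0.
  by rewrite -natrM ler_nat; move/allP: dl => /(_ _ xl) /=; lia.
Qed.

Lemma ode_poly_bound n (W : R) (w : R[i]) : 1 <= W -> cmod w <= W ->
  cmod (ode_poly n).[w] <= W * (2 * (1 + cmod s) * W ^+ 2) ^+ n * n`!%:R.
Proof.
move=> W1 wW; have [l [-> dl sl]] := ode_poly_coefs n.
have W0 : 0 <= W by apply: le_trans W1.
rewrite horner_sum; apply: le_trans (ler_cmod_sum _ _ _) _.
apply: (@le_trans _ _ (W ^+ n.*2.+1 * \sum_(x <- l) cmod x.1)).
  rewrite big_distrr /= big_seq [leRHS]big_seq; apply: ler_sum => x xl.
  rewrite hornerZ hornerXn cmodM cmodX mulrC ler_wpM2r ?cmod_ge0 //.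
  apply: (@le_trans _ _ (W ^+ x.2)); first by apply: lerXn2r; rewrite ?nnegrE ?cmod_ge0.
  by apply: ler_weXn2l => //; move/allP: dl => /(_ _ xl).
apply: le_trans (ler_wpM2l _ sl) _; first by rewrite exprn_ge0.
rewrite le_eqVlt; apply/orP; left; apply/eqP.
by rewrite exprS -mul2n exprM [in RHS]exprMn; ring.
Qed.

End TaylorPolynomials.

Section LambertODE.
Local Open Scope complex_scope.
Variables (R : realType) (s : R[i]).
Hypothesis s1 : 1 + s != 0.
Implicit Types (z : R[i]) (r : R).

Lemma lambert_coefE m : lambert_coef s m = (lambert_poly _ m).[(1 + s)^-1].
Proof.
rewrite /lambert_coef /lambert_poly horner_sum; apply: eq_bigr => p _.
by rewrite hornerZ hornerXn mulrAC.
Qed.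

Lemma lambert_coef0 : lambert_coef s 0 = 0.
Proof. by rewrite /lambert_coef big_ord0. Qed.

Lemma lambert_radius_gt0 : exists2 r, 0 < r & coef_bounded (lambert_coef s) r.
Proof.
pose q := 3 * (1 + cmod (1 + s)^-1) * cmod (1 + s)^-1.
have z0 : 0 < cmod (1 + s)^-1 by rewrite cmod_gt0 invr_eq0.
have q0 : 0 < q by rewrite !mulr_gt0 // addr_gt0.
exists q^-1; first by rewrite invr_gt0.
exists 1 => m; rewrite exprVn ler_pdivrMr ?exprn_gt0 // mul1r lambert_coefE -lecR.
rewrite -normc_cmod; apply: le_trans (lambert_poly_bound _ _) _.
rewrite !normc_cmod rmorphXn le_eqVlt; apply/orP; left; apply/eqP; congr (_ ^+ m).
by apply: complex_eq; rewrite /q /=; ring.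
Qed.

Let c := lambert_coef s.
Let f := shift_deriv c.

(** With these, u = lambert_sum and u' = lambert_sum_deriv; [lambert_den] is
    e^(-u) + s by the equation defining u. *)
Definition lambert_sum z : R[i] := cpsum c z.
Definition lambert_sum_deriv z : R[i] := cpsum f z.
Definition lambert_den z : R[i] := 1 + s + s * lambert_sum z - z.

Lemma lambert_sum0 : lambert_sum 0 = 0.
Proof. by rewrite /lambert_sum cpsum0 /c lambert_coef0. Qed.

(** The identity [lambert_poly_ode] between coefficients, summed. *)
Lemma lambert_ode r z : coef_bounded c r -> cmod z < r ->
  lambert_sum_deriv z * lambert_den z = 1.
Proof.
move=> gc zr; pose d (j : nat) : R[i] := (1 + s) *+ (j == 0) - (j == 1)%:R.
have [u [zu ur]] : exists u, cmod z < u /\ 0 <= u < r.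
  exists ((cmod z + r) / 2); have [h1 h2] := midf_lt zr; split => //.
  by rewrite h2 andbT divr_ge0 // addr_ge0 ?cmod_ge0 // (le_trans (cmod_ge0 z)) // ltW.
have gu : coef_bounded c u by apply: coef_boundedW gc; case/andP: ur => -> /ltW.
have gf : coef_bounded f u by apply: coef_bounded_deriv gc ur.
have gsc : coef_bounded (fun j => s * c j) u.
  have [K hK] := gu; exists (cmod s * K) => m; rewrite cmodM -mulrA ler_wpM2l ?cmod_ge0 //.
have d2 j : (2 <= j)%N -> d j = 0 by case: j => [|[|j]] // _; rewrite /d /= mulr0n subr0.
have gd : coef_bounded d u.
  exists (cmod (d 0%N) + cmod (d 1%N) * u) => -[|[|m]]; last first.
  - by rewrite d2 // cmod0 mul0r addr_ge0 ?mulr_ge0 ?cmod_ge0 //; case/andP: ur.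
  - by rewrite expr1 lerDr cmod_ge0.
  - by rewrite expr0 mulr1 lerDl mulr_ge0 ?cmod_ge0 //; case/andP: ur.
have dz : cpsum d z = 1 + s - z.
  have /csum_finite[_ E] : forall n, (2 <= n)%N -> d n * z ^+ n = 0 by move=> n /d2->; rewrite mul0r.
  rewrite /cpsum E !big_ord_recl big_ord0 /= /d /= /bump /= !mulr1n !mulr0n expr0 expr1; ring.
have -> : lambert_den z = cpsum (fun j => s * c j + d j) z.
  by rewrite (cpsumD gsc gd zu) (cpsumZ _ gu zu) dz /lambert_den /lambert_sum; ring.
have gv : coef_bounded (fun j => s * c j + d j) u.
  have [K hK] := gsc; have [K' hK'] := gd; exists (K + K') => m.
  apply: le_trans (_ : (cmod (s * c m) + cmod (d m)) * u ^+ m <= _); last first.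
    by rewrite mulrDl lerD.
  by rewrite ler_wpM2r ?ler_cmodD // exprn_ge0 //; case/andP: ur.
rewrite /lambert_sum_deriv -(cpsum_cauchy_prod gf gv zu).
have -> : cauchy_prod f (fun j => s * c j + d j) = fun m => (m == 0)%:R.
  apply/funext => m; rewrite -(lambert_poly_ode s1 m).
  apply: eq_bigr => i _; rewrite /f /shift_deriv /c !lambert_coefE /d addrA //.
have /csum_finite[_] : forall n, (1 <= n)%N -> (n == 0)%:R * z ^+ n = 0.
  by case=> // n _; rewrite mul0r.
by rewrite big_ord1 expr0 mulr1.
Qed.

Lemma is_cderive_lambert_sum r z (t : R) : coef_bounded c r -> `|t| * cmod z < r ->
  is_cderive t (fun x => lambert_sum (x%:C * z)) (z * lambert_sum_deriv (t%:C * z)).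
Proof. exact: is_cderive_cpsum. Qed.

Lemma is_cderive_lambert_den r z (t : R) : coef_bounded c r -> `|t| * cmod z < r ->
  is_cderive t (fun x => lambert_den (x%:C * z)) (z * (s * lambert_sum_deriv (t%:C * z) - 1)).
Proof.
move=> gc tz.
have h := is_cderiveD (is_cderiveD (is_cderive_cst t (1 + s))
  (is_cderiveM (is_cderive_cst t s) (is_cderive_lambert_sum gc tz)))
  (is_cderiveN (is_cderive_real t z)).
apply: is_cderive_eq h _; ring.
Qed.

(** Differentiate f V = 1, where V' = s f - 1, along the ray through z. *)
Lemma lambert_sum_deriv_ode r z : coef_bounded c r -> 0 < cmod z < r ->
  cpsum (shift_deriv f) z = lambert_sum_deriv z ^+ 2 - s * lambert_sum_deriv z ^+ 3.
Proof.
move=> gc /andP[z0 zr].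
have [u [zu /andP[u0 ur]]] : exists u, cmod z < u /\ 0 <= u < r.
  exists ((cmod z + r) / 2); have [h1 h2] := midf_lt zr; split => //.
  by rewrite h2 andbT divr_ge0 // addr_ge0 ?cmod_ge0 // (le_trans (cmod_ge0 z)) // ltW.
have zu1 : `|1 : R| * cmod z < u by rewrite normr1 mul1r.
have zr1 : `|1 : R| * cmod z < r by rewrite normr1 mul1r.
have gf : coef_bounded f u by apply: coef_bounded_deriv gc _; rewrite u0.
have h := is_cderiveM (is_cderive_cpsum gf zu1) (is_cderive_lambert_den gc zr1).
have h0 : is_cderive (1 : R) (fun x => cpsum f (x%:C * z) * lambert_den (x%:C * z)) 0.
  apply: (@is_cderive_itv _ _ (u / cmod z) (fun=> 1)); last exact: is_cderive_cst.
    by rewrite normr1 ltr_pdivlMr // mul1r.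
  move=> x; rewrite ltr_pdivlMr // => xz; rewrite (@lambert_ode r) // cmodM cmod_real.
  exact: lt_trans ur.
have E := is_cderive_unique h h0; move: E; rewrite mul1r -/(lambert_sum_deriv z) => E.
have zn0 : z != 0 by rewrite -cmod_gt0.
have FV := lambert_ode gc zr.
apply: (mulfI zn0); set F := lambert_sum_deriv z in E FV *; set V := lambert_den z in E FV.
set F' := cpsum _ _ in E *.
have -> : z * F' = (z * F' * V) * F by rewrite -mulrA [V * F]mulrC FV mulr1.
have -> : z * F' * V = - (F * (z * (s * F - 1))) by apply/eqP; rewrite -addr_eq0 E.
ring.
Qed.

Lemma cpsum_iter_shift_deriv r z n : coef_bounded c r -> 0 < cmod z < r ->
  cpsum (iter n (@shift_deriv _) f) z = (ode_poly s n).[lambert_sum_deriv z].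
Proof.
move=> gc; elim: n z => [|n IH] z; first by rewrite /= hornerX.
move=> /andP[z0 zr]; have zn0 : z != 0 by rewrite -cmod_gt0.
have [u [zu /andP[u0 ur]]] : exists u, cmod z < u /\ 0 <= u < r.
  exists ((cmod z + r) / 2); have [h1 h2] := midf_lt zr; split => //.
  by rewrite h2 andbT divr_ge0 // addr_ge0 ?cmod_ge0 // (le_trans (cmod_ge0 z)) // ltW.
have zu1 : `|1 : R| * cmod z < u by rewrite normr1 mul1r.
have gfn : coef_bounded (iter n (@shift_deriv _) f) u.
  by rewrite /f -iterSr; apply: coef_bounded_iter_deriv gc _; rewrite u0.
have gf : coef_bounded f u by apply: coef_bounded_deriv gc _; rewrite u0.
have h1 := is_cderive_cpsum gfn zu1.
have h2 := is_cderive_horner (ode_poly s n) (is_cderive_cpsum gf zu1).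
have /is_cderive_near/(_ h2) h3 : \forall x \near (1 : R),
   (ode_poly s n).[cpsum f (x%:C * z)] = cpsum (iter n (@shift_deriv _) f) (x%:C * z).
  have n1 : `|(1 : R)| < r / cmod z by rewrite normr1 ltr_pdivlMr // mul1r.
  near=> x; rewrite IH // cmodM cmod_real mulr_gt0 //=; last first.
    rewrite normr_gt0; suff : `|1 - x| < 1.
      by apply: contraTneq => ->; rewrite subr0 normr1 ltxx.
    by near: x; exact: near_dist_lt.
  by rewrite -ltr_pdivlMr //; near: x; exact: near_norm_lt.
have := is_cderive_unique h1 h3; rewrite mul1r -/(lambert_sum_deriv z).
rewrite (lambert_sum_deriv_ode gc) ?z0 // mulrCA => /(mulfI zn0) ->.
by rewrite /= -/(ode_poly s n) hornerM !hornerE.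
Unshelve. all: end_near. Qed.

End LambertODE.

(** * Enlarging the disc while the derivative is bounded *)

Section RadiusBootstrap.
Local Open Scope complex_scope.
Variables (R : realType) (s : R[i]).
Hypothesis s1 : 1 + s != 0.
Implicit Types (z : R[i]) (r : R).
Let c := lambert_coef s.
Let f := shift_deriv c.

Lemma iter_shift_derivE (a : nat -> R[i]) n k :
  iter n (@shift_deriv _) a k = a (n + k)%N *+ ((n + k) ^_ n).
Proof.
elim: n k => [|n IH] k; first by rewrite ffactn0.
by rewrite iterS /shift_deriv IH -mulrnA ffactnSr addSnnS addKn.
Qed.

(** That the radius of convergence is at least r. *)
Definition converges_below r := forall r', 0 <= r' < r -> coef_bounded c r'.

Let gain (W : R) := 2 * (1 + cmod s) * W ^+ 2.

Let gain_gt0 W : 1 <= W -> 0 < gain W.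
Proof.
move=> W1; have W0 : 0 < W by apply: lt_le_trans W1.
by rewrite /gain !mulr_gt0 ?exprn_gt0 // ltr_pwDl ?cmod_ge0.
Qed.

(** Let B = gain W.  On a circle of radius q < r the n-th derivative of f is at
    most n! W B^n, so by the Cauchy estimate its k-th coefficient, which is
    n! C(n + k, n) f_(n + k), gives C(N, n) |f_N| q^k B^(-n) <= W for all
    n + k = N.  The sum over n is |f_N| (q + 1/B)^N <= (N + 1) W, and the factor
    N + 1 disappears on integrating f. *)
Lemma radius_step (W : R) r : 1 <= W -> 0 < r -> converges_below r ->
  (forall z, cmod z < r -> cmod (lambert_sum_deriv s z) <= W) ->
  converges_below (r + (gain W)^-1).
Proof.
move=> W1 r0 cr hW r' /andP[r'0 r'r]; have B0 := gain_gt0 W1; set B := gain W in r'r B0 *.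
have W0 : 0 <= W by apply: le_trans W1.
have [q /andP[q0 qr] r'q] : exists2 q, 0 < q < r & r' <= q + B^-1.
  pose m := Num.max 0 (r' - B^-1).
  have m0 : 0 <= m by rewrite /m le_max lexx.
  have mr : m < r by rewrite /m gt_max r0 ltrBlDr.
  have mq : r' - B^-1 <= m by rewrite /m le_max lexx orbT.
  by exists ((m + r) / 2); lra.
have [u /andP[qu ur]] : exists u, q < u < r by exists ((q + r) / 2); lra.
have u0 : 0 < u by apply: lt_trans qu.
have [u' /andP[uu' u'r]] : exists u', u < u' < r by exists ((u + r) / 2); lra.
have gu' : coef_bounded c u' by apply: cr; rewrite u'r andbT; lra.
have est n k : cmod (f (n + k)%N) * 'C(n + k, n)%:R * q ^+ k <= W * B ^+ n.
  have gn : coef_bounded (iter n (@shift_deriv _) f) u.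
    by rewrite /f -iterSr; apply: coef_bounded_iter_deriv gu' _; rewrite uu' ltW.
  have M z : cmod z = q -> cmod (cpsum (iter n (@shift_deriv _) f) z) <= W * B ^+ n * n`!%:R.
    move=> zq; have zr : 0 < cmod z < u' by rewrite zq q0 (lt_trans qu).
    rewrite (cpsum_iter_shift_deriv s1 n gu' zr); apply: ode_poly_bound => //.
    by apply: hW; rewrite zq.
  have := @cauchy_estimate _ _ q u _ k gn _ M; rewrite qu (ltW q0) => /(_ isT).
  rewrite iter_shift_derivE -(mulr_natr (f _)) cmodM cmod_nat -bin_ffact natrM => h.
  rewrite -(ler_pM2r (_ : 0 < n`!%:R :> R)) ?ltr0n ?fact_gt0 //; apply: le_trans h.
  by rewrite le_eqVlt; apply/orP; left; apply/eqP; ring.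
have bound N : cmod (f N) * (q + B^-1) ^+ N <= N.+1%:R * W.
  rewrite exprDn big_distrr /= -[X in X%:R * W](card_ord N.+1) -sum1_card natr_sum big_distrl /=.
  apply: ler_sum => i _; rewrite mul1r; have iN : (i <= N)%N by rewrite -ltnS.
  have := est i (N - i)%N; rewrite subnKC // => h.
  have Bi : 0 < B ^+ i by rewrite exprn_gt0.
  rewrite -(ler_pM2r Bi); apply: le_trans h; rewrite le_eqVlt; apply/orP; left; apply/eqP.
  rewrite -(mulr_natr (_ * _)) exprVn; field; by rewrite gt_eqF.
have gq : coef_bounded c (q + B^-1).
  have qB : 0 <= q + B^-1 by apply: addr_ge0; rewrite ?invr_ge0; apply: ltW.
  exists (W * (q + B^-1)) => -[|m].
    by rewrite /c lambert_coef0 cmod0 mul0r mulr_ge0.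
  have := bound m; rewrite /f /shift_deriv -(mulr_natr (c _)) cmodM cmod_nat exprS => h.
  rewrite mulrCA [W * _]mulrC ler_wpM2l //.
  rewrite -(ler_pM2l (_ : 0 < m.+1%:R :> R)) ?ltr0n //; apply: le_trans h.
  by rewrite le_eqVlt; apply/orP; left; apply/eqP; ring.
by apply: coef_boundedW gq; rewrite r'0.
Qed.

(** The gain in radius is the same at each step as long as W bounds f, so that
    finitely many steps reach rho. *)
Lemma radius_ge (rho W : R) : 1 <= W ->
  (forall r z, converges_below r -> cmod z < r -> r <= rho -> cmod (lambert_sum_deriv s z) <= W) ->
  converges_below rho.
Proof.
move=> W1 hW; have B0 := gain_gt0 W1; have Bi0 : 0 < (gain W)^-1 by rewrite invr_gt0.
have [r0 r00 gr0] := lambert_radius_gt0 s1.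
have base : converges_below r0.
  by move=> r' /andP[r'0 /ltW r'r]; apply: coef_boundedW gr0; rewrite r'0.
have [rho0|rho0] := leP rho 0.
  by move=> r' /andP[r'0 r'r]; exfalso; lra.
have iterk k : converges_below (Num.min rho (r0 + k%:R * (gain W)^-1)).
  elim: k => [|k IH] r'.
    by rewrite mul0r addr0 lt_min => /andP[r'0 /andP[_ h]]; apply: base; rewrite r'0.
  rewrite lt_min => /andP[r'0 /andP[r'rho r'k]].
  pose r1 := Num.min rho (r0 + k%:R * (gain W)^-1).
  have r10 : 0 < r1 by rewrite /r1 lt_min rho0 /= ltr_wpDr // mulr_ge0 // ltW.
  have hr1 : r1 <= rho by rewrite /r1 ge_min lexx.
  apply: (@radius_step W r1) => //; first by move=> z zr; apply: (hW r1).
  rewrite r'0 /=; rewrite /r1; case: (leP rho) => _; first by apply: lt_trans r'rho _; rewrite ltrDl.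
  suff -> : r0 + k%:R * (gain W)^-1 + (gain W)^-1 = r0 + k.+1%:R * (gain W)^-1 by [].
  by rewrite -natr1 mulrDl mul1r addrA.
move=> r' /andP[r'0 r'r]; have kP := archi_boundP (ltW (divr_gt0 rho0 Bi0)).
set k := Num.bound _ in kP; apply: (iterk k); rewrite r'0 lt_min r'r /=.
apply: (lt_le_trans r'r); rewrite ltr_pdivrMr // in kP.
by apply: (le_trans (ltW kP)); rewrite lerDr ltW.
Qed.

End RadiusBootstrap.

(** * Exponential, logarithm and trigonometric estimates *)

Section ComplexExponential.
Local Open Scope complex_scope.
Variable R : realType.
Local Notation Re := complex.Re.
Local Notation Im := complex.Im.
Implicit Types (z w : R[i]) (t : R).

Definition cexp z : R[i] := (expR (Re z) * cos (Im z)) +i* (expR (Re z) * sin (Im z)).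

Lemma cexpD z w : cexp (z + w) = cexp z * cexp w.
Proof.
rewrite /cexp cReD cImD expRD cosD sinD; apply: complex_eq; rewrite !cReImE /=; ring.
Qed.

Lemma cexp0 : cexp 0 = 1.
Proof. by rewrite /cexp /= expR0 cos0 sin0 mulr1 mulr0. Qed.

Lemma cmod_cexp z : cmod (cexp z) = expR (Re z).
Proof.
rewrite cmodE /= !exprMn -mulrDr cos2Dsin2 mulr1 sqrtr_sqr ger0_norm //; exact: expR_ge0.
Qed.

Lemma is_cderive_cexp t f (d : R[i]) : is_cderive t f d ->
  is_cderive t (fun x => cexp (f x)) (d * cexp (f t)).
Proof.
move=> [fr fi]; split => /=.
  have h1 : is_derive t (1 : R) (fun x => expR (Re (f x))) (Re d * expR (Re (f t))).
    by apply: is_derive_eq (is_derive1_comp _ fr) _; rewrite /GRing.scale /= mulrC.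
  have h2 : is_derive t (1 : R) (fun x => cos (Im (f x))) (Im d * - sin (Im (f t))).
    by apply: is_derive_eq (is_derive1_comp _ fi) _; rewrite /GRing.scale /= mulrC.
  by apply: is_derive_eq (is_deriveM h1 h2) _; rewrite cReM /= /GRing.scale /=; ring.
have h1 : is_derive t (1 : R) (fun x => expR (Re (f x))) (Re d * expR (Re (f t))).
  by apply: is_derive_eq (is_derive1_comp _ fr) _; rewrite /GRing.scale /= mulrC.
have h2 : is_derive t (1 : R) (fun x => sin (Im (f x))) (Im d * cos (Im (f t))).
  by apply: is_derive_eq (is_derive1_comp _ fi) _; rewrite /GRing.scale /= mulrC.
by apply: is_derive_eq (is_deriveM h1 h2) _; rewrite cImM /= /GRing.scale /=; ring.
Qed.

Lemma is_cderive0_cst f t : 0 <= t -> (forall x, 0 <= x <= t -> is_cderive x f 0) -> f t = f 0.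
Proof.
move=> t0 h.
have key (g : R -> R) : (forall x, 0 <= x <= t -> is_derive x (1 : R) g 0) -> g t = g 0.
  move=> hg; have [x||x _] := @MVT_segment R g (fun=> 0) 0 t t0.
  - by rewrite in_itv /= => /andP[a b]; apply: hg; rewrite !ltW.
  - apply: derivable_within_continuous => x; rewrite in_itv /= => /hg h1.
    exact: (@ex_derive _ _ _ _ _ _ _ h1).
  - by rewrite mul0r => /eqP; rewrite subr_eq0 => /eqP.
by apply: complex_eq; [apply: (key (fun x => Re (f x))) | apply: (key (fun x => Im (f x)))];
  move=> x /h [].
Qed.

Lemma cos_arg_bound z : z != 0 -> -1 <= Re z / cmod z <= 1.
Proof.
rewrite -cmod_gt0 => z0; rewrite ler_pdivlMr // ler_pdivrMr // mul1r mulN1r -ler_norml.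
exact: Re_le_cmod.
Qed.

Lemma carg_ge0 z : z != 0 -> 0 <= Im z -> 0 <= carg z <= pi.
Proof.
move=> z0 zi; rewrite /carg zi; have h := cos_arg_bound z0.
by rewrite acos_ge0 // acos_lepi.
Qed.

Lemma cexp_cln z : z != 0 -> cexp (cln z) = z.
Proof.
move=> z0; have z1 : 0 < cmod z by rewrite cmod_gt0.
have h := cos_arg_bound z0.
have co : cmod z * cos (carg z) = Re z.
  have : cos (acos (Re z / cmod z)) = Re z / cmod z by rewrite acosK // in_itv.
  by rewrite /carg; case: ifP => _; rewrite ?cosN => ->; field; rewrite gt_eqF.
have si : cmod z * sin (carg z) = Im z.
  have : cmod z * sin (acos (Re z / cmod z)) = `|Im z|.
    rewrite sin_acos // -{1}(ger0_norm (cmod_ge0 z)) -sqrtr_sqr -sqrtrM ?sqr_ge0 //.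
    rewrite -sqrtr_sqr; congr Num.sqrt; rewrite mulrBr mulr1 expr_div_n.
    by rewrite mulrCA divff ?mulr1 ?expf_neq0 ?gt_eqF // cmod_sqr addrAC subrr add0r.
  rewrite /carg; case: ifPn => [h0|]; first by rewrite ger0_norm.
  by rewrite -ltNge sinN mulrN => h0 ->; rewrite ltr0_norm ?opprK.
by apply: complex_eq; rewrite /= lnK ?posrE.
Qed.

Lemma carg_gt0 z : 0 < Im z -> 0 < carg z < pi.
Proof.
move=> zi; have z0 : z != 0 by apply: contraTneq zi => ->; rewrite ltxx.
have /andP[a0 ap] := carg_ge0 z0 (ltW zi).
have si : Im z = cmod z * sin (carg z) by rewrite -{1}(cexp_cln z0) /= lnK // posrE cmod_gt0.
have nz (u : R) : sin u = 0 -> carg z != u by move=> su; apply: contraTneq zi => h; rewrite si h su mulr0 ltxx.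
by rewrite !lt_def a0 ap nz ?sin0 // eq_sym nz ?sinpi.
Qed.

End ComplexExponential.

Section RealEstimates.
Variable R : realType.
Implicit Types (phi m : R).

Lemma MVT_from0 (f df : R -> R) (x : R) : 0 < x -> (forall t, is_derive t (1 : R) f (df t)) -> f 0 = 0 ->
  exists2 c, 0 < c < x & f x = df c * x.
Proof.
move=> x0 hf f0; have [|c] := @MVT R f df 0 x x0 (fun t _ => hf t).
  apply: derivable_within_continuous => t _; exact: (@ex_derive _ _ _ _ _ _ _ (hf t)).
by rewrite in_itv /= f0 !subr0 => hc E; exists c.
Qed.

Lemma cos_lt1_pi phi : 0 < phi <= pi -> cos phi < 1.
Proof.
move=> /andP[h1 h2]; rewrite -(@cos0 R) ltr_cos // in_itv /= ?lexx ?pi_ge0 //.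
by rewrite (ltW h1) h2.
Qed.

Lemma sin_lt_id phi : 0 < phi <= pi -> sin phi < phi.
Proof.
move=> /andP[h1 h2].
have D (t : R) : is_derive t (1 : R) (fun x => x - sin x) (1 - cos t) by apply: is_deriveB.
have [|c /andP[c0 cp] E] := MVT_from0 h1 D; first by rewrite sin0 subr0.
rewrite -subr_gt0 E mulr_gt0 // subr_gt0 cos_lt1_pi // c0 /=; exact: ltW (lt_le_trans cp h2).
Qed.

Lemma mul_cos_lt_sin phi : 0 < phi <= pi -> phi * cos phi < sin phi.
Proof.
move=> /andP[h1 h2].
have D (t : R) : is_derive t (1 : R) (fun x => sin x - x * cos x) (t * sin t).
  by apply: is_derive_eq; rewrite /GRing.scale /=; ring.
have [|c /andP[c0 cp] E] := MVT_from0 h1 D; first by rewrite sin0 mul0r subr0.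
rewrite -subr_gt0 E !mulr_gt0 // sin_gt0_pi // c0 /=; exact: lt_le_trans cp h2.
Qed.

Lemma ln_le_subr1 m : 0 < m -> ln m <= m - 1.
Proof.
move=> m0; have h := @le_ln1Dx R (m - 1); rewrite (_ : 1 + (m - 1) = m) in h; last by ring.
by apply: h; lra.
Qed.

Lemma ln_eq_subr1 m : 0 < m -> ln m = m - 1 -> m = 1.
Proof.
move=> m0 E; have [l0|ln0] := eqVneq (ln m) 0; first by lra.
by have := expR_gt1Dx ln0; rewrite lnK ?posrE // E; lra.
Qed.

(** For y = m e^(i (pi - phi)) the hypothesis m sin phi = phi says that the
    imaginary part of y + ln y is pi.  On this curve, which leaves -1 into the
    upper half-plane, y + ln y lies to the right of -1 + pi i, whereas on the
    upper edge of the cut it lies to the left. *)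
Lemma cut_tip_right m phi : 0 < m -> 0 < phi < pi -> m * sin phi = phi ->
  -1 < - (m * cos phi) + ln m.
Proof.
move=> m0 /andP[p0 pp] E; have hp : 0 < phi <= pi by rewrite p0 ltW.
have s0 : 0 < sin phi by rewrite sin_gt0_pi // p0.
have m1 : 1 < m by rewrite -(ltr_pM2r s0) mul1r E sin_lt_id.
have ln0 : 0 < ln m by rewrite ln_gt0.
have : m * cos phi < 1.
  by rewrite -(ltr_pM2r s0) mul1r mulrAC E mul_cos_lt_sin.
lra.
Qed.

End RealEstimates.

(** * Paths lifted along y + ln y *)

Section BranchPoints.
Local Open Scope complex_scope.
Variable R : realType.
Local Notation Re := complex.Re.
Local Notation Im := complex.Im.
Implicit Types (l : R[i]) (k : int) (e : R).

Lemma periodic_int (f : R -> R) k (u : R) : periodic f (pi *+ 2) ->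
  f (u + k%:~R * (pi *+ 2)) = f u.
Proof.
move=> pf; have pn n v : f (v + n%:R * (pi *+ 2)) = f v.
  elim: n => [|n IH]; first by rewrite mul0r addr0.
  by rewrite -natr1 mulrDl mul1r addrA pf.
case: k => n; first exact: pn.
by rewrite -(pn n.+1 (u + _)) NegzE mulrNz mulNr subrK.
Qed.

(** The critical values of y + ln y are these points for a an odd multiple of
    pi. *)
Definition branch_pt (a : R) : R[i] := -1 +i* a.

(** Here l is a logarithm of y = e^l.  The nearby critical value is the one whose
    imaginary part is the odd multiple a of pi closest to Im l. *)
Lemma near_branch_pt l e : cmod (1 + cexp l) <= e -> e <= 2^-1 ->
  exists k, let a := (k%:~R * 2 + 1) * pi in
    [/\ a - pi <= Im l < a + pi & cmod (cexp l + l - branch_pt a) <= 10 * e].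
Proof.
move=> ye e2; have p0 := pi_gt0 R.
pose k := Num.floor (Im l / (pi *+ 2)); exists k => a.
have p2 : 0 < pi *+ 2 :> R by rewrite mulrn_wgt0.
have la : a - pi <= Im l < a + pi.
  have f1 := ge_floor (Im l / (pi *+ 2)); have f2 := floorD1_gt (Im l / (pi *+ 2)).
  rewrite -/k in f1 f2; rewrite ler_pdivlMr // in f1; rewrite ltr_pdivrMr // intrD in f2.
  by rewrite /a; apply/andP; split; move: f1 f2; rewrite mulr2n; lra.
split=> //; pose phi := Im l - a; pose m := expR (Re l).
have m0 : 0 < m by exact: expR_gt0.
have lE : Im l = (phi + pi) + k%:~R * (pi *+ 2) by rewrite /phi /a mulr2n; ring.
have cE : Re (cexp l) = - (m * cos phi).
  by rewrite /= lE (periodic_int _ _ (@cosD2pi R)) cosDpi mulrN.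
have sE : Im (cexp l) = - (m * sin phi).
  by rewrite /= lE (periodic_int _ _ (@sinD2pi R)) sinDpi mulrN.
have := Re_le_cmod (1 + cexp l); have := Im_le_cmod (1 + cexp l).
rewrite cReD cImD cE sE /= add0r normrN => him hre.
have {}him := le_trans him ye; have {}hre := le_trans hre ye.
have mE : cmod (cexp l) = m by rewrite cmod_cexp.
have m1 : m <= 1 + e.
  have := ler_cmod_dist (cexp l) (- 1); rewrite opprK cmodN cmod1 mE addrC [cexp l + 1]addrC.
  by move: ye; lra.
have m2 : 1 - e <= m.
  have := ler_cmod_dist 1 (- cexp l); rewrite opprK cmodN cmod1 mE.
  by move: ye; lra.
have e0 : 0 <= e by apply: le_trans ye; exact: cmod_ge0.
have mh : 2^-1 <= m by lra.
have lnm : ln m = Re l by rewrite expRK.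
have ln1 : ln m <= e by apply: le_trans (ln_le_subr1 m0) _; lra.
have ln2 : - (2 * e) <= ln m.
  have := ln_le_subr1 (_ : 0 < m^-1); rewrite invr_gt0 lnV ?posrE // => /(_ m0).
  have : m^-1 <= 1 + 2 * e.
    rewrite -[m^-1]mul1r ler_pdivrMr //; apply: le_trans (_ : (1 + 2 * e) * (1 - e) <= _); nra.
  by lra.
have cphi : 3^-1 <= cos phi.
  move: hre; rewrite ler_norml => /andP[_ h].
  rewrite -(ler_pM2l m0); nra.
have sphi : `|sin phi| <= 2 * e.
  rewrite -(ler_pM2l m0) -{1}(gtr0_norm m0) -normrM; apply: le_trans him _; nra.
have hphi : `|phi| <= 6 * e.
  have key q : 0 < q <= pi -> cos q = cos phi -> `|sin q| = `|sin phi| -> q <= 6 * e.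
    move=> hq cq sq; have h := mul_cos_lt_sin hq; have /andP[q0 _] := hq.
    have h2 := ler_norm (sin q); rewrite sq in h2; rewrite cq in h; nra.
  have [q0|q0|q0] := ltrgt0P phi; last by rewrite mulr_ge0.
    by apply: key => //; rewrite q0 /=; move: la; rewrite /phi; lra.
  apply: key; rewrite ?cosN ?sinN ?normrN // oppr_gt0 q0 /=; move: la; rewrite /phi; lra.
(* 10 = 1 + 2 + 1 + 6, the four terms being bounded by hre, t3, him and hphi *)
apply: le_trans (cmod_le_ReIm _) _.
rewrite !cReD !cImD cReN cImN cE sE -lnm /=.
have -> : - (m * cos phi) + ln m - -1 = (1 - m * cos phi) + ln m by ring.
have -> : - (m * sin phi) + Im l - a = - (m * sin phi) + phi by rewrite /phi; ring.
have t1 := ler_normD (1 - m * cos phi) (ln m).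
have t2 := ler_normD (- (m * sin phi)) phi; rewrite normrN in t2.
have t3 : `|ln m| <= 2 * e by rewrite ler_norml ln2 /=; lra.
by move: hre him => /=; lra.
Qed.

End BranchPoints.

Section Sinc.
Variable R : realType.
Implicit Types (q : R).

Definition sinc q : R := if q == 0 then 1 else sin q / q.

Lemma sincN q : sinc (- q) = sinc q.
Proof. by rewrite /sinc oppr_eq0 sinN; case: eqP => // /eqP q0; field. Qed.

Lemma sinc_bounds q : `|q| <= pi -> cos q <= sinc q <= 1.
Proof.
wlog q0 : q / 0 <= q => [h|].
  have [/h//|/ltW q0] := leP 0 q; rewrite -sincN -cosN -normrN; apply: h; by rewrite oppr_ge0.
move: q0; rewrite le_eqVlt => /orP[/eqP <- _|q0]; first by rewrite /sinc eqxx cos0 lexx.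
rewrite gtr0_norm // => qp; have h : 0 < q <= pi by rewrite q0.
rewrite /sinc gt_eqF // ler_pdivlMr // ler_pdivrMr // mul1r mulrC.
by rewrite !ltW ?mul_cos_lt_sin ?sin_lt_id.
Qed.

Lemma continuous_sinc : continuous sinc.
Proof.
move=> q; have [->|q0] := eqVneq q 0.
  have s0 : sinc 0 = 1 by rewrite /sinc eqxx.
  rewrite /continuous_at s0.
  have c1 : cos x @[x --> (0 : R)] --> (1 : R).
    by rewrite -(@cos0 R); exact: continuous_cos.
  have c2 : (fun _ : R => 1 : R) x @[x --> (0 : R)] --> (1 : R) by exact: cvg_cst.
  apply: (squeeze_cvgr _ c1 c2); near=> x; apply: sinc_bounds.
  rewrite ltW //; near: x; apply: near_norm_lt; rewrite normr0; exact: pi_gt0.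
have E : \forall x \near q, sin x / x = sinc x.
  suff h : \forall x \near q, x != 0 by apply: filterS h => x x0; rewrite /sinc (negbTE x0).
  have q1 : 0 < `|q| by rewrite normr_gt0.
  by apply: filterS (near_dist_lt q q1) => x; apply: contraTneq => ->; rewrite subr0 ltxx.
rewrite /continuous_at -(nbhs_singleton E); apply: cvg_trans; first by apply: near_eq_cvg E.
by apply: cvgM; [exact: continuous_sin | apply: cvgV].
Unshelve. all: end_near. Qed.

End Sinc.

Lemma le_sqr_norm (R : realDomainType) (a b : R) : `|a| <= `|b| -> a ^+ 2 <= b ^+ 2.
Proof.
move=> ab; rewrite -(real_normK (num_real a)) -(real_normK (num_real b)).
by apply: lerXn2r; rewrite ?nnegrE.
Qed.

Lemma int_cases (k : int) : [\/ k = 0, k = -1, 1 <= k | k <= -2].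
Proof.
have : (k == 0) || (k == -1) || (1 <= k) || (k <= -2) by lia.
by case/orP => [/orP[/orP[]|]|] => [/eqP->|/eqP->|h|h]; [apply: Or41 | apply: Or42 | apply: Or43 | apply: Or44].
Qed.

Section LogarithmicPath.
Local Open Scope complex_scope.
Variable R : realType.
Local Notation Re := complex.Re.
Local Notation Im := complex.Im.
Variables (y0 x1 : R[i]) (y : R -> R[i]).
Hypothesis y0n : y0 != 0.
Hypothesis y0i : 0 <= Im y0.
Let x0 := y0 + cln y0.
Let x (t : R) := x0 + t%:C * (x1 - x0).
Hypothesis yc : forall t, 0 <= t <= 1 ->
  {for t, continuous (fun u => Re (y u))} /\ {for t, continuous (fun u => Im (y u))}.
Hypothesis yE : forall t, 0 <= t <= 1 -> y t = cexp (x t - y t).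
Hypothesis yz : y 0 = y0.
Implicit Types (t e : R).

(* Polar coordinates of y along the path: ln y = x - y = lm + i th, with the
   branch of the logarithm carried along by continuity. *)
Let th t := Im x0 + t * (Im x1 - Im x0) - Im (y t).
Let lm t := Re x0 + t * (Re x1 - Re x0) - Re (y t).

Let x_0 : x 0 = x0. Proof. by rewrite /x rmorph0 mul0r addr0. Qed.
Let x_1 : x 1 = x1. Proof. by rewrite /x rmorph1 mul1r addrC subrK. Qed.

Let Rx t : Re (x t) = Re x0 + t * (Re x1 - Re x0).
Proof. by rewrite /x !cReImE /=; ring. Qed.

Let Ix t : Im (x t) = Im x0 + t * (Im x1 - Im x0).
Proof. by rewrite /x !cReImE /=; ring. Qed.

Let th0 : th 0 = carg y0.
Proof. by rewrite /th yz mul0r addr0 /x0 cImD addrC addKr. Qed.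

Let x0_dist t : 0 <= t <= 1 -> cmod (x t - x0) <= cmod (x1 - x0).
Proof.
move=> /andP[t0 t1]; rewrite /x addrC addKr cmodM cmod_real ger0_norm //.
by rewrite -[leRHS]mul1r ler_wpM2r ?cmod_ge0.
Qed.

Let lE t : x t - y t = lm t +i* th t.
Proof. by apply: complex_eq; [rewrite cReD cReN Rx | rewrite cImD cImN Ix]. Qed.

Let ReyE t : 0 <= t <= 1 -> Re (y t) = expR (lm t) * cos (th t).
Proof. by move=> /yE {1}->; rewrite lE. Qed.

Let ImyE t : 0 <= t <= 1 -> Im (y t) = expR (lm t) * sin (th t).
Proof. by move=> /yE {1}->; rewrite lE. Qed.

Let RexE t : 0 <= t <= 1 -> Re (x t) = expR (lm t) * cos (th t) + lm t.
Proof. by move=> /ReyE <-; rewrite /lm -Rx addrC subrK. Qed.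

Let ImxE t : 0 <= t <= 1 -> Im (x t) = expR (lm t) * sin (th t) + th t.
Proof. by move=> /ImyE <-; rewrite /th -Ix addrC subrK. Qed.

Let cont_affine (a b : R) t : {for t, continuous (fun u : R => a + u * b)}.
Proof. by apply: cvgD; [exact: cvg_cst | apply: cvgM; [exact: cvg_id | exact: cvg_cst]]. Qed.

Let th_cont t : 0 <= t <= 1 -> {for t, continuous th}.
Proof.
by move=> /yc[_ c]; apply: cvgB => //; exact: cont_affine.
Qed.

Let lm_cont t : 0 <= t <= 1 -> {for t, continuous lm}.
Proof.
by move=> /yc[c _]; apply: cvgB => //; exact: cont_affine.
Qed.

Let IVT01 (g : R -> R) v : (forall t, 0 <= t <= 1 -> {for t, continuous g}) ->
  Num.min (g 0) (g 1) <= v <= Num.max (g 0) (g 1) -> exists2 t, 0 <= t <= 1 & g t = v.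
Proof.
move=> gc gv; have [|c] := @IVT R g 0 1 v ler01 _ gv; last first.
- by rewrite in_itv /= => hc E; exists c.
- by apply: continuous_in_subspaceT => t; rewrite inE /= in_itv /= => /gc.
Qed.

(* Where y is a negative number, Re x = - |y| + ln |y| <= -1. *)
Let on_cut t (b : R) : 0 <= t <= 1 -> th t = b -> cos b = -1 -> sin b = 0 ->
  Re (x t) <= -1 /\ Im (x t) = b.
Proof.
move=> ht tb cb sb; rewrite RexE // ImxE // tb cb sb mulr0 add0r; split=> //.
have := ln_le_subr1 (expR_gt0 (lm t)); rewrite expRK; lra.
Qed.

Let cos_Npi : cos (- pi) = -1 :> R. Proof. by rewrite cosN cospi. Qed.
Let sin_Npi : sin (- pi) = 0 :> R. Proof. by rewrite sinN sinpi oppr0. Qed.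

(* The path stays strictly inside the circle about x0 through branch_pt pi. *)
Let far t : 0 <= t <= 1 -> cmod (x1 - x0) < cmod (x0 - branch_pt pi) ->
  `|Re x0 + 1| <= `|Re (x t) - Re x0| -> `|Im x0 - pi| <= `|Im (x t) - Im x0| -> False.
Proof.
move=> ht D h1 h2; have := x0_dist ht; apply/negP; rewrite -ltNge; apply: (lt_le_trans D).
rewrite !cmodE; apply: ler_wsqrtr.
rewrite [Re (_ - x0)]cReD [Im (_ - x0)]cImD; apply: lerD; apply: le_sqr_norm.
  by rewrite cReN [Re (x0 - _)]cReD cReN opprK.
by rewrite cImN [Im (x0 - _)]cImD cImN.
Qed.

(** When x0 lies to the right of -1, the argument of y cannot leave ]-pi, pi[:
    on crossing the cut, x would be on one of the half-lines Im x = pi,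
    Re x <= -1 and Im x = - pi, Re x <= -1, which are out of reach. *)
Let th_right : 2 * pi < Im x0 -> -1 <= Re x0 -> cmod (x1 - x0) < cmod (x0 - branch_pt pi) ->
  - pi < th 1 < pi.
Proof.
move=> ix rx D; have p0 := pi_gt0 R.
have := carg_ge0 y0n y0i; rewrite -th0 => /andP[t0 t0p].
have nopi (b : R) : (b = pi \/ b = - pi) -> forall t, 0 <= t <= 1 -> th t <> b.
  move=> hb t ht E; have [h1 h2] : Re (x t) <= -1 /\ Im (x t) = b.
    by apply: on_cut => //; case: hb => ->; rewrite ?cospi ?sinpi ?cos_Npi ?sin_Npi.
  have hb' : b <= pi by case: hb => ->; lra.
  apply: (far ht D); first by (rewrite ger0_norm; last lra); rewrite ler0_norm; lra.
  by rewrite h2; (rewrite ger0_norm; last lra); rewrite ler0_norm; case: hb => ->; lra.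
rewrite !ltNge; apply/andP; split; apply/negP => h.
  have [|t ht /(nopi (- pi))] := IVT01 th_cont (v := - pi); last by apply=> //; right.
  by rewrite ge_min le_max h orbT /=; apply/orP; left; lra.
have [|t ht /(nopi pi)] := IVT01 th_cont (v := pi); last by apply=> //; left.
by rewrite ge_min le_max h orbT t0p.
Qed.

(* The clamp to [-pi, pi]; it makes the barrier H continuous in all angles. *)
Let cl (q : R) := (`|q + pi| - `|q - pi|) / 2.

Let cl_in (q : R) : `|q| <= pi -> cl q = q.
Proof.
rewrite ler_norml => /andP[a b]; rewrite /cl ger0_norm; last by lra.
by rewrite ler0_norm; [field | lra].
Qed.

Let cl_out (q : R) : pi <= `|q| -> `|cl q| = pi.
Proof.
have p0 := pi_gt0 R; have [q0|q0] := ltP q 0.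
  rewrite (ltr0_norm q0) => h; have -> : cl q = - pi.
    by rewrite /cl !ler0_norm; [field | lra | lra].
  by rewrite normrN gtr0_norm.
rewrite (ger0_norm q0) => h; have -> : cl q = pi by rewrite /cl !ger0_norm; [field | lra | lra].
by rewrite gtr0_norm.
Qed.

(* For |pi - th| < pi, H = 1 is the equation of the curve of the points y such
   that x is on the half-line Im x = pi, Re x >= -1, while H = 0 for the other
   angles. *)
Let H t := expR (lm t) * sinc (cl (pi - th t)).

Let H_cont t : 0 <= t <= 1 -> {for t, continuous H}.
Proof.
move=> ht; apply: cvgM.
  by apply: continuous_comp; [exact: lm_cont | exact: continuous_expR].
apply: (continuous_comp (f := fun u => cl (pi - th u))); last exact: continuous_sinc.
have c : {for t, continuous (fun u => pi - th u)} by apply: cvgB; [exact: cvg_cst | exact: th_cont].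
apply: cvgM; last exact: cvg_cst.
apply: cvgB.
  by apply: cvg_norm; apply: cvgD => //; exact: cvg_cst.
by apply: cvg_norm; apply: cvgB => //; exact: cvg_cst.
Qed.

(** When x0 lies to the left of -1, the barrier is the preimage of the half-line
    Im x = pi, Re x >= -1, which is out of reach.  The path starts where H > 1
    and so stays there, with an argument strictly between 0 and 2 pi. *)
Let th_left : 2 * pi < Im x0 -> Re x0 < -1 -> cmod (x1 - x0) < cmod (x0 - branch_pt pi) ->
  0 < th 1 < 2 * pi.
Proof.
move=> ix rx D; have p0 := pi_gt0 R.
have := carg_ge0 y0n y0i; rewrite -th0 => /andP[t0 t0p].
have I0 : 0 <= (0 : R) <= 1 by apply/andP; split; lra.
have I1 : 0 <= (1 : R) <= 1 by apply/andP; split; lra.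
have i0 := ImxE I0; rewrite x_0 in i0.
have [sp thp] : pi < expR (lm 0) * sin (th 0) /\ th 0 < pi.
  have h : pi < expR (lm 0) * sin (th 0) by move: i0; lra.
  split=> //; rewrite lt_neqAle t0p andbT; apply/eqP => E; move: h; rewrite E sinpi mulr0; lra.
have H0 : 1 < H 0.
  rewrite /H cl_in; last by rewrite ger0_norm; lra.
  have q0 : 0 < pi - th 0 by lra.
  rewrite /sinc gt_eqF // mulrA ltr_pdivlMr // mul1r.
  have -> : sin (pi - th 0) = sin (th 0).
    by rewrite addrC sinDpi sinN opprK.
  lra.
have noH t : 0 <= t <= 1 -> H t <> 1.
  move=> ht E; set q := pi - th t in E; have thE : th t = pi - q by rewrite /q; ring.
  have sthE : sin (th t) = sin q by rewrite thE addrC sinDpi sinN opprK.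
  have cthE : cos (th t) = - cos q by rewrite thE addrC cosDpi cosN.
  have qpi : `|q| < pi.
    rewrite ltNge; apply/negP => /cl_out; move: E; rewrite /H -/q => E hc.
    have : sinc (cl q) = 0.
      case: (ger0P (cl q)) hc => _ hc; first by rewrite hc /sinc gt_eqF // sinpi mul0r.
      by rewrite -sincN hc /sinc gt_eqF // sinpi mul0r.
    by move=> z; move: E; rewrite z mulr0 => /eqP; rewrite eq_sym oner_eq0.
  rewrite /H -/q (cl_in (ltW qpi)) in E.
  have [rge ieq] : -1 <= Re (x t) /\ Im (x t) = pi.
    rewrite RexE // ImxE // sthE cthE thE.
    have [q0|q0] := eqVneq q 0.
      move: E; rewrite q0 /sinc eqxx mulr1 cos0 sin0 => E.
      by rewrite -[X in _ + X]expRK E ln1; split; lra.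
    move: E; rewrite /sinc (negbTE q0) mulrA => /(congr1 (fun u => u * q)).
    rewrite mul1r divfK // => E; split; last by rewrite E; lra.
    rewrite mulrN -[X in _ + X]expRK ltW //.
    move: qpi; have [qg|ql|q00] := ltrgt0P q => qpi.
    - by apply: cut_tip_right; rewrite ?expR_gt0 // qg.
    - by rewrite -(cosN q); apply: cut_tip_right; rewrite ?expR_gt0 ?sinN ?mulrN ?E // oppr_gt0 ql.
    - by rewrite q00 eqxx in q0.
  apply: (far ht D); first by (rewrite ler0_norm; last lra); rewrite ger0_norm; lra.
  by rewrite ieq distrC.
have H1 : 1 < H 1.
  rewrite ltNge; apply/negP => h; have [|t ht /noH] := IVT01 H_cont (v := 1); last by apply.
  by rewrite ge_min le_max h orbT ltW.
have : `|pi - th 1| < pi; last by rewrite ltr_norml; lra.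
rewrite ltNge; apply/negP => /cl_out hc; move: H1; rewrite /H.
have -> : sinc (cl (pi - th 1)) = 0.
  case: (ger0P (cl (pi - th 1))) hc => _ hc; first by rewrite hc /sinc gt_eqF // sinpi mul0r.
  by rewrite -sincN hc /sinc gt_eqF // sinpi mul0r.
by rewrite mulr0 ltr10.
Qed.

(** If 1 + y is small at the end of the path, then its end x1 is near a critical
    value branch_pt a, and it suffices that branch_pt a is at least as far from
    x0 as branch_pt pi.  This holds for all a if 0 <= Im x0 <= 2 pi.  If
    Im x0 > 2 pi, then critical values with a > pi may be nearer; the bounds
    on the argument of y exclude them, because a is the odd multiple of pi
    closest to this argument. *)
Lemma path_avoids_critical e : e <= 2^-1 -> cmod (1 + y 1) <= e ->
  cmod (x0 - branch_pt pi) <= cmod (x1 - x0) + 10 * e.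
Proof.
move=> e2 ye; have p0 := pi_gt0 R.
have I1 : 0 <= (1 : R) <= 1 by apply/andP; split; lra.
have e0 : 0 <= e by apply: le_trans ye; exact: cmod_ge0.
rewrite leNgt; apply/negP => D10; have D : cmod (x1 - x0) < cmod (x0 - branch_pt pi) by lra.
have yl := yE I1; rewrite x_1 in yl; rewrite yl in ye.
have [k] := near_branch_pt ye e2; set a := (_ * pi).
rewrite -{1}yl [y 1 + _]addrC subrK => -[la da].
have {}la : a - pi <= th 1 < a + pi by move: la; rewrite cImD cImN /th -Ix x_1.
have y0arg := carg_ge0 y0n y0i.
have ix0 : 0 <= Im x0 by rewrite /x0 cImD addr_ge0 //; case/andP: y0arg.
suff ha : `|Im x0 - pi| <= `|Im x0 - a|.
  have h : cmod (x0 - branch_pt pi) <= cmod (x0 - branch_pt a).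
    rewrite !cmodE; apply: ler_wsqrtr.
    rewrite ![Re (x0 - _)]cReD ![Im (x0 - _)]cImD !cReN !cImN /= lerD2l.
    exact: le_sqr_norm.
  have := ler_cmodD (x0 - x1) (x1 - branch_pt a).
  rewrite addrA subrK cmodB => h2; move: da h h2 D10; lra.
have aE : a = pi \/ a = - pi \/ 3 * pi <= a \/ a <= - (3 * pi).
  have [k1|k1|k1|k1] := int_cases k.
  - by left; rewrite /a k1 mul0r add0r mul1r.
  - by right; left; rewrite /a k1; ring.
  - right; right; left; rewrite /a ler_wpM2r ?(ltW p0) //.
    have : (1%:~R : R) <= k%:~R by rewrite ler_int.
    lra.
  - right; right; right; rewrite /a -mulNr ler_wpM2r ?(ltW p0) //.
    have : (k%:~R : R) <= (-2)%:~R by rewrite ler_int.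
    have -> : (-2)%:~R = -2 :> R by [].
    lra.
have [i2|i2] := leP (Im x0) (2 * pi).
  have : `|Im x0 - pi| <= pi by rewrite ler_norml; lra.
  case: aE => [->//|[->|[h|h]]] hp.
  - by rewrite opprK (ger0_norm (_ : 0 <= Im x0 + pi)); [case: (lerP 0 (Im x0 - pi)); lra | lra].
  - by apply: le_trans hp _; rewrite ler0_norm; lra.
  - by apply: le_trans hp _; rewrite ger0_norm; lra.
have th1 : - pi < th 1 < 2 * pi.
  have [rx|rx] := leP (-1) (Re x0).
    by have := th_right i2 rx D; lra.
  by have := th_left i2 rx D; lra.
case: aE => [->//|[->|[h|h]]].
- by rewrite !ger0_norm; lra.
- by exfalso; lra.
- by exfalso; lra.
Qed.

(** The argument of y stays positive since Im x does, and cannot exceed pi before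
    the end: on the cut Re x <= -1 and Im x = pi, so that the whole
    path would be on the line Im x = pi and start to the left of the tip,
    against [cut_tip_right].  At the end Im x = pi, and
    [cut_tip_right] leaves only y = -1. *)
Lemma path_to_critical : 0 < Im y0 -> x1 = branch_pt pi -> y 1 = -1.
Proof.
move=> yi xE; have p0 := pi_gt0 R.
have := carg_gt0 yi; rewrite -th0 => /andP[t0 t0p].
have I0 : 0 <= (0 : R) <= 1 by apply/andP; split; lra.
have I1 : 0 <= (1 : R) <= 1 by apply/andP; split; lra.
have ix0 : 0 < Im x0 by rewrite /x0 cImD addr_gt0 //; case/andP: (carg_gt0 yi).
have ix t : 0 <= t <= 1 -> 0 < Im (x t).
  by move=> /andP[h0 h1]; rewrite Ix xE /=; nra.
have th1 : 0 < th 1.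
  rewrite ltNge; apply/negP => h.
  have [|t ht E] := IVT01 th_cont (v := 0); first by rewrite ge_min le_max h orbT ltW.
  have := ix t ht; rewrite ImxE // E sin0 mulr0 addr0; lra.
have x1r : Re (x 1) = -1 by rewrite x_1 xE.
have x1i : Im (x 1) = pi by rewrite x_1 xE.
have th1p : th 1 <= pi.
  rewrite leNgt; apply/negP => h.
  have [|t ht E] := IVT01 th_cont (v := pi); first by rewrite ge_min le_max !(ltW h) (ltW t0p) orbT.
  have [h1 h2] := on_cut ht E (@cospi R) (@sinpi R).
  have t1 : t != 1 by apply: contraTneq h => h'; rewrite -E h' ltxx.
  have t1' : t < 1 by rewrite lt_neqAle t1; case/andP: ht.
  have tp : 0 <= t by case/andP: ht.
  have ipi : Im x0 = pi by move: h2; rewrite Ix xE /=; nra.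
  have rx0 : Re x0 <= -1 by move: h1; rewrite Rx xE /=; nra.
  have e1 := RexE I0; have e2 := ImxE I0; rewrite x_0 ipi in e2; rewrite x_0 in e1.
  have hq : 0 < pi - th 0 < pi by lra.
  have := cut_tip_right (expR_gt0 (lm 0)) hq.
  rewrite [pi - _]addrC sinDpi cosDpi sinN cosN opprK expRK mulrN opprK => H1.
  by have := H1; rewrite -e1; move: e2; lra.
have e1 := RexE I1; have e2 := ImxE I1; rewrite x1r in e1; rewrite x1i in e2.
have thpi : th 1 = pi.
  apply/eqP; rewrite eq_le th1p leNgt; apply/negP => h.
  have hq : 0 < pi - th 1 < pi by lra.
  have := cut_tip_right (expR_gt0 (lm 1)) hq.
  rewrite [pi - _]addrC sinDpi cosDpi sinN cosN opprK expRK mulrN opprK -e1 => H1.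
  have : - (1 : R) < -1 by apply: H1; move: e2; lra.
  by rewrite ltxx.
have lm1 : lm 1 = 0.
  rewrite thpi cospi in e1.
  have : expR (lm 1) = 1 by apply: ln_eq_subr1; rewrite ?expR_gt0 // expRK; lra.
  by move=> h; rewrite -[lm 1]expRK h ln1.
by apply: complex_eq; rewrite ?ReyE ?ImyE // lm1 thpi expR0 mul1r ?cospi ?sinpi /= ?oppr0.
Qed.

End LogarithmicPath.

(** * The radius of convergence *)

Section RadiusOfConvergence.
Local Open Scope complex_scope.
Variable R : realType.
Local Notation Re := complex.Re.
Local Notation Im := complex.Im.
Implicit Types (a : nat -> R[i]) (z : R[i]) (r : R).

Lemma coef_bounded_cvg a r z : coef_bounded a r -> cmod z < r -> cvgn (cpseries a z).
Proof.
move=> ga zr; have h := csummable_cvg (coef_bounded_csummable ga zr).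
by apply/cvg_ex; eexists; exact: h.
Qed.

Lemma cvg_coef_bounded a z : cvgn (cpseries a z) -> coef_bounded a (cmod z).
Proof.
move=> /cvg_ex[l /cvg_complexP[hr hi]].
have cr : cvgn (series (fun k => Re (a k * z ^+ k))).
  by apply/cvg_ex; exists (Re l); under eq_cvg do rewrite -seriesRe.
have ci : cvgn (series (fun k => Im (a k * z ^+ k))).
  by apply/cvg_ex; exists (Im l); under eq_cvg do rewrite -seriesIm.
have [Kr [_ Hr]] := cvg_series_bounded cr; have [Ki [_ Hi]] := cvg_series_bounded ci.
exists ((Kr + 1) + (Ki + 1)) => m; rewrite -cmodX -cmodM; apply: le_trans (cmod_le_ReIm _) _.
by apply: lerD; [apply: Hr | apply: Hi]; rewrite ?ltrDl.
Qed.

(** Convergence at z bounds the terms at z, and bounded terms at r give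
    convergence inside the circle of radius r. *)
Lemma convergence_radiusE a (rho : R) : 0 <= rho ->
  (forall r, 0 <= r < rho -> coef_bounded a r) -> (forall r, 0 <= r -> coef_bounded a r -> r <= rho) ->
  convergence_radius a = rho%:E.
Proof.
move=> rho0 lo up; rewrite /convergence_radius; apply/eqP; rewrite eq_le; apply/andP; split.
  apply: ge_ereal_sup => _ [x /= cx <-]; rewrite lee_fin; apply: up; first exact: cmod_ge0.
  exact: cvg_coef_bounded.
have in_set r : 0 <= r < rho ->
    (r%:E <= ereal_sup [set (cmod x)%:E | x in [set x : R[i] | cvgn (cpseries a x)]])%E.
  move=> /andP[r0 rr]; apply: ereal_sup_ubound; exists (r%:C); last by rewrite cmod_real ger0_norm.
  apply: (@coef_bounded_cvg _ ((r + rho) / 2)); first by apply: lo; lra.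
  by rewrite cmod_real ger0_norm //; lra.
apply/lee_addgt0Pr => e e0; rewrite -leeBlDr //.
have [re|re] := leP 0 (rho - e).
  by rewrite -EFinB; apply: in_set; rewrite re /=; lra.
have [->|rn0] := eqVneq rho 0; last first.
  apply: le_trans (in_set 0 _); first by rewrite -EFinB lee_fin ltW.
  by rewrite lexx lt_def rn0.
apply: (@le_trans _ _ 0%:E); first by rewrite -EFinB lee_fin; lra.
apply: ereal_sup_ubound; exists 0; last by rewrite cmod0.
have h : forall n, (1 <= n)%N -> a n * 0 ^+ n = 0 by case=> // n _; rewrite expr0n mulr0.
have [cs _] := csum_finite h.
by have := csummable_cvg cs => h2; apply/cvg_ex; eexists; exact: h2.
Qed.

End RadiusOfConvergence.

Section LambertRadius.
Local Open Scope complex_scope.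
Variable R : realType.
Local Notation Re := complex.Re.
Local Notation Im := complex.Im.
Implicit Types (z : R[i]) (r : R).

(** The inverse of 1 + s is 0 for s = -1, which is the case z = 1/e. *)
Lemma lambert_coefN1 m : lambert_coef (-1 : R[i]) m = 0.
Proof.
rewrite /lambert_coef subrr invr0 big1 // => p _.
have m0 : (0 < m)%N by apply: leq_ltn_trans (ltn_ord p).
by rewrite expr0n addn_eq0 (gtn_eqF m0) andbF mulr0 mul0r.
Qed.

Variable y0 : R[i].
Hypothesis y0n : y0 != 0.
Hypothesis y01 : y0 != -1.
Let s := y0^-1.
Let x0 := y0 + cln y0.
Let c := lambert_coef s.

Let s1 : 1 + s != 0.
Proof.
apply: contra_neq y01 => h; have : y0 * (1 + s) = 0 by rewrite h mulr0.
by rewrite mulrDr mulr1 mulfV // => /eqP; rewrite addr_eq0 => /eqP.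
Qed.

(* That is y = u + y0 (1 - z), whence lambert_den = s (1 + y). *)
Let y z := y0 * lambert_den s z - 1.

Let y_0 : y 0 = y0.
Proof. by rewrite /y /lambert_den lambert_sum0 mulr0 addr0 subr0 mulrDr mulr1 mulfV // addrK. Qed.

Let y_deriv r z (t : R) : coef_bounded c r -> `|t| * cmod z < r ->
  is_cderive t (fun u => y (u%:C * z)) (z * lambert_sum_deriv s (t%:C * z) - z * y0).
Proof.
move=> gc tz; have h := is_cderiveD (is_cderiveM (is_cderive_cst t y0)
  (is_cderive_lambert_den gc tz)) (is_cderive_cst t (-1)).
apply: is_cderive_eq h _; set F := lambert_sum_deriv _ _.
have ys : y0 * s = 1 by rewrite mulfV.
have -> : z * F - z * y0 = (y0 * s) * z * F - z * y0 by rewrite ys mul1r.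
ring.
Qed.

(** The ODE says that y e^(y - x) is constant along the ray through z; this
    avoids choosing a branch of ln y. *)
Let y_log r z : coef_bounded c r -> cmod z < r ->
  y z = cexp (x0 - z * y0 - y z).
Proof.
move=> gc zr.
have tz (t : R) : 0 <= t <= 1 -> `|t| * cmod z < r.
  move=> /andP[t0 t1]; rewrite ger0_norm //; apply: le_lt_trans zr.
  by rewrite -[leRHS]mul1r ler_wpM2r ?cmod_ge0.
pose w (t : R) := y (t%:C * z) - x0 + t%:C * (z * y0).
have wd (t : R) : 0 <= t <= 1 -> is_cderive t w (z * lambert_sum_deriv s (t%:C * z)).
  move=> ht; have h := is_cderiveD (is_cderiveD (y_deriv gc (tz t ht)) (is_cderive_cst t (- x0)))
    (is_cderive_real t (z * y0)).
  by apply: is_cderive_eq h _; ring.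
pose E (t : R) := y (t%:C * z) * cexp (w t).
have Ed (t : R) : 0 <= t <= 1 -> is_cderive t E 0.
  move=> ht; have h := is_cderiveM (y_deriv gc (tz t ht)) (is_cderive_cexp (wd t ht)).
  apply: is_cderive_eq h _; rewrite /y.
  have FV : lambert_sum_deriv s (t%:C * z) * lambert_den s (t%:C * z) = 1.
    by apply: (lambert_ode s1 gc); rewrite cmodM cmod_real tz.
  move: FV; set F := lambert_sum_deriv _ _; set V := lambert_den _ _ => FV.
  have -> : (z * F - z * y0) * cexp (w t) + (y0 * V - 1) * (z * F * cexp (w t)) =
    z * y0 * (F * V - 1) * cexp (w t) by ring.
  by rewrite FV subrr mulr0 mul0r.
have := is_cderive0_cst ler01 Ed; rewrite /E /w !rmorph1 !rmorph0 !mul1r !mul0r addr0 y_0.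
have -> : y0 - x0 = - cln y0 by rewrite /x0; ring.
have -> : y0 * cexp (- cln y0) = 1 by rewrite -{1}(cexp_cln y0n) -cexpD subrr cexp0.
have -> : x0 - z * y0 - y z = - (y z - x0 + z * y0) by ring.
move=> E1; set l := y z - x0 + z * y0 in E1 *.
have : y z * cexp l * cexp (- l) = cexp (- l) by rewrite E1 mul1r.
by rewrite -mulrA -cexpD subrr cexp0 mulr1.
Qed.

Let path_hyps r z : coef_bounded c r -> cmod z < r ->
  let x1 := x0 - z * y0 in
  [/\ forall t : R, 0 <= t <= 1 ->
      {for t, continuous (fun u : R => Re (y (u%:C * z)))} /\
      {for t, continuous (fun u : R => Im (y (u%:C * z)))},
    forall t : R, 0 <= t <= 1 -> y (t%:C * z) =
      cexp (x0 + t%:C * (x1 - x0) - y (t%:C * z))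
    & y (0%:C * z) = y0].
Proof.
move=> gc zr x1.
have tz (t : R) : 0 <= t <= 1 -> `|t| * cmod z < r.
  move=> /andP[t0 t1]; rewrite ger0_norm //; apply: le_lt_trans zr.
  by rewrite -[leRHS]mul1r ler_wpM2r ?cmod_ge0.
split=> [t ht|t ht|]; last by rewrite rmorph0 mul0r y_0.
  exact: (is_cderive_continuous (y_deriv gc (tz t ht))).
rewrite {1}(y_log gc (_ : cmod (t%:C * z) < r)); last by rewrite cmodM cmod_real tz.
by have -> : x0 - t%:C * z * y0 = x0 + t%:C * (x1 - x0) by rewrite /x1; ring.
Qed.

(** As |f| |1 + y| = |y0|, it suffices that |1 + y| >= e on the disc; the path
    leading to a point where this fails would be too short. *)
Lemma lambert_radius_ge r : 0 <= Im y0 -> 0 <= r ->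
  r * cmod y0 < cmod (x0 - branch_pt pi) -> coef_bounded c r.
Proof.
move=> yi r0 rrho; have ym : 0 < cmod y0 by rewrite cmod_gt0.
set rho := cmod (x0 - _) in rrho.
pose r1 := (r + rho / cmod y0) / 2.
have rq : r < rho / cmod y0 by rewrite ltr_pdivlMr.
have [r1r r1h] : r < r1 /\ r1 < rho / cmod y0 by have [] := midf_lt rq.
have r1rho : r1 * cmod y0 < rho by rewrite -ltr_pdivlMr.
(* the error 10 e of path_avoids_critical is at most half the length available *)
pose e := Num.min 2^-1 ((rho - r1 * cmod y0) / 20).
have e0 : 0 < e by rewrite /e lt_min; apply/andP; split; lra.
have e2 : e <= 2^-1 by rewrite /e ge_min lexx.
have e3 : e <= (rho - r1 * cmod y0) / 20 by rewrite /e ge_min lexx orbT.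
pose W := Num.max 1 (cmod y0 / e).
suff h : converges_below s r1 by apply: h; rewrite r0.
apply: (@radius_ge _ _ s1 r1 W); first by rewrite /W le_max lexx.
move=> q z cq zq qr1.
pose u := (cmod z + q) / 2; have uz : cmod z < u by rewrite /u; lra.
have z0 := cmod_ge0 z.
have gu : coef_bounded c u by apply: cq; rewrite /u; apply/andP; split; lra.
have [yc yE yz] := path_hyps gu uz.
have FV := lambert_ode s1 gu uz.
have Ve : e < cmod (y0 * lambert_den s z).
  rewrite ltNge; apply/negP => h.
  have := path_avoids_critical y0n yi yc yE yz e2; rewrite rmorph1 mul1r /y addrC subrK => /(_ h).
  rewrite -/x0 -/rho addrAC subrr add0r cmodN cmodM => h2.
  have h3 : cmod z * cmod y0 <= r1 * cmod y0 by rewrite ler_wpM2r ?(ltW ym) //; lra.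
  by move: h2 h3 e3 r1rho; lra.
have /(congr1 (@cmod R)) := FV; rewrite cmodM cmod1 => FV1.
rewrite /W le_max; apply/orP; right; rewrite ler_pdivlMr //.
rewrite cmodM in Ve; have F0 := cmod_ge0 (lambert_sum_deriv s z).
apply: (@le_trans _ _ (cmod (lambert_sum_deriv s z) * (cmod y0 * cmod (lambert_den s z)))).
  by rewrite ler_wpM2l // ltW.
by rewrite mulrCA FV1 mulr1.
Qed.

(** Otherwise the path from x0 to branch_pt pi is covered by the disc, and at its
    end 1 + y = 0, against f s (1 + y) = 1. *)
Lemma lambert_radius_le r : 0 < Im y0 -> coef_bounded c r -> 0 <= r ->
  r * cmod y0 <= cmod (x0 - branch_pt pi).
Proof.
move=> yi gc r0; rewrite leNgt; apply/negP => h.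
have ym : 0 < cmod y0 by rewrite cmod_gt0.
pose z := (x0 - branch_pt pi) / y0.
have zr : cmod z < r by rewrite /z cmodM cmodV ltr_pdivrMr.
have [yc yE yz] := path_hyps gc zr.
have x1E : x0 - z * y0 = branch_pt pi by rewrite /z divfK // subKr.
have := path_to_critical yc yE yz yi x1E; rewrite rmorph1 mul1r /y => V0.
have : y0 * lambert_den s z = 0 by apply: (addIr (-1)); rewrite V0 add0r.
have FV := lambert_ode s1 gc zr.
move=> /eqP; rewrite mulf_eq0 (negbTE y0n) => /eqP Vz; move: FV; rewrite Vz mulr0 => /eqP.
by rewrite eq_sym oner_eq0.
Qed.

End LambertRadius.

Section Conjugation.
Local Open Scope complex_scope.
Variable R : realType.
Local Notation Re := complex.Re.
Local Notation Im := complex.Im.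
Implicit Types (s z : R[i]) (r : R).

Lemma cRe_inv z : Re z^-1 = Re z / cmod z ^+ 2.
Proof. by rewrite cmod_sqr; case: z. Qed.

Lemma cIm_inv z : Im z^-1 = - Im z / cmod z ^+ 2.
Proof. by rewrite cmod_sqr mulNr; case: z. Qed.

Lemma cRe_conj z : Re z^*%C = Re z. Proof. by case: z. Qed.
Lemma cIm_conj z : Im z^*%C = - Im z. Proof. by case: z. Qed.

Lemma cmod_conj z : cmod z^*%C = cmod z.
Proof. by rewrite !cmodE cRe_conj cIm_conj sqrrN. Qed.

Lemma carg_conj z : Im z != 0 -> carg z^*%C = - carg z.
Proof.
move=> zi; rewrite /carg cRe_conj cIm_conj cmod_conj oppr_ge0.
have [h|h|h] := ltrgt0P (Im z); last by rewrite h eqxx in zi.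
  by [].
by rewrite opprK.
Qed.

Lemma cln_conj z : Im z != 0 -> cln z^*%C = (cln z)^*%C.
Proof. by move=> zi; rewrite /cln cmod_conj carg_conj. Qed.

Lemma cln_inv z : Im z != 0 -> cln z^-1 = - cln z.
Proof.
move=> zi; have z0 : z != 0 by apply: contraNneq zi => ->.
have m0 : 0 < cmod z by rewrite cmod_gt0.
rewrite /cln cmodV lnV ?posrE //; apply: complex_eq => //=.
rewrite /carg cRe_inv cmodV cIm_inv mulNr oppr_ge0.
have -> : Re z / cmod z ^+ 2 / (cmod z)^-1 = Re z / cmod z by field; rewrite gt_eqF.
rewrite pmulr_lle0 ?invr_gt0 ?exprn_gt0 //.
have [h|h|h] := ltrgt0P (Im z); last by rewrite h eqxx in zi.
  by [].
by rewrite opprK.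
Qed.

Lemma lambert_coef_conj s m : lambert_coef s^*%C m = (lambert_coef s m)^*%C.
Proof.
have cD : {morph (@conjc R) : a b / a + b} by move=> [a b] [c d] /=; rewrite opprD.
have c0 : (0 : R[i])^*%C = 0 by rewrite /= oppr0.
have cM (a b : R[i]) : (a * b)^*%C = a^*%C * b^*%C.
  by case: a b => [a b] [c d]; apply: complex_eq => /=; ring.
have cX (a : R[i]) n : (a ^+ n)^*%C = a^*%C ^+ n.
  by elim: n => [|n IH]; [rewrite !expr0 /= oppr0 | rewrite !exprS cM IH].
rewrite /lambert_coef (big_morph _ cD c0); apply: eq_bigr => p _.
have cN1 : (-1 : R[i])^*%C = -1 by rewrite /= oppr0.
have c1s : (1 + s)^*%C = 1 + s^*%C by rewrite cD /= oppr0.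
by rewrite !(cM, cX, conjc_inv, conjc_nat, cN1, c1s).
Qed.

Lemma coef_bounded_conj s r : coef_bounded (lambert_coef s^*%C) r <-> coef_bounded (lambert_coef s) r.
Proof.
by split=> -[K hK]; exists K => m; have := hK m; rewrite lambert_coef_conj cmod_conj.
Qed.

Lemma tau_star_conj s : Im s != 0 -> tau_star_minus s^*%C = tau_star_plus s.
Proof.
move=> si; rewrite /tau_star_minus /tau_star_plus -[RHS]cmod_conj cln_conj //; congr cmod.
apply: complex_eq; case: s {si} => a b; case: (cln _) => c d; rewrite /= ?cReImE /=; ring.
Qed.

(** The geometric meaning of the formula: the distance from x0 to the critical
    value -1 + pi i, divided by |y0|. *)
Lemma tau_star_minusE s : Im s < 0 ->
  tau_star_minus s = cmod (s^-1 + cln s^-1 - branch_pt pi) / cmod s^-1.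
Proof.
move=> si; have s0 : s != 0 by apply: contraTneq si => ->; rewrite ltxx.
rewrite cln_inv ?lt_eqF // cmodV invrK -cmodM /tau_star_minus; congr cmod.
have -> : branch_pt pi = -1 + 'i%C * pi%:C :> R[i].
  by apply: complex_eq; rewrite /= ?cReImE /=; ring.
by rewrite !mulrBl mulrDl mulVf //; ring.
Qed.

Lemma lambert_radius_minus s : Im s < 0 ->
  (forall r, 0 <= r < tau_star_minus s -> coef_bounded (lambert_coef s) r) /\
  (forall r, 0 <= r -> coef_bounded (lambert_coef s) r -> r <= tau_star_minus s).
Proof.
move=> si; have s0 : s != 0 by apply: contraTneq si => ->; rewrite ltxx.
have y0n : s^-1 != 0 by rewrite invr_eq0.
have m0 : 0 < cmod s^-1 by rewrite cmod_gt0.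
have yi : 0 < Im s^-1.
  by rewrite cIm_inv divr_gt0 ?oppr_gt0 // exprn_gt0 // cmod_gt0.
have y01 : s^-1 != -1.
  by apply: contraTneq yi => ->; rewrite cImN /= oppr0 ltxx.
split=> r.
  move=> /andP[r0]; rewrite tau_star_minusE // ltr_pdivlMr // => h.
  by have := lambert_radius_ge y0n y01 (ltW yi) r0 h; rewrite invrK.
move=> r0 gr; rewrite tau_star_minusE // ler_pdivlMr //.
by apply: (lambert_radius_le y0n y01 yi _ r0); rewrite invrK.
Qed.

Lemma convergence_radius_minus s : Im s < 0 ->
  convergence_radius (lambert_coef s) = (tau_star_minus s)%:E.
Proof.
by move=> /lambert_radius_minus[lo up]; apply: convergence_radiusE => //; exact: cmod_ge0.
Qed.

Lemma convergence_radius_plus s : 0 < Im s ->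
  convergence_radius (lambert_coef s) = (tau_star_plus s)%:E.
Proof.
move=> si; have ci : Im s^*%C < 0 by rewrite cIm_conj oppr_lt0.
rewrite -tau_star_conj ?gt_eqF //.
have [lo up] := lambert_radius_minus ci.
apply: convergence_radiusE; first exact: cmod_ge0.
  by move=> r hr; exact: (coef_bounded_conj s r).1 (lo r hr).
by move=> r r0 gr; exact: up r r0 ((coef_bounded_conj s r).2 gr).
Qed.

End Conjugation.

(** * The boundary line near the real axis *)

Section RealAxisCrossings.
Variable R : realType.
Implicit Types (p q : R).

Lemma sin_le_norm (x : R) : `|sin x| <= `|x|.
Proof.
wlog x0 : x / 0 <= x => [h|].
  by have [/h//|/ltW x0] := leP 0 x; rewrite -normrN -sinN -[leRHS]normrN; apply: h; rewrite oppr_ge0.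
rewrite (ger0_norm x0); have [xp|xp] := leP x pi; last first.
  by apply: le_trans (sin_max x) _; have := pi_ge2 R; move: xp; lra.
rewrite ger0_norm; last by rewrite sin_ge0_pi // x0.
move: x0; rewrite le_eqVlt => /orP[/eqP<-|x0]; first by rewrite sin0.
by apply/ltW/sin_lt_id; rewrite x0.
Qed.

Lemma cos_ge (x : R) : 1 - x ^+ 2 / 2 <= cos x.
Proof.
have -> : x = x / 2 + x / 2 by lra.
rewrite cosD -!expr2 cos2sin2; have : sin (x / 2) ^+ 2 <= (x / 2) ^+ 2.
  by apply: le_sqr_norm; exact: sin_le_norm.
by rewrite -splitr; move: (sin _ ^+ 2) => t; nra.
Qed.

Lemma sin_ge (x : R) : 0 < x -> x - x ^+ 3 / 6 <= sin x.
Proof.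
move=> x0.
have D (t : R) : is_derive t (1 : R) (fun x => sin x - x + x ^+ 3 * 6^-1) (cos t - 1 + t ^+ 2 / 2).
  by apply: is_derive_eq; rewrite /GRing.scale /=; field.
have [|c _ E] := MVT_from0 x0 D; first by rewrite sin0 expr0n /= mul0r subr0 addr0.
have : 0 <= (cos c - 1 + c ^+ 2 / 2) * x by rewrite mulr_ge0 ?(ltW x0) //; have := cos_ge c; lra.
by rewrite -E; lra.
Qed.

(** The derivative in [boundary_polar_0_pos_crosses] is positive because
    pi^2 is less than the minimum, about 11.09, of (p + 1)^2 (p + 2) / p over
    p > 0.  The bound comes from sin^2 (pi / 4) = 1/2. *)
Lemma pi_lt_324 : pi < 81 / 25 :> R.
Proof.
rewrite ltNge; apply/negP => h.
have := @sin_ge (81 / 100) _; rewrite (_ : 0 < 81 / 100); last by lra.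
move=> /(_ isT) h1.
have h2 : sin (81 / 100) <= sin (pi / 4) :> R.
  have p2 := pihalf_lt2 R; have p0 := pi_gt0 R.
  have i1 : (81 / 100 : R) \in `[- (pi / 2), pi / 2] by rewrite in_itv /=; apply/andP; split; lra.
  have i2 : (pi / 4 : R) \in `[- (pi / 2), pi / 2] by rewrite in_itv /=; apply/andP; split; lra.
  by rewrite leNgt (ltr_sin i2 i1) -leNgt; lra.
have h3 : sin (pi / 4) ^+ 2 = 2^-1 :> R.
  have := cosD (pi / 4 : R) (pi / 4); have -> : pi / 4 + pi / 4 = pi / 2 :> R by field.
  by rewrite cos_pihalf -!expr2 cos2sin2; lra.
nra.
Qed.

(** The difference |L + ln L + 1 - pi i|^2 - |ln L|^2 for L = p + i q with
    q >= 0, where M = |L|. *)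
Definition boundary_polar p q : R := let M := Num.sqrt (p ^+ 2 + q ^+ 2) in
  (p + 1) ^+ 2 + 2 * (p + 1) * ln M + (q - pi) ^+ 2 + 2 * (q - pi) * acos (p / M).

(** Both signs occur arbitrarily close to p. *)
Definition crosses (h : R -> R) p := forall e, 0 < e ->
  exists p1 p2, [/\ `|p1 - p| < e, `|p2 - p| < e, h p1 < 0 & 0 < h p2].

(** By Caratheodory's criterion h t = G t (t - p) with G continuous at p and
    G p = d, so that G has the sign of d near p. *)
Lemma is_derive_crosses (h : R -> R) p d : is_derive p (1 : R) h d -> h p = 0 -> d != 0 ->
  crosses h p.
Proof.
move=> /is_derive1_caratheodory[G [hG Gc Gp]] hp d0 e e0.
have d1 : 0 < `|d| by rewrite normr_gt0.
have /nbhs_ballP[u /= u0 hu] : \forall t \near p, `|G p - G t| < `|d|.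
  by move/cvgrPdist_lt : Gc; apply.
have sgnG z : `|p - z| < u -> 0 < G z * d.
  move=> pz; have := hu z pz; rewrite Gp ltr_norml; case: (ltrgt0P d) d0 => [h1|h1|->]; rewrite ?eqxx //.
    by move=> _ /andP[h2 h3]; rewrite mulr_gt0 //; lra.
  by move=> _ /andP[h2 h3]; rewrite nmulr_lgt0 //; lra.
pose t := Num.min u e / 2.
have m0 : 0 < Num.min u e by rewrite lt_min u0.
have t0 : 0 < t by rewrite /t; lra.
have tu : t < u by apply: lt_le_trans (_ : Num.min u e <= _); [rewrite /t; lra | rewrite ge_min lexx].
have te : t < e by apply: lt_le_trans (_ : Num.min u e <= _); [rewrite /t; lra | rewrite ge_min lexx orbT].
have hE z : h z = G z * (z - p) by rewrite -hG hp subr0.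
have s1 : 0 < G (p + t) * d by apply: sgnG; rewrite opprD addNKr normrN gtr0_norm.
have s2 : 0 < G (p - t) * d by apply: sgnG; rewrite opprB addrC subrK gtr0_norm.
have n1 : `|p + t - p| < e by rewrite addrC addKr gtr0_norm.
have n2 : `|p - t - p| < e by rewrite addrC addKr normrN gtr0_norm.
have e1 : h (p + t) = G (p + t) * t by rewrite hE; ring.
have e2 : h (p - t) = - (G (p - t) * t) by rewrite hE; ring.
have [dp|dn] := ltP 0 d.
  exists (p - t), (p + t); split=> //.
    by rewrite e2 oppr_lt0 mulr_gt0 //; rewrite pmulr_lgt0 in s2.
  by rewrite e1 mulr_gt0 //; rewrite pmulr_lgt0 in s1.
have {}dn : d < 0 by rewrite lt_neqAle d0.
exists (p + t), (p - t); split=> //.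
  by rewrite e1 nmulr_rlt0 //; rewrite nmulr_lgt0 in s1.
by rewrite e2 oppr_gt0 nmulr_rlt0 //; rewrite nmulr_lgt0 in s2.
Qed.

(** The next three formulas are the values on the real axis: L = ln z is real for
    z > 1 and for 0 < z < 1, and has imaginary part pi for z < 0. *)
Lemma boundary_polar_0_pos p : 0 < p -> boundary_polar p 0 = (p + 1) ^+ 2 + 2 * (p + 1) * ln p + pi ^+ 2.
Proof.
move=> p0; rewrite /boundary_polar expr0n addr0 sqrtr_sqr gtr0_norm // divff ?gt_eqF // acos1.
by ring.
Qed.

Lemma boundary_polar_0_neg p : p < 0 -> boundary_polar p 0 = (p + 1) ^+ 2 + 2 * (p + 1) * ln (- p) - pi ^+ 2.
Proof.
move=> p0; rewrite /boundary_polar expr0n addr0 sqrtr_sqr ltr0_norm // invrN mulrN divff ?lt_eqF //.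
by rewrite acosN1; ring.
Qed.

Lemma boundary_polar_pi p : boundary_polar p pi = (p + 1) * (p + 1 + ln (p ^+ 2 + pi ^+ 2)).
Proof.
rewrite /boundary_polar subrr expr0n mulr0 mul0r !addr0.
have m0 : 0 < p ^+ 2 + pi ^+ 2 by rewrite ltr_wpDl ?sqr_ge0 // exprn_gt0 // pi_gt0.
have -> : ln (p ^+ 2 + pi ^+ 2) = 2 * ln (Num.sqrt (p ^+ 2 + pi ^+ 2)).
  rewrite -{1}(sqr_sqrtr (ltW m0)) lnXn ?sqrtr_gt0 // mulr_natl //.
ring.
Qed.

(** At a zero, the derivative times p (p + 1) is (p + 1)^2 (p + 2) - p pi^2; the
    logarithm is eliminated by the equation. *)
Lemma boundary_polar_0_pos_crosses p : 0 < p -> boundary_polar p 0 = 0 ->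
  crosses (fun p => (p + 1) ^+ 2 + 2 * (p + 1) * ln p + pi ^+ 2) p.
Proof.
move=> p0; rewrite boundary_polar_0_pos // => hp.
have D : is_derive p (1 : R) (fun p => (p + 1) ^+ 2 + 2 * (p + 1) * ln p + pi ^+ 2)
   (2 * (p + 1) + 2 * ln p + 2 * (p + 1) / p).
  by have := is_derive1_ln p0 => dl; apply: is_derive_eq; rewrite /GRing.scale /=; field; rewrite gt_eqF.
apply: (is_derive_crosses D hp); rewrite gt_eqF //.
have p10 : 0 < p + 1 by lra.
rewrite -(pmulr_rgt0 _ p10) -(pmulr_rgt0 _ p0).
have -> : p * ((p + 1) * (2 * (p + 1) + 2 * ln p + 2 * (p + 1) / p)) =
   p * (2 * (p + 1) ^+ 2 + 2 * (p + 1) * ln p) + 2 * (p + 1) ^+ 2 by field; rewrite gt_eqF.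
have -> : 2 * (p + 1) * ln p = - (p + 1) ^+ 2 - pi ^+ 2 by move: hp; lra.
have pi1 := pi_lt_324; have pi0 := pi_gt0 R.
have pi2 : pi ^+ 2 < 21 / 2 :> R by nra.
move: (pi ^+ 2) pi2 => w wl.
have pw : p * w < p * (21 / 2) by rewrite ltr_pM2l.
have p3 : 0 < p ^+ 3 by rewrite exprn_gt0.
(* p^3 + (4 p^2 - (11 / 2) p + 2) > 0 by completing the square *)
have := sqr_ge0 (2 * p - 11 / 8); move: pw p3; lra.
Qed.

(** As for positive p, with (p + 1)^2 (p + 2) + p pi^2 < 0 once p < -1. *)
Lemma boundary_polar_0_neg_crosses p : p < 0 -> boundary_polar p 0 = 0 ->
  crosses (fun p => (p + 1) ^+ 2 + 2 * (p + 1) * ln (- p) - pi ^+ 2) p.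
Proof.
move=> p0; rewrite boundary_polar_0_neg // => hp; have np0 : 0 < - p by lra.
have pi2 : 4 <= pi ^+ 2 :> R by have := pi_ge2 R; nra.
have p1 : p < -1.
  rewrite ltNge; apply/negP => h.
  have l0 : ln (- p) <= 0 by apply: ln_le0; lra.
  have : (p + 1) * ln (- p) <= 0 by rewrite mulr_ge0_le0 //; lra.
  by move: hp; nra.
have D : is_derive p (1 : R) (fun p => (p + 1) ^+ 2 + 2 * (p + 1) * ln (- p) - pi ^+ 2)
   (2 * (p + 1) + 2 * ln (- p) + 2 * (p + 1) / p).
  have dl : is_derive p (1 : R) (fun p => ln (- p)) p^-1.
    have h1 := is_derive1_ln np0.
    by apply: is_derive_eq (@is_derive1_comp _ (@ln R) -%R p _ _ h1 _) _;
      rewrite /GRing.scale /= invrN mulrN1 opprK.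
  by apply: is_derive_eq; rewrite /GRing.scale /=; field; rewrite lt_eqF.
apply: (is_derive_crosses D hp); rewrite lt_eqF //.
have p10 : p + 1 < 0 by lra.
rewrite -(nmulr_rgt0 _ p10) -(nmulr_rlt0 _ p0).
have -> : p * ((p + 1) * (2 * (p + 1) + 2 * ln (- p) + 2 * (p + 1) / p)) =
   p * (2 * (p + 1) ^+ 2 + 2 * (p + 1) * ln (- p)) + 2 * (p + 1) ^+ 2 by field; rewrite lt_eqF.
have -> : 2 * (p + 1) * ln (- p) = pi ^+ 2 - (p + 1) ^+ 2 by move: hp; lra.
move: (pi ^+ 2) pi2 => w wl.
have pw : p * w <= p * 4 by rewrite ler_nM2l.
have q0 : 0 <= (p + 1) ^+ 2 by rewrite sqr_ge0.
suff : (p + 1) ^+ 2 * (p + 2) < - (p * 4) by move: pw; lra.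
have [h|h] := leP p (-2).
  by apply: (@le_lt_trans _ _ 0); [rewrite mulr_ge0_le0 //; lra | lra].
have q1 : (p + 1) ^+ 2 <= 1 by nra.
by apply: (@le_lt_trans _ _ ((p + 1) ^+ 2 * 1)); [rewrite ler_wpM2l //; lra | lra].
Qed.

(** The second factor has a positive derivative and is positive at p = -1, so
    both factors have simple zeros and no common one. *)
Lemma boundary_polar_pi_crosses p : boundary_polar p pi = 0 ->
  crosses (fun p => (p + 1) * (p + 1 + ln (p ^+ 2 + pi ^+ 2))) p.
Proof.
rewrite boundary_polar_pi => hp; have pi2 : 4 <= pi ^+ 2 :> R by have := pi_ge2 R; nra.
have m0 : 0 < p ^+ 2 + pi ^+ 2 by have := sqr_ge0 p; lra.
pose k := p + 1 + ln (p ^+ 2 + pi ^+ 2); pose k' := 1 + 2 * p / (p ^+ 2 + pi ^+ 2).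
have D (w : R) (w0 : 0 < p ^+ 2 + w) :
    is_derive p (1 : R) (fun p => (p + 1) * (p + 1 + ln (p ^+ 2 + w)))
      (p + 1 + ln (p ^+ 2 + w) + (p + 1) * (1 + 2 * p / (p ^+ 2 + w))).
  have dm : is_derive p (1 : R) (fun p => p ^+ 2 + w) (2 * p).
    by apply: is_derive_eq; rewrite /GRing.scale /=; ring.
  have h1 := is_derive1_ln w0.
  have dl := @is_derive1_comp _ (@ln R) (fun p => p ^+ 2 + w) p _ _ h1 dm.
  by apply: is_derive_eq; rewrite /GRing.scale /=; field; rewrite gt_eqF.
have k'0 : 0 < k'.
  have -> : k' = ((p + 1) ^+ 2 + pi ^+ 2 - 1) / (p ^+ 2 + pi ^+ 2)
    by rewrite /k'; move: (pi ^+ 2) m0 => w w0; field; rewrite gt_eqF.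
  by rewrite divr_gt0 //; have := sqr_ge0 (p + 1); lra.
apply: (is_derive_crosses (D _ m0) hp); rewrite -/k -/k'.
move/eqP : hp; rewrite mulf_eq0 => /orP[/eqP p1|/eqP k0]; last first.
  rewrite /k k0 add0r mulf_neq0 ?(gt_eqF k'0) //.
  apply: contra_eqN k0 => /eqP p1; rewrite p1 add0r gt_eqF // ln_gt0 //.
  by have := sqr_ge0 p; lra.
rewrite p1 mul0r addr0 /k p1 add0r gt_eqF // ln_gt0 //; by have := sqr_ge0 p; lra.
Qed.

End RealAxisCrossings.

(** * The boundary function *)

Section BoundaryFunction.
Local Open Scope complex_scope.
Variable R : realType.
Local Notation Re := complex.Re.
Local Notation Im := complex.Im.
Implicit Types (z w : R[i]) (r : R).

Definition polar_log z : R := ln (cmod z).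
(** The modulus of the argument: it is symmetric under conjugation and continuous
    across the cut of the logarithm. *)
Definition polar_arg z : R := acos (Re z / cmod z).

Definition boundary_fun z : R := boundary_polar (polar_log z) (polar_arg z).

Lemma boundary_fun_conj z : boundary_fun z^*%C = boundary_fun z.
Proof. by rewrite /boundary_fun /polar_log /polar_arg cmod_conj cRe_conj. Qed.

(** After division by |ln z|, the two squared moduli compare the radius of
    convergence with |tau|. *)
Lemma boundary_funE z : 0 <= Im z -> z != 0 ->
  boundary_fun z = cmod (cln z + cln (cln z) - branch_pt pi) ^+ 2 - cmod (cln (cln z)) ^+ 2.
Proof.
move=> zi z0; have /andP[c0 _] := carg_ge0 z0 zi.
have cE : carg z = acos (Re z / cmod z) by rewrite /carg zi.
set L := cln z; have LR : Re L = ln (cmod z) by [].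
have LI : Im L = carg z by [].
have aL : carg L = acos (ln (cmod z) / cmod L) by rewrite /carg LI c0.
have ME : Num.sqrt (ln (cmod z) ^+ 2 + carg z ^+ 2) = cmod L by rewrite [cmod L]cmodE.
rewrite /boundary_fun /polar_log /polar_arg -cE /boundary_polar ME -aL !cmod_sqr !cReD !cImD !cReN !cImN LR LI /=.
by move: (ln (cmod z)) (carg z) (ln (cmod L)) (carg L) => a b c d; rewrite opprK; ring.
Qed.

Lemma cln_eq0 z : z != 0 -> cln z = 0 -> z = 1.
Proof. by move=> z0 h; rewrite -(cexp_cln z0) h cexp0. Qed.

Lemma cln_conj_cln z : 0 < Im z -> z != 0 ->
  cln (cln z^*%C) = (cln (cln z))^*%C /\ cln z^*%C = (cln z)^*%C.
Proof.
move=> zi z0; have e1 : cln z^*%C = (cln z)^*%C by apply: cln_conj; rewrite gt_eqF.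
rewrite e1 cln_conj //=; by case/andP: (carg_gt0 zi) => h _; rewrite gt_eqF.
Qed.

(** Only the lower bound on the radius is used, which holds for real z too; for
    z = 1/e, where sigma = -1, all coefficients vanish. *)
Lemma boundary_fun_cvg z : z != 0 -> z != 1 -> 0 < boundary_fun z ->
  cvgn (cpseries (lambert_coef (sigma z)) (tau z)).
Proof.
have upper w : 0 <= Im w -> w != 0 -> w != 1 -> 0 < boundary_fun w ->
    exists2 r, cmod (tau w) < r & coef_bounded (lambert_coef (sigma w)) r.
  move=> wi w0 w1 gw; have L0 : cln w != 0 by apply: contra_neq w1 => /cln_eq0 ->.
  have m0 : 0 < cmod (cln w) by rewrite cmod_gt0.
  have [L1|L1] := eqVneq (cln w) (-1).
    exists (cmod (tau w) + 1); first by rewrite ltrDl.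
    exists 0 => m; rewrite /sigma L1 (_ : (-1)^-1 = -1); last by rewrite invrN invr1.
    by rewrite lambert_coefN1 cmod0 mul0r.
  have Li : 0 <= Im (cln w) by case/andP: (carg_ge0 w0 wi).
  have lt : cmod (cln (cln w)) < cmod (cln w + cln (cln w) - branch_pt pi).
    rewrite -(@ltr_pXn2r _ 2) ?nnegrE ?cmod_ge0 // -subr_gt0 -boundary_funE //.
  have tE : cmod (tau w) = cmod (cln (cln w)) / cmod (cln w) by rewrite /tau cmodM cmodV.
  have tlt : cmod (tau w) < cmod (cln w + cln (cln w) - branch_pt pi) / cmod (cln w).
    by rewrite tE ltr_pM2r // invr_gt0.
  have [h1 h2] := midf_lt tlt; eexists; first exact: h1.
  apply: lambert_radius_ge => //; last by rewrite -ltr_pdivlMr.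
  by apply: le_trans (ltW h1); exact: cmod_ge0.
move=> z0 z1 gz; have [zi|zi] := leP 0 (Im z).
  by have [r h1 h2] := upper z zi z0 z1 gz; apply: coef_bounded_cvg h2 h1.
have wi : 0 < Im z^*%C by rewrite cIm_conj oppr_gt0.
have w0 : z^*%C != 0 by apply: contra_neq z0 => h; rewrite -[z]conjcK h conjc0.
have w1 : z^*%C != 1 by apply: contra_neq z1 => h; rewrite -[z]conjcK h conjc1.
have [|r h1 h2] := upper _ (ltW wi) w0 w1; first by rewrite boundary_fun_conj.
have [e1 e2] := cln_conj_cln wi w0; rewrite conjcK in e1 e2.
apply: (@coef_bounded_cvg _ _ r).
  have -> : sigma z = (sigma z^*%C)^*%C by rewrite /sigma e2 conjc_inv.
  exact: (coef_bounded_conj _ _).2.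
by move: h1; rewrite /tau e1 e2 !cmodM !cmodV !cmod_conj.
Qed.

Lemma line_upper z : 0 < Im z -> boundary_fun z = 0 ->
  cmod (- (sigma z * cln (sigma z))) = tau_star_minus (sigma z).
Proof.
move=> zi gz; have z0 : z != 0 by apply: contraTneq zi => ->; rewrite ltxx.
have /andP[Li _] := carg_gt0 zi.
have L0 : cln z != 0 by apply/eqP => h; move: Li; rewrite -[carg z]/(Im (cln z)) h ltxx.
have m0 : 0 < cmod (cln z) by rewrite cmod_gt0.
have Lin : Im (cln z) != 0 by rewrite gt_eqF.
have si : Im (sigma z) < 0.
  by rewrite /sigma cIm_inv mulNr oppr_lt0 divr_gt0 // exprn_gt0.
rewrite tau_star_minusE // cmodN cmodM /sigma invrK cln_inv // cmodN cmodV mulrC; congr (_ / _).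
apply/eqP; rewrite -(@eqrXn2 _ 2) ?cmod_ge0 // eq_sym -subr_eq0.
by rewrite -boundary_funE ?gz // ltW.
Qed.

End BoundaryFunction.

Section BoundaryContinuity.
Local Open Scope complex_scope.
Variable R : realType.
Local Notation Re := complex.Re.
Local Notation Im := complex.Im.
Implicit Types (x : R).

(** The cosine is strictly decreasing on [0, pi]: compare with its values at
    acos x + e and acos x - e, unless these leave the interval. *)
Lemma acos_near x e : -1 <= x <= 1 -> 0 < e -> exists2 d, 0 < d &
  forall y, -1 <= y <= 1 -> `|x - y| < d -> `|acos x - acos y| < e.
Proof.
move=> hx e0; set a := acos x.
have [/andP[a0 ap] ca] : 0 <= a <= pi /\ cos a = x by rewrite acos_ge0 // acos_lepi // acosK // in_itv.
have ub : exists2 d, 0 < d & forall y, -1 <= y <= 1 -> `|x - y| < d -> acos y < a + e.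
  have [ae|ae] := leP (a + e) pi; last first.
    by exists 1 => // y hy _; apply: le_lt_trans ae; exact: acos_lepi.
  exists (x - cos (a + e)); first by rewrite subr_gt0 -ca ltr_cos ?in_itv /=; lra.
  move=> y hy; rewrite ltr_norml => /andP[_ h]; rewrite -ltr_cos ?in_itv /= ?acos_ge0 ?acos_lepi //.
    by rewrite acosK ?in_itv //; lra.
  by lra.
have lb : exists2 d, 0 < d & forall y, -1 <= y <= 1 -> `|x - y| < d -> a - e < acos y.
  have [ae|ae] := leP 0 (a - e); last first.
    by exists 1 => // y hy _; apply: lt_le_trans ae _; exact: acos_ge0.
  exists (cos (a - e) - x); first by rewrite subr_gt0 -ca ltr_cos ?in_itv /=; lra.
  move=> y hy; rewrite ltr_norml => /andP[h _]; rewrite -ltr_cos ?in_itv /= ?acos_ge0 ?acos_lepi //.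
    by rewrite acosK ?in_itv //; lra.
  by lra.
have [d1 d10 h1] := ub; have [d2 d20 h2] := lb.
exists (Num.min d1 d2); first by rewrite lt_min d10.
move=> y hy; rewrite lt_min => /andP[/(h1 y hy) k1 /(h2 y hy) k2].
by rewrite ltr_norml; lra.
Qed.

Definition cont_at (T : topologicalType) (f : T -> R) (t : T) := f u @[u --> t] --> f t.

Lemma cont_atP (T : topologicalType) (f : T -> R) (t : T) :
  cont_at f t <-> forall e, 0 < e -> \forall u \near t, `|f t - f u| < e.
Proof. by split=> [/cvgrPdist_lt//|h]; apply/cvgrPdist_lt => e; apply: h. Qed.

Section ContAtAlgebra.
Variables (T : topologicalType) (t : T).
Implicit Types f g : T -> R.

Lemma cont_at_cst (a : R) : cont_at (fun=> a) t.
Proof. exact: cvg_cst. Qed.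

Lemma cont_atD f g : cont_at f t -> cont_at g t -> cont_at (fun u => f u + g u) t.
Proof. exact: cvgD. Qed.

Lemma cont_atM f g : cont_at f t -> cont_at g t -> cont_at (fun u => f u * g u) t.
Proof. exact: cvgM. Qed.

Lemma cont_atV f : f t != 0 -> cont_at f t -> cont_at (fun u => (f u)^-1) t.
Proof. exact: cvgV. Qed.

Lemma cont_at_comp (h : R -> R) f : cont_at f t -> {for f t, continuous h} ->
  cont_at (fun u => h (f u)) t.
Proof. exact: continuous_comp. Qed.

Lemma cont_at_acos f : (forall u, -1 <= f u <= 1) -> cont_at f t ->
  cont_at (fun u => acos (f u)) t.
Proof.
move=> fb /cont_atP fc; apply/cont_atP => e e0.
have [d d0 hd] := acos_near (fb t) e0; apply: filterS (fc d d0) => u hu.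
exact: hd.
Qed.

End ContAtAlgebra.

Lemma nbhs_complexP (z : cplx R) (P : cplx R -> Prop) :
  (\forall w \near z, P w) <-> exists2 d : R, 0 < d & forall w : cplx R, cmod (w - z) < d -> P w.
Proof.
have cm (w : cplx R) : (`|w| : R[i]) = (cmod w)%:C by exact: normc_cmod.
split.
  move=> /nbhs_ballP[e /= e0 h]; move: e0 h; case: e => er ei; rewrite ltcE /= => /andP[/eqP -> er0] h.
  exists er => // w wz; apply: h; rewrite -ball_normE /=.
  by rewrite cm cmodB ltcR.
move=> [d d0 h]; apply/nbhs_ballP; exists d%:C; first by rewrite /= ltcR.
by move=> w; rewrite -ball_normE /= cm ltcR cmodB => /h.
Qed.

Lemma cont_at_Re (z : cplx R) : cont_at (fun w : cplx R => Re w) z.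
Proof.
apply/cont_atP => e e0; apply/nbhs_complexP; exists e => // w wz.
by apply: le_lt_trans wz; rewrite -cReN -cReD cmodB Re_le_cmod.
Qed.

Lemma cont_at_cmod (z : cplx R) : cont_at (fun w : cplx R => cmod (w : R[i])) z.
Proof.
apply/cont_atP => e e0; apply/nbhs_complexP; exists e => // w wz.
apply: le_lt_trans wz; rewrite ler_norml lerNl opprB cmodB ler_cmod_dist /=.
by rewrite cmodB ler_cmod_dist.
Qed.

Lemma ratio_bound (w : R[i]) : -1 <= Re w / cmod w <= 1.
Proof.
have [->|/cos_arg_bound//] := eqVneq w 0.
by rewrite cmod0 invr0 mulr0; apply/andP; split; lra.
Qed.

Local Notation P := (@polar_log R).
Local Notation Q := (@polar_arg R).

Lemma cont_at_polar_log (z : cplx R) : z != 0 -> cont_at (P : cplx R -> R) z.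
Proof.
move=> z0; apply: cont_at_comp; first exact: cont_at_cmod.
by apply: continuous_ln; rewrite cmod_gt0.
Qed.

Lemma cont_at_polar_arg (z : cplx R) : z != 0 -> cont_at (Q : cplx R -> R) z.
Proof.
move=> z0; apply: cont_at_acos; first by move=> u; exact: ratio_bound.
apply: cont_atM; first exact: cont_at_Re.
by apply: cont_atV; [rewrite cmod_eq0 | exact: cont_at_cmod].
Qed.

(* ln z <> 0 *)
Lemma cmod_ln_gt0 (z : cplx R) : z != 0 -> z != 1 -> 0 < Num.sqrt (P z ^+ 2 + Q z ^+ 2).
Proof.
move=> z0 z1; have zl : (cmod z +i* 0) != 0 :> R[i].
  by rewrite eq_complex /= cmod_eq0 negb_and z0.
rewrite sqrtr_gt0 lt_def addr_ge0 ?sqr_ge0 // andbT paddr_eq0 ?sqr_ge0 // !sqrf_eq0.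
apply: contra_neqN z1 => /andP[/eqP p0 /eqP q0].
have m0 : 0 < cmod z by rewrite cmod_gt0.
have m1 : cmod z = 1 by apply/eqP; rewrite -ln_eq0 //; apply/eqP.
have r1 : Re z = 1.
  have := acosK (ratio_bound z : Re z / cmod z \in `[-1, 1]).
  by rewrite -/(Q z) q0 cos0 m1 divr1.
have i0 : Im z = 0.
  have := cmod_sqr z; rewrite m1 r1 expr1n => h.
  by apply/eqP; rewrite -sqrf_eq0; apply/eqP; lra.
exact: complex_eq.
Qed.

Lemma boundary_fun_continuous (z : cplx R) : z != 0 -> z != 1 ->
  cont_at (fun w : cplx R => boundary_fun (w : R[i])) z.
Proof.
move=> z0 z1; have Pc := cont_at_polar_log z0; have Qc := cont_at_polar_arg z0.
pose M (w : cplx R) := Num.sqrt (P w ^+ 2 + Q w ^+ 2).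
have M0 : 0 < M z by exact: cmod_ln_gt0.
have Mc : cont_at M z.
  apply: cont_at_comp; last exact: sqrt_continuous.
  by apply: cont_atD; apply: cont_atM.
have lc : cont_at (fun w : cplx R => ln (M w)) z by apply: cont_at_comp => //; apply: continuous_ln.
have ac : cont_at (fun w : cplx R => acos (P w / M w)) z.
  apply: cont_at_acos; first by move=> u; have := ratio_bound (P u +i* Q u); rewrite cmodE.
  by apply: cont_atM => //; apply: cont_atV => //; rewrite gt_eqF.
have p1 : cont_at (fun w : cplx R => P w + 1) z by apply: cont_atD => //; exact: cont_at_cst.
have q1 : cont_at (fun w : cplx R => Q w - pi) z by apply: cont_atD => //; exact: cont_at_cst.
have E : (fun w : cplx R => boundary_fun (w : R[i])) = fun w => (P w + 1) * (P w + 1) +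
   2 * (P w + 1) * ln (M w) + (Q w - pi) * (Q w - pi) + 2 * (Q w - pi) * acos (P w / M w).
  by [].
rewrite E; apply: cont_atD.
  apply: cont_atD; last by apply: cont_atM.
  apply: cont_atD; first by apply: cont_atM.
  by apply: cont_atM => //; apply: cont_atM => //; exact: cont_at_cst.
by apply: cont_atM => //; apply: cont_atM => //; exact: cont_at_cst.
Qed.

End BoundaryContinuity.

(** * Signs of the boundary function and the exterior *)

Section BoundarySigns.
Local Open Scope complex_scope.
Variable R : realType.
Implicit Types (p q : R).

Let pi4 : pi < 4 :> R. Proof. by have := pihalf_lt2 R; lra. Qed.

Let M_ge p q : `|p| <= Num.sqrt (p ^+ 2 + q ^+ 2).
Proof. by rewrite -sqrtr_sqr; apply: ler_wsqrtr; rewrite lerDl sqr_ge0. Qed.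

Let acosM p q : 0 <= acos (p / Num.sqrt (p ^+ 2 + q ^+ 2)) <= pi.
Proof.
have h := ratio_bound (p +i* q); rewrite cmodE /= in h.
by rewrite acos_ge0 // acos_lepi.
Qed.

(* Crude bounds obtained from pi < 4. *)
Let corr_bounds q a : 0 <= q <= pi -> 0 <= a <= pi -> - 32 <= (q - pi) ^+ 2 + 2 * (q - pi) * a <= 16.
Proof.
move=> /andP[q0 qp] /andP[a0 ap]; have p0 := pi_gt0 R; have p4 := pi4.
have h1 : (pi - q) * a <= 4 * 4 by apply: ler_pM; lra.
have h2 : 0 <= (pi - q) * a by rewrite mulr_ge0 //; lra.
have h3 : (pi - q) * (pi - q) <= 4 * 4 by apply: ler_pM; lra.
have h4 : 0 <= (pi - q) * (pi - q) by rewrite mulr_ge0 //; lra.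
by apply/andP; split; lra.
Qed.

(** Near z = 1: the logarithm of |ln z| dominates, as 9/4 + 16 < 20. *)
Lemma boundary_polar_lt0 p q : `|p| <= 1 / 2 -> 0 <= q <= pi ->
  0 < Num.sqrt (p ^+ 2 + q ^+ 2) < expR (- 20) -> boundary_polar p q < 0.
Proof.
rewrite ler_norml => /andP[p1 p2] hq; rewrite /boundary_polar; have ha := acosM p q.
set M := Num.sqrt _ in ha * => /andP[M0 Ms].
have lM : ln M < - 20 by rewrite -[ltRHS]expRK ltr_ln ?posrE ?expR_gt0.
have /andP[_ c] := corr_bounds hq ha.
have : (2 * (p + 1)) * ln M <= 1 * ln M by apply: ler_wnM2r; lra.
have : (p + 1) ^+ 2 <= 9 / 4 by nra.
by move: c; lra.
Qed.

(** Near infinity: already (p + 1)^2 > 32. *)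
Lemma boundary_polar_gt0_large p q : 16 <= p -> 0 <= q <= pi -> 0 < boundary_polar p q.
Proof.
move=> p1 hq; rewrite /boundary_polar; have ha := acosM p q; have hM := M_ge p q.
set M := Num.sqrt _ in ha hM *.
have /andP[c _] := corr_bounds hq ha.
rewrite ger0_norm in hM; last by lra.
have l0 : 0 <= ln M by apply: ln_ge0; lra.
have : 0 <= 2 * (p + 1) * ln M by rewrite !mulr_ge0 //; lra.
have : 289 <= (p + 1) ^+ 2 by nra.
by move: c; lra.
Qed.

(** Near 0: bounding ln M by its tangent at 8 makes the product with 2 (p + 1)
    grow like p^2 / 4 only, less than (p + 1)^2. *)
Lemma boundary_polar_gt0_small p q : p <= -16 -> 0 <= q <= pi -> 0 < boundary_polar p q.
Proof.
move=> p1 hq; rewrite /boundary_polar; have ha := acosM p q; have hM := M_ge p q.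
set M := Num.sqrt _ in ha hM *.
have /andP[c _] := corr_bounds hq ha; have p4 := pi4.
rewrite ler0_norm in hM; last by lra.
have M0 : 0 < M by lra.
have Mu : M <= - p + 4.
  rewrite -(ler_pXn2r (_ : 0 < 2)%N) ?nnegrE //; [|lra|lra].
  rewrite sqr_sqrtr ?addr_ge0 ?sqr_ge0 //; case/andP: hq => q0 qp.
  have : q ^+ 2 <= 16 by nra.
  by nra.
have lM : ln M <= - p / 8 + 5 / 2.
  have h8 : ln (8 : R) <= 3.
    have -> : 8 = 2 ^+ 3 :> R by rewrite !exprS expr0; lra.
    rewrite lnXn //; have := ln_le_subr1 (_ : 0 < 2 :> R); rewrite ltr0n => /(_ isT).
    by rewrite -mulr_natl; lra.
  have M8 : 0 < M / 8 by lra.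
  have := ln_le_subr1 M8; rewrite ln_div ?posrE //; lra.
have : (2 * (- p - 1)) * ln M <= (2 * (- p - 1)) * (- p / 8 + 5 / 2) by apply: ler_wpM2l; lra.
have p2 : 16 * 16 <= (- p) * (- p) by apply: ler_pM; lra.
have p3 : 16 * (- p) <= (- p) * (- p) by apply: ler_wpM2r; lra.
by move: c; lra.
Qed.

End BoundarySigns.

Section BoundaryLine.
Local Open Scope complex_scope.
Variable R : realType.
Local Notation Re := complex.Re.
Local Notation Im := complex.Im.
Implicit Types (z w : cplx R).

Let bf z : R := boundary_fun (z : R[i]).

Lemma polar_arg_bounds z : 0 <= polar_arg (z : R[i]) <= pi.
Proof. by rewrite /polar_arg acos_ge0 ?acos_lepi // ratio_bound. Qed.

Lemma boundary_fun_near1 : \forall w \near (1 : cplx R), w != 1 -> bf w < 0.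
Proof.
have e0 : 0 < expR (- 20) / 2 :> R by rewrite divr_gt0 ?expR_gt0.
have o0 : (1 : cplx R) != 0 by exact: oner_neq0.
have p1 : polar_log (1 : R[i]) = 0 by rewrite /polar_log cmod1 ln1.
have q1 : polar_arg (1 : R[i]) = 0 by rewrite /polar_arg cmod1 divr1 acos1.
have e1 : expR (- 20) <= 1 :> R by rewrite expR_le1; lra.
have /cont_atP/(_ _ e0) := cont_at_polar_log o0; have /cont_atP/(_ _ e0) := cont_at_polar_arg o0.
rewrite p1 q1 => hq hp; have hw : \forall w \near (1 : cplx R), `|1 - cmod (w : R[i])| < 1.
  by have /cont_atP/(_ _ ltr01) := @cont_at_cmod R 1; rewrite cmod1.
apply: filterS3 hq hp hw => w; rewrite !sub0r !normrN => hq hp hw w1.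
have w0 : w != 0 by apply: contraTneq hw => ->; rewrite cmod0 subr0 normr1 ltxx.
apply: boundary_polar_lt0; first by lra.
  exact: polar_arg_bounds.
rewrite cmod_ln_gt0 //=.
have := cmod_le_ReIm (polar_log (w : R[i]) +i* polar_arg (w : R[i])); rewrite cmodE /=; lra.
Qed.

Lemma boundary_fun_near0 : \forall w \near (0 : cplx R), w != 0 -> 0 < bf w.
Proof.
apply/nbhs_complexP; exists (expR (- 16)); first exact: expR_gt0.
move=> w; rewrite subr0 => wl w0; apply: boundary_polar_gt0_small; last exact: polar_arg_bounds.
by rewrite /polar_log -[leRHS]expRK ler_ln ?posrE ?expR_gt0 ?cmod_gt0 // ltW.
Qed.

Lemma boundary_fun_far w : expR 16 <= cmod (w : R[i]) -> 0 < bf w.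
Proof.
move=> wl; apply: boundary_polar_gt0_large; last exact: polar_arg_bounds.
rewrite /polar_log -[leLHS]expRK ler_ln ?posrE ?expR_gt0 //.
by apply: lt_le_trans wl; exact: expR_gt0.
Qed.

Let line_set : set (cplx R) :=
    [set z : cplx R | 0 < Im z /\
        cmod (- (sigma z * cln (sigma z))) = tau_star_minus (sigma z)] `|`
    [set z : cplx R | Im z < 0 /\
        cmod (- (sigma z * cln (sigma z))) = tau_star_plus (sigma z)].

Lemma boundary_line_nonreal z : Im z != 0 -> bf z = 0 -> line_set z.
Proof.
move=> zi gz; have [zp|zn|z0] := ltrgt0P (Im z); last by rewrite z0 eqxx in zi.
  by left; split=> //; exact: line_upper.
right; split=> //; pose w : R[i] := (z : R[i])^*%C.
have wi : 0 < Im w by rewrite cIm_conj oppr_gt0.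
have w0 : w != 0 by apply: contraTneq wi => ->; rewrite ltxx.
have gw : boundary_fun w = 0 by rewrite /w boundary_fun_conj.
have [_ e2] := cln_conj_cln wi w0; rewrite conjcK in e2.
have sE : sigma z = (sigma w)^*%C by rewrite /sigma e2 conjc_inv.
have /andP[Li _] := carg_gt0 wi.
have L0 : cln w != 0 by apply/eqP => h; move: Li; rewrite -[carg w]/(Im (cln w)) h ltxx.
have si : Im (sigma w) < 0.
  by rewrite /sigma cIm_inv mulNr oppr_lt0 divr_gt0 // exprn_gt0 // cmod_gt0.
have si' : Im (sigma w) != 0 by rewrite lt_eqF.
have := line_upper wi gw; rewrite !cmodN !cmodM sE cln_conj // !cmod_conj => ->.
have si2 : Im (sigma w)^*%C != 0 by rewrite cIm_conj oppr_eq0 si'.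
rewrite -(tau_star_conj si2); suff -> : ((sigma w)^*^*)%C = sigma w by [].
by case: (sigma w) => a b /=; rewrite opprK.
Qed.

Let near_exp (p e : R) : 0 < e -> exists2 d, 0 < d & forall u, `|u - p| < d -> `|expR u - expR p| < e.
Proof.
move=> e0; have /cvgrPdist_lt/(_ e e0)/nbhs_ballP[d /= d0 h] := @continuous_expR R p.
by exists d => // u hu; rewrite distrC; apply: h; rewrite /ball /= distrC.
Qed.

Let bf_pos (p : R) : bf (expR p)%:C = boundary_polar p 0.
Proof.
rewrite /bf /boundary_fun /polar_log /polar_arg cmod_real (gtr0_norm (expR_gt0 p)) expRK /=.
by rewrite divff ?gt_eqF ?expR_gt0 // acos1.
Qed.

Let bf_neg (p : R) : bf (- expR p)%:C = boundary_polar p pi.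
Proof.
rewrite /bf /boundary_fun /polar_log /polar_arg cmod_real normrN (gtr0_norm (expR_gt0 p)) expRK /=.
by rewrite mulNr divff ?gt_eqF ?expR_gt0 // acosN1.
Qed.

Let real_sign_change (x e : R) : x != 0 -> x != 1 -> bf x%:C = 0 -> 0 < e ->
  exists x1 x2 : R, [/\ `|x1 - x| < e, `|x2 - x| < e, bf x1%:C < 0 & 0 < bf x2%:C].
Proof.
move=> x0 x1 gx e0; pose p := ln `|x|.
have px : expR p = `|x| by rewrite lnK // posrE normr_gt0.
have [d d0 hd] := near_exp p e0.
have [xp|xn|/eqP] := ltrgt0P x; last by rewrite (negbTE x0).
  rewrite (gtr0_norm xp) in px; rewrite -{}px in gx x1 hd *; rewrite bf_pos in gx.
  have pn : p != 0 by apply: contra_neq x1 => ->; rewrite expR0.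
  have p0 : 0 < Num.min d `|p| by rewrite lt_min d0 normr_gt0.
  have [pp|pn'|/eqP] := ltrgt0P p; last by rewrite (negbTE pn).
    have [p1 [p2 [h1 h2 h3 h4]]] := boundary_polar_0_pos_crosses pp gx p0.
    rewrite !lt_min (gtr0_norm pp) in h1 h2; case/andP: h1 => h1 k1; case/andP: h2 => h2 k2.
    exists (expR p1), (expR p2); rewrite !bf_pos; rewrite !ltr_norml in k1 k2.
    by rewrite !boundary_polar_0_pos; [split; rewrite ?hd | lra | lra].
  have [p1 [p2 [h1 h2 h3 h4]]] := boundary_polar_0_neg_crosses pn' gx p0.
  rewrite !lt_min (ltr0_norm pn') in h1 h2; case/andP: h1 => h1 k1; case/andP: h2 => h2 k2.
  exists (expR p1), (expR p2); rewrite !bf_pos; rewrite !ltr_norml in k1 k2.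
  by rewrite !boundary_polar_0_neg; [split; rewrite ?hd | lra | lra].
rewrite (ltr0_norm xn) in px; have xE : x = - expR p by rewrite px opprK.
rewrite xE bf_neg in gx.
have [p1 [p2 [h1 h2 h3 h4]]] := boundary_polar_pi_crosses gx d0.
exists (- expR p1), (- expR p2); rewrite !bf_neg !boundary_polar_pi xE.
by split; rewrite // -opprD normrN; exact: hd.
Qed.

(** Both signs occur on the real axis near z, hence by continuity at the ends of
    a segment slightly above and parallel to it, on which there is then a
    non-real zero. *)
Lemma boundary_line_real z : Im z = 0 -> z != 0 -> z != 1 -> bf z = 0 ->
  boundary_line z.
Proof.
move=> zi z0 z1 gz; have zE : z = (Re z)%:C by apply: complex_eq.
have x0 : Re z != 0 by apply: contra_neq z0 => h; rewrite zE h.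
have x1 : Re z != 1 by apply: contra_neq z1 => h; rewrite zE h.
rewrite zE in gz; move=> B /nbhs_complexP[d d0 hB].
have e0 : 0 < Num.min (d / 2) (Num.min `|Re z| `|Re z - 1|).
  by rewrite !lt_min !normr_gt0 subr_eq0 x0 x1 !andbT; lra.
have [u1 [u2 []]] := real_sign_change x0 x1 gz e0.
rewrite !lt_min => /and3P[h1 k1 l1] /and3P[h2 k2 l2] g1 g2.
have off (u : R) : `|u - Re z| < `|Re z| -> `|u - Re z| < `|Re z - 1| ->
    (u%:C : cplx R) != 0 /\ (u%:C : cplx R) != 1.
  move=> a b; split; first by apply: contraTneq a => -[->]; rewrite sub0r normrN ltxx.
  by apply: contraTneq b => -[->]; rewrite distrC ltxx.
have [a1 b1] := off _ k1 l1; have [a2 b2] := off _ k2 l2.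
have /cont_atP/(_ (- bf u1%:C)) := boundary_fun_continuous a1 b1.
rewrite oppr_gt0 => /(_ g1)/nbhs_complexP[d1 d10 hd1].
have /cont_atP/(_ (bf u2%:C) g2)/nbhs_complexP[d3 d30 hd3] := boundary_fun_continuous a2 b2.
pose eta := Num.min (d / 2) (Num.min d1 d3) / 2.
have m0 : 0 < Num.min (d / 2) (Num.min d1 d3) by rewrite !lt_min d10 d30 !andbT; lra.
have eta0 : 0 < eta by rewrite /eta; lra.
have : eta < Num.min (d / 2) (Num.min d1 d3) by rewrite /eta; lra.
rewrite !lt_min => /and3P[etad eta1 eta3].
pose w (t : R) : cplx R := (u1 + t * (u2 - u1)) +i* eta.
have wdist t u : cmod (w t - w u : R[i]) = `|t - u| * `|u2 - u1|.
  have -> : (w t - w u : R[i]) = ((t - u) * (u2 - u1))%:C.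
    by apply: complex_eq; rewrite /w /=; ring.
  by rewrite cmod_real normrM.
have w0 t : w t != 0 by apply/eqP => -[_ h]; move: eta0; rewrite h ltxx.
have w1 t : w t != 1 by apply/eqP => -[_ h]; move: eta0; rewrite h ltxx.
have cont (t : R) : {for t, continuous (fun u => bf (w u))}.
  apply/cvgrPdist_lt => e ep.
  have /cont_atP/(_ e ep)/nbhs_complexP[dd dd0 hdd] := boundary_fun_continuous (w0 t) (w1 t).
  have q0 : 0 < dd / (`|u2 - u1| + 1) by rewrite divr_gt0 // ltr_wpDl.
  apply: filterS (near_dist_lt t q0) => u hu; apply: hdd; rewrite wdist distrC.
  apply: le_lt_trans (_ : `|t - u| * (`|u2 - u1| + 1) < _); first by rewrite ler_wpM2l // lerDl.
  by rewrite -ltr_pdivlMr // ltr_wpDl.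
have s1 : bf (w 0) < 0.
  have := hd1 (w 0); have -> : (w 0 - u1%:C : R[i]) = 0 +i* eta.
    by apply: complex_eq; rewrite /w /=; ring.
  rewrite cmodE /= expr0n add0r sqrtr_sqr gtr0_norm // => /(_ eta1).
  by rewrite ltr_norml -/(bf _) -/(bf _); lra.
have s2 : 0 < bf (w 1).
  have := hd3 (w 1); have -> : (w 1 - u2%:C : R[i]) = 0 +i* eta.
    by apply: complex_eq; rewrite /w /=; ring.
  rewrite cmodE /= expr0n add0r sqrtr_sqr gtr0_norm // => /(_ eta3).
  by rewrite ltr_norml -/(bf _) -/(bf _); lra.
have [||t] := @IVT R (fun u => bf (w u)) 0 1 0 ler01.
- by apply: continuous_in_subspaceT => t _; exact: cont.
- by rewrite ge_min le_max (ltW s1) (ltW s2) orbT.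
rewrite in_itv /= => /andP[t0 t1] gw; exists (w t); split.
  by apply: boundary_line_nonreal => //=; rewrite gt_eqF.
apply: hB; apply: le_lt_trans (cmod_le_ReIm _) _; rewrite cReD cImD cReN cImN zi subr0 /=.
rewrite (gtr0_norm eta0); have : `|u1 + t * (u2 - u1) - Re z| <= d / 2; last by lra.
move: h1 h2; rewrite !ltr_norml ler_norml => /andP[h1 h1'] /andP[h2 h2'].
by apply/andP; split; nra.
Qed.

(** The line separates the open sets O1 and O2 where the function is negative and
    positive.  Since 1 and 0 need not be on the line, they are added to O1 and
    O2.  A component meeting O1 is included in it, hence bounded. *)
Lemma exterior_boundary_fun_gt0 z : z != 0 -> z != 1 -> exterior (@boundary_line R) z -> 0 < bf z.
Proof.
move=> z0 z1 [zB unb]; rewrite ltNge; apply/negP => gz; apply: unb.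
have zeros w : w != 0 -> w != 1 -> bf w = 0 -> boundary_line w.
  move=> w0 w1 gw; have [wi|wi] := eqVneq (Im w) 0; first exact: boundary_line_real.
  by apply: subset_closure; exact: boundary_line_nonreal.
pose O1 : set (cplx R) := [set w | w = 1 \/ [/\ w != 0, w != 1 & bf w < 0]].
pose O2 : set (cplx R) := [set w | w = 0 \/ [/\ w != 0, w != 1 & 0 < bf w]].
have near_ne (w v : cplx R) : w != v -> \forall u \near w, u != v.
  move=> wv; apply/nbhs_complexP; exists (cmod (v - w : R[i])).
    by rewrite cmod_gt0 subr_eq0 eq_sym.
  by move=> u; apply: contraTneq => ->; rewrite ltxx.
have O1o : open O1.
  rewrite openE => w [->|[w0 w1 gw]]; rewrite /interior.
    have h1 := boundary_fun_near1; have h2 := near_ne 1 0 (oner_neq0 _).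
    apply: filterS2 h1 h2 => u hu u0; have [->|u1] := eqVneq u 1; first by left.
    by right; split=> //; exact: hu.
  have /cont_atP/(_ (- bf w)) := boundary_fun_continuous w0 w1; rewrite oppr_gt0 => /(_ gw) h1.
  apply: filterS3 h1 (near_ne _ _ w0) (near_ne _ _ w1) => u hu u0 u1; right; split=> //.
  by move: hu; rewrite -/(bf _) -/(bf _) ltr_norml; lra.
have O2o : open O2.
  rewrite openE => w [->|[w0 w1 gw]]; rewrite /interior.
    have h1 := boundary_fun_near0.
    have h2 : \forall u \near (0 : cplx R), u != 1 by apply: near_ne; rewrite eq_sym oner_neq0.
    apply: filterS2 h1 h2 => u hu u1; have [->|u0] := eqVneq u 0; first by left.
    by right; split=> //; exact: hu.
  have /cont_atP/(_ (bf w) gw) h1 := boundary_fun_continuous w0 w1.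
  apply: filterS3 h1 (near_ne _ _ w0) (near_ne _ _ w1) => u hu u0 u1; right; split=> //.
  by move: hu; rewrite -/(bf _) -/(bf _) ltr_norml; lra.
have disj w : O1 w -> ~ O2 w.
  move=> [->|[w0 w1 gw]] [e|[v0 v1 gv]].
  - by move/eqP: e; rewrite oner_eq0.
  - by rewrite eqxx in v1.
  - by rewrite e eqxx in w0.
  - by move: gw; rewrite ltNge ltW.
have cover w : (~` @boundary_line R) w -> O1 w \/ O2 w.
  move=> wB; have [->|w0] := eqVneq w 0; first by right; left.
  have [->|w1] := eqVneq w 1; first by left; left.
  have [g|g|g] := ltrgt0P (bf w); first by right; right.
    by left; right.
  by exfalso; apply: wB; exact: zeros.
have zO : O1 z.
  have [//|[e|[_ _ g]]] := cover z zB; first by rewrite e eqxx in z0.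
  by exfalso; move: gz; rewrite leNgt g.
have sub : connected_component (~` @boundary_line R) z `<=` O1.
  move=> w [C [Cz CB Cc] Cw].
  suff E : C `&` O1 = C by have [] : (C `&` O1) w by rewrite E.
  apply: Cc; first by exists z.
    by exists O1.
  exists (~` O2); first exact: open_closedC.
  apply/seteqP; split=> u [Cu]; first by move=> /disj.
  by move=> nO2; split=> //; have [] := cover u (CB u Cu).
exists (expR 16)%:C; split; first by rewrite complex_real.
move=> M hM w /sub wO /=; apply: ltW; apply: le_lt_trans hM.
have -> : `|w| = (cmod (w : R[i]))%:C by exact: normc_cmod.
rewrite lecR; case: wO => [->|[w0 w1 gw]].
  by rewrite cmod1; have := @expR_ge1Dx R 16; lra.
by rewrite leNgt; apply/negP => /ltW /boundary_fun_far; rewrite ltNge ltW.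
Qed.

End BoundaryLine.

Theorem theorem20 (R : realType) :
  (forall s : R[i], complex.Im s < 0 ->
     convergence_radius (lambert_coef s) = (tau_star_minus s)%:E) /\
  (forall s : R[i], 0 < complex.Im s ->
     convergence_radius (lambert_coef s) = (tau_star_plus s)%:E) /\
  (forall z : cplx R, z != 0 -> z != 1 ->
     exterior (@boundary_line R) z ->
     cvgn (cpseries (lambert_coef (sigma z)) (tau z))).
Proof.
split; first exact: convergence_radius_minus.
split; first exact: convergence_radius_plus.
move=> z z0 z1 zext; apply: boundary_fun_cvg => //.
exact: exterior_boundary_fun_gt0.
Qed.
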